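(* For any $Y$-pin $S=\{a,b,c,d\}$ with $D(S)\ge2$, $$m_2(S)=\max(c_2-a_2,\;d_2-b_2).$$
   Context: Y-pin: a set $S=\{a,b,c,d\}$ of four distinct points of $\mathbb{Z}^2$, with coordinates $a=(a_1,a_2)$ etc., labelled so that $a_2\le b_2<c_2\le d_2$, and such that the vectors $b-a,c-a,d-a$ generate $\mathbb{Z}^2$. $D(S)=2\alpha-1$, where $\alpha$ is the area of the convex hull of $S$. $\mathcal{U}_{2,m}$ is the space of $m$-tuples $(A^{(1)},\dots,A^{(m)})$ of infinite polygons $A^{(j)}=(A^{(j)}_i)_{i\in\mathbb{Z}}$ in $\mathbb{RP}^2$, modulo projective equivalence; write $P_{i,j}=A^{(j)}_i$. $\langle A,B\rangle$ is the line through $A$ and $B$. The map $T_{2,S}$: let $m=d_2-a_2$. $X_{2,S}\subseteq\mathcal{U}_{2,m}$ is the set of $A$ such that (L1) $P_{r+a},P_{r+b},P_{r+c}$ are collinear for all $r\in\mathbb{Z}^2$ with $-a_2<r_2\le m-c_2$, and (L2) $P_{r+b},P_{r+c},P_{r+d}$ are collinear for all $r$ with $-b_2<r_2\le m-d_2$. The birational map $T_{2,S}:X_{2,S}\to X_{2,S}$ is $T_{2,S}(A^{(1)},\dots,A^{(m)})=(A^{(2)},\dots,A^{(m+1)})$, where row $m+1$ is defined by $P_{r+c+d}=\langle P_{r+a+c},P_{r+b+c}\rangle\cap\langle P_{r+a+d},P_{r+b+d}\rangle$ for $r_2=m+1-c_2-d_2$. S-map: a birational map $F:X\to X$, $X\subseteq\mathcal{U}_{2,m'}$,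 of the form $(A^{(1)},\dots,A^{(m')})\mapsto(A^{(2)},\dots,A^{(m'+1)})$, such that generic $A\in X$ spans $\mathbb{RP}^2$ and, on iterating $F^{\pm1}$ to define all $P_{i,j}=A^{(j)}_i$, for generic $A\in X$ the points $P_{r+a},P_{r+b},P_{r+c},P_{r+d}$ are collinear and distinct for all $r\in\mathbb{Z}^2$; $m'$ is its order. $m_2(S)$ denotes the smallest order to which $T_{2,S}$ can be reduced, i.e. the smallest $m'\le m$ for which there is an $S$-map $F:X'\to X'$, $X'\subseteq\mathcal{U}_{2,m'}$, of order $m'$ such that a generic $A\in X_{2,S}$ is determined by its first $m'$ rows $(A^{(1)},\dots,A^{(m')})\in X'$ by applying $F$ (namely $m-m'$ times) to produce the remaining rows. *)

(* Defs.v *)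
From HB Require Import structures.
From mathcomp Require Import all_boot all_order all_algebra.
From mathcomp Require Import all_classical all_reals all_analysis.
(* Not imported: its notations clash with those of mathcomp-analysis. *)
From mathcomp Require mpoly.

Set Implicit Arguments.
Unset Strict Implicit.
Unset Printing Implicit Defensive.

Import Order.TTheory GRing.Theory Num.Theory.
Local Open Scope classical_set_scope.
Local Open Scope ring_scope.

Notation Z2 := (int * int)%type.

Record Ypin := MkYpin {
  pa : Z2;
  pb : Z2;
  pc : Z2;
  pd : Z2;
  _ : uniq [:: pa; pb; pc; pd];
  _ : (pa.2 <= pb.2) && (pb.2 < pc.2) && (pc.2 <= pd.2);
  _ : forall z : Z2, exists x y t : int,
        z = (pb - pa) *~ x + (pc - pa) *~ y + (pd - pa) *~ t
}.

Definition point_of_Z2 (R : realType) (z : Z2) : R * R := (z.1%:~R, z.2%:~R).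

Definition hull4 (R : realType) (p q s t : R * R) : set (R * R) :=
  [set z | exists w1 w2 w3 w4 : R,
     [/\ 0 <= w1, 0 <= w2, 0 <= w3 & 0 <= w4] /\
     [/\ w1 + w2 + w3 + w4 = 1,
         z.1 = w1 * p.1 + w2 * q.1 + w3 * s.1 + w4 * t.1 &
         z.2 = w1 * p.2 + w2 * q.2 + w3 * s.2 + w4 * t.2]].

Definition hull_area (R : realType) (S : Ypin) : \bar R :=
  ((@lebesgue_measure R) \x (@lebesgue_measure R))%E
    (hull4 (point_of_Z2 R (pa S)) (point_of_Z2 R (pb S))
           (point_of_Z2 R (pc S)) (point_of_Z2 R (pd S))).

Definition D (R : realType) (S : Ypin) : \bar R :=
  (2%:E * hull_area R S - 1%:E)%E.

(* The real projective plane: points are the lines through 0 in R^3; a line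
   of the plane is a subspace of dimension 2, the line through two distinct
   points is their sum. *)
Definition RP2 (R : realType) :=
  {L : {vspace 'rV[R]_3} | \dim L == 1%N}.

Definition line_through (R : realType) (p q : RP2 R) : {vspace 'rV[R]_3} :=
  (val p + val q)%VS.

Definition collinear (R : realType) (p q s : RP2 R) : Prop :=
  (\dim (val p + val q + val s) <= 2)%N.

Definition collinear4 (R : realType) (p q s t : RP2 R) : Prop :=
  (\dim (val p + val q + val s + val t) <= 2)%N.

(* m-tuples of infinite polygons; the paper's A^(j)_i is [A (j-1) i]. *)
Definition polygons (R : realType) (m : nat) := 'I_m -> int -> RP2 R.

(* A doubly infinite array; the paper's P_{i,j} is [P (i, j)]. *)
Definition mesh (R : realType) := Z2 -> RP2 R.

(* The rows k+1, ..., k+m of a mesh. *)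
Definition rows (R : realType) (m : nat) (k : int) (P : mesh R)
  : polygons R m := fun j i => P (i, k + j.+1%:Z).
Arguments rows {R} m k P.

(* Projective equivalence. Instead of forming the quotient U_{2,m}, we use
   subsets of [polygons R m] stable under PGL_3 and equivariant maps. *)
Definition proj_transform (R : realType) (g : 'M[R]_3) (p q : RP2 R) : Prop :=
  val q = (linfun (mulmxr g) @: val p)%VS.

Definition PGL_stable (R : realType) (m : nat) (X : set (polygons R m)) :=
  forall (g : 'M[R]_3) (A B : polygons R m), g \in unitmx ->
    (forall j i, proj_transform g (A j i) (B j i)) -> X A -> X B.

Definition lifts (R : realType) (m : nat)
    (v : 'I_m -> int -> 'rV[R]_3) (A : polygons R m) : Prop :=
  forall j i, val (A j i) = <[v j i]>%VS.

(* Polynomials in (finitely many of) the homogeneous coordinates of the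
   points of an m-tuple of polygons. *)
Record cpoly (R : realType) (m : nat) := CPoly {
  cnum : nat;
  cvar : 'I_cnum -> 'I_m * int * 'I_3;
  cpol : mpoly.mpoly cnum R
}.
Arguments cvar {R m} c k.

Definition ceval (R : realType) (m : nat) (f : cpoly R m)
    (v : 'I_m -> int -> 'rV[R]_3) : R :=
  mpoly.meval (fun k => let: (j, i, l) := cvar f k in v j i 0 l) (cpol f).

(* f need not be multihomogeneous: as it has to vanish at all the lifts of A,
   this means that all its multihomogeneous components vanish at A. *)
Definition vanishes (R : realType) (m : nat) (f : cpoly R m)
    (A : polygons R m) : Prop :=
  forall v, lifts v A -> ceval f v = 0.

Definition zclosed (R : realType) (m : nat) (X : set (polygons R m)) : Prop :=
  exists I : set (cpoly R m), X = [set A | forall f, I f -> vanishes f A].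

Definition zclosure (R : realType) (m : nat) (X : set (polygons R m))
  : set (polygons R m) :=
  [set A | forall f, (forall B, X B -> vanishes f B) -> vanishes f A].

Definition zirreducible (R : realType) (m : nat) (X : set (polygons R m)) :=
  X !=set0 /\
  forall C1 C2 : set (polygons R m), zclosed C1 -> zclosed C2 ->
    X `<=` C1 `|` C2 -> X `<=` C1 \/ X `<=` C2.

(* A property holds for generic A in X if it holds on a Zariski-dense
   intersection of countably many Zariski-open subsets of X: as there are
   infinitely many points, a single open subset would not do. *)
Definition generic (R : realType) (m : nat) (X : set (polygons R m))
    (Q : polygons R m -> Prop) : Prop :=
  exists O : nat -> set (polygons R m),
    [/\ forall n, zclosed (~` O n),
        X `<=` zclosure (X `&` \bigcap_n O n) &
        forall A, X A -> (forall n, O n A) -> Q A].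

(* A rational map from m-tuples of polygons to polygons, given for each i by
   the three homogeneous coordinates of the i-th point of the value. *)
Definition ratrow (R : realType) (m : nat) := int -> 'I_3 -> cpoly R m.

(* phi is defined at A, with value B; the span being a point, the coordinates
   do not all vanish. *)
Definition row_value (R : realType) (m : nat) (phi : ratrow R m)
    (A : polygons R m) (B : int -> RP2 R) : Prop :=
  forall i v, lifts v A -> val (B i) = <[\row_l ceval (phi i l) v]>%VS.

Definition PGL_equivariant (R : realType) (m : nat) (X : set (polygons R m))
    (phi : ratrow R m) : Prop :=
  forall (g : 'M[R]_3) (A A' : polygons R m) (B B' : int -> RP2 R),
    g \in unitmx -> X A -> X A' ->
    (forall j i, proj_transform g (A j i) (A' j i)) ->
    row_value phi A B -> row_value phi A' B' ->
    forall i, proj_transform g (B i) (B' i).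

(* The map F : (A^(1),...,A^(m)) |-> (A^(2),...,A^(m+1)), with A^(m+1) given
   by phi, is defined at rows k+1, ..., k+m of P and sends them to rows
   k+2, ..., k+m+1. *)
Definition fwd_at (R : realType) (m : nat) (phi : ratrow R m) (P : mesh R)
    (k : int) : Prop :=
  row_value phi (rows m k P) (fun i => P (i, k + m.+1%:Z)).

(* The map (A^(2),...,A^(m+1)) |-> (A^(1),...,A^(m)), with A^(1) given by psi,
   is defined at rows k+2, ..., k+m+1 of P and sends them to rows
   k+1, ..., k+m. *)
Definition bwd_at (R : realType) (m : nat) (psi : ratrow R m) (P : mesh R)
    (k : int) : Prop :=
  row_value psi (rows m (k + 1) P) (fun i => P (i, k + 1)).

(* phi and psi define mutually inverse rational maps from X to X *)
Definition birational_pair (R : realType) (m : nat) (X : set (polygons R m))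
    (phi psi : ratrow R m) : Prop :=
  generic X (fun A => exists P : mesh R,
    [/\ rows m 0 P = A, fwd_at phi P 0, X (rows m 1 P) & bwd_at psi P 0]) /\
  generic X (fun A => exists P : mesh R,
    [/\ rows m 0 P = A, bwd_at psi P (-1), X (rows m (-1) P) &
        fwd_at phi P (-1)]).

Definition spanning (R : realType) (m : nat) (A : polygons R m) : Prop :=
  forall V : {vspace 'rV[R]_3},
    (forall j i, (val (A j i) <= V)%VS) -> V = fullv.

Definition collinear_distinct (R : realType) (S : Ypin) (P : mesh R) : Prop :=
  forall r : Z2,
    collinear4 (P (r + pa S)) (P (r + pb S)) (P (r + pc S)) (P (r + pd S)) /\
    uniq [:: P (r + pa S); P (r + pb S); P (r + pc S); P (r + pd S)].

Definition is_Smap (R : realType) (S : Ypin) (m : nat)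
    (X : set (polygons R m)) (phi : ratrow R m) : Prop :=
  [/\ zclosed X, zirreducible X & PGL_stable X] /\
  generic X (@spanning R m) /\
  exists psi : ratrow R m,
    [/\ PGL_equivariant X phi, PGL_equivariant X psi,
        birational_pair X phi psi &
        generic X (fun A => exists P : mesh R,
          [/\ rows m 0 P = A,
              forall k : int,
                [/\ X (rows m k P), fwd_at phi P k & bwd_at psi P k] &
              collinear_distinct S P])].

Definition order2 (S : Ypin) : nat := `|(pd S).2 - (pa S).2|%N.

(* The ranges of r for which the condition (L1), resp. (L2), is imposed. *)
Definition L1_range (S : Ypin) (r : Z2) : Prop :=
  - (pa S).2 < r.2 <= (order2 S)%:Z - (pc S).2.

Definition L2_range (S : Ypin) (r : Z2) : Prop :=
  - (pb S).2 < r.2 <= (order2 S)%:Z - (pd S).2.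

Definition X2 (R : realType) (S : Ypin) : set (polygons R (order2 S)) :=
  [set A | exists P : mesh R,
    [/\ rows (order2 S) 0 P = A,
        forall r, L1_range S r ->
          collinear (P (r + pa S)) (P (r + pb S)) (P (r + pc S)) &
        forall r, L2_range S r ->
          collinear (P (r + pb S)) (P (r + pc S)) (P (r + pd S))]].
Arguments X2 R S _ : clear implicits.

(* The relatively open subset of X2 where the incidences (L1), (L2) are
   nondegenerate: the points on each line are distinct, and so are the two
   lines through a point P_{r+c+d} that is subject to both conditions.
   X2 itself also contains degenerate arrays, such as the constant ones;
   generic elements of X_{2,S} are those generic in X2_reg. *)
Definition X2_reg (R : realType) (S : Ypin) : set (polygons R (order2 S)) :=
  [set A | X2 R S A /\ exists P : mesh R,
    [/\ rows (order2 S) 0 P = A,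
        forall r, L1_range S r ->
          uniq [:: P (r + pa S); P (r + pb S); P (r + pc S)],
        forall r, L2_range S r ->
          uniq [:: P (r + pb S); P (r + pc S); P (r + pd S)] &
        forall r, L1_range S (r + pd S) -> L2_range S (r + pc S) ->
          line_through (P (r + pa S + pd S)) (P (r + pb S + pd S)) <>
          line_through (P (r + pb S + pc S)) (P (r + pc S + pc S))]].
Arguments X2_reg R S _ : clear implicits.

Definition reducible_to (R : realType) (S : Ypin) (m' : nat) : Prop :=
  (m' <= order2 S)%N /\
  exists (X' : set (polygons R m')) (phi : ratrow R m'),
    is_Smap S X' phi /\
    generic (X2_reg R S) (fun A => exists P : mesh R,
      [/\ rows (order2 S) 0 P = A,
          forall k : nat, (k + m' <= order2 S)%N -> X' (rows m' k%:Z P) &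
          forall k : nat, (k + m' < order2 S)%N -> fwd_at phi P k%:Z]).

(* The smallest order to which T_{2,S} can be reduced (0 if there is none). *)
Definition m2 (R : realType) (S : Ypin) : nat :=
  xget 0%N [set n : nat | reducible_to R S n /\
    forall k : nat, reducible_to R S k -> (n <= k)%N].

(* Main.v *)
Require Import Defs.
From mathcomp Require Import all_boot all_order all_algebra.
From mathcomp Require Import all_classical all_reals all_analysis.
From mathcomp Require Import measurable_realfun.
From mathcomp Require Import ring lra zify.
From mathcomp Require mpoly complex polyrcf.

Set Implicit Arguments.
Unset Strict Implicit.
Unset Printing Implicit Defensive.

Import Order.TTheory GRing.Theory Num.Theory.
Import (canonicals) mpoly complex.
Local Open Scope ring_scope.

(** Let M = max(c_2 - a_2, d_2 - b_2). In M consecutive rows only one of the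
    conditions (L1), (L2) can occur, so such a window is obtained by choosing
    some points freely and the others on lines through two earlier points. In
    the rows above (resp. below), each point is the intersection of two known lines,
    those of the two copies of S in which it has the roles c and d (resp. a and b).
    Call a mesh good if all the incidences hold and nothing degenerates. Any two
    windows are joined by a polynomial path in the space of windows, and a real polynomial path
    through one good mesh consists of good meshes outside of a countable set.
    Hence, as soon as one good mesh exists, good windows are dense and
    irreducible, which makes the extension map an S-map of order M, and the good
    arrays are dense in X_{2,S}.

    The order cannot be smaller: with the coefficients of the linear relations
    between the lifts fixed, a single point of row k+1 <= M can be moved without
    changing the rows 1, ..., k, so that these do not determine row k+1.

    A good mesh is obtained from the primitive affine relation
    sum_x n_x x = 0, sum_x n_x = 0, between the four points of S. Let w be a real
    cubic dividing prod_(n_x > 0) (X - s_x)^(n_x) - k prod_(n_x < 0) (X - s_x)^(-n_x)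
    with distinct s_x, and take P_z to be the class of chi(z) in P(R[X]/w), where
    chi is a character of Z^2 for which chi(x - y) is proportional to
    (X - s_x) / (X - s_y); then the points P_{r+x} are the multiples by a unit of
    linear polynomials, hence collinear. The polynomial divided by w has as degree
    twice the area of the hull of S, so a cubic w exists once this is at least 3. *)

(** * Plane projective geometry in homogeneous coordinates *)

Section Vectors.
Variable F : fieldType.
Implicit Types (u v w z : 'rV[F]_3) (x y c : F).

Definition vec3 x y c : 'rV[F]_3 := \row_(i < 3) nth 0 [:: x; y; c] i.

Definition det3 u v w : F :=
  u 0 0 * (v 0 1 * w 0 2 - v 0 2 * w 0 1)
  - u 0 1 * (v 0 0 * w 0 2 - v 0 2 * w 0 0)
  + u 0 2 * (v 0 0 * w 0 1 - v 0 1 * w 0 0).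

Definition cross u v : 'rV[F]_3 :=
  vec3 (u 0 1 * v 0 2 - u 0 2 * v 0 1) (u 0 2 * v 0 0 - u 0 0 * v 0 2)
       (u 0 0 * v 0 1 - u 0 1 * v 0 0).

(* A vector on both lines <u, v> and <w, z>: it spans their intersection, and
   is 0 exactly when the lines coincide. *)
Definition meet u v w z : 'rV[F]_3 := det3 u v z *: w - det3 u v w *: z.

Lemma ord3P (P : 'I_3 -> Prop) : P 0 -> P 1 -> P 2 -> forall i, P i.
Proof.
move=> P0 P1 P2 i.
have -> : i = nth 0 [:: 0; 1; 2] i.
  by apply: val_inj; case: i => [[|[|[|]]]].
by case: i => [[|[|[|]]]].
Qed.

Lemma row3P u v : u 0 0 = v 0 0 -> u 0 1 = v 0 1 -> u 0 2 = v 0 2 -> u = v.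
Proof. by move=> *; apply/rowP; apply: ord3P. Qed.

Ltac vec := rewrite /meet /cross /det3 /vec3; apply: row3P; rewrite !mxE /=; ring.

Definition propto u v := exists2 c, c != 0 & u = c *: v.

Lemma propto_refl u : propto u u.
Proof. by exists 1; rewrite ?oner_neq0 ?scale1r. Qed.

Lemma propto_sym u v : propto u v -> propto v u.
Proof.
by case=> c c0 ->; exists c^-1; rewrite ?invr_eq0 // scalerA mulVf ?scale1r.
Qed.

Lemma propto_trans u v w : propto u v -> propto v w -> propto u w.
Proof.
by case=> c c0 -> [d d0 ->]; exists (c * d); rewrite ?mulf_neq0 ?scalerA.
Qed.

Lemma propto_neq0 u v : propto u v -> (u != 0) = (v != 0).
Proof. by case=> c c0 ->; rewrite scaler_eq0 (negPf c0). Qed.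

Lemma det3_combr u v x y : det3 u v (x *: u + y *: v) = 0.
Proof. by rewrite /det3 !mxE; ring. Qed.

Lemma det3_uvu u v : det3 u v u = 0.
Proof. by rewrite /det3; ring. Qed.

Lemma det3_uvv u v : det3 u v v = 0.
Proof. by rewrite /det3; ring. Qed.

Lemma det3_rot u v w : det3 u v w = det3 v w u.
Proof. by rewrite /det3; ring. Qed.

Lemma det3Z x y c u v w :
  det3 (x *: u) (y *: v) (c *: w) = x * y * c * det3 u v w.
Proof. by rewrite /det3 !mxE; ring. Qed.

Lemma det3_mulmx (g : 'M[F]_3) u v w :
  det3 (u *m g) (v *m g) (w *m g) = \det g * det3 u v w.
Proof.
have det3E (u' v' w' : 'rV_3) :
    det3 u' v' w' = \det (\matrix_(i < 3) nth 0 [:: u'; v'; w'] i).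
  have e1 : lift 0 0 = 1 :> 'I_3 by apply: val_inj.
  have e2 : lift 0 (lift 0 0) = 2 :> 'I_3 by apply: val_inj.
  have e3 : lift 1 0 = 0 :> 'I_3 by apply: val_inj.
  have e4 : lift 1 (lift 0 0) = 2 :> 'I_3 by apply: val_inj.
  have e5 : lift 2 0 = 0 :> 'I_3 by apply: val_inj.
  have e6 : lift 2 (lift 0 0) = 1 :> 'I_3 by apply: val_inj.
  rewrite (expand_det_row _ 0) !big_ord_recl big_ord0 /cofactor.
  rewrite !(expand_det_row _ (0 : 'I_2)) !big_ord_recl !big_ord0 /cofactor !det_mx11.
  rewrite !mxE /= !e1 !e2 ?(e3, e4, e5, e6) /= ?e2 /det3.
  have e7 : lift ord0 (lift (lift ord0 ord0) 0) = 1 :> 'I_3 by apply: val_inj.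
  have e8 : lift 1 (lift (lift ord0 ord0) 0) = 0 :> 'I_3 by apply: val_inj.
  have e9 : lift 2 (lift (lift ord0 ord0) 0) = 0 :> 'I_3 by apply: val_inj.
  by rewrite /= e7 e8 e9 /bump /=; ring.
rewrite !det3E mulrC -det_mulmx; congr (\det _).
by apply/row_matrixP; apply: ord3P; rewrite row_mul !rowK.
Qed.

Lemma cramer u v w z :
  det3 u v z *: w = det3 w v z *: u + det3 u w z *: v + det3 u v w *: z.
Proof. vec. Qed.

(** [cross u v] is the coefficient vector of the linear form [det3 u v], so it vanishes as soon as
    this form is zero on the three unit vectors. *)
Lemma cross_neq0P u v : reflect (exists w, det3 u v w != 0) (cross u v != 0).
Proof.
have key w : det3 u v w =
    cross u v 0 0 * w 0 0 + cross u v 0 1 * w 0 1 + cross u v 0 2 * w 0 2.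
  by rewrite /det3 /cross /vec3 !mxE /=; ring.
apply: (iffP idP) => [|[w]]; last first.
  by apply: contraNneq => uv0; rewrite key uv0 !mxE; apply/eqP; ring.
move=> uv0; apply/not_existsP => dn0; case/negP: uv0; apply/eqP.
have {}dn0 w : det3 u v w = 0 by apply/eqP/negPn/negP; exact: dn0.
have := key (vec3 1 0 0); have := key (vec3 0 1 0); have := key (vec3 0 0 1).
rewrite !dn0 ![vec3 _ _ _ _ _]mxE /= => k2 k1 k0.
apply: row3P; rewrite [RHS]mxE.
- by rewrite [RHS]k0 [LHS]mxE /=; ring.
- by rewrite [RHS]k1 [LHS]mxE /=; ring.
- by rewrite [RHS]k2 [LHS]mxE /=; ring.
Qed.

Lemma det3_eq0_comb u v w : cross u v != 0 -> det3 u v w = 0 ->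
  exists x y, w = x *: u + y *: v.
Proof.
move=> /cross_neq0P[z dz] dw.
exists (det3 w v z / det3 u v z), (det3 u w z / det3 u v z).
apply: (scalerI dz); rewrite cramer dw scale0r addr0 scalerDr !scalerA.
by congr (_ *: _ + _ *: _); field.
Qed.

(** Choose w with [cross u w != 0]. As [det3 u w v] is zero, v = x u + y w; then [cross u v] is y
    times [cross u w], which forces y = 0. *)
Lemma cross_eq0_prop u v : u != 0 -> cross u v = 0 -> exists x, v = x *: u.
Proof.
move=> u0 uv0.
have [w uw] : exists w, cross u w != 0.
  apply/not_existsP => n0; case/negP: u0; apply/eqP.
  have {}n0 w : cross u w = 0 by apply/eqP/negPn/negP; exact: n0.
  have := n0 (vec3 1 0 0); have := n0 (vec3 0 1 0).
  move=> /rowP e1 /rowP e0.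
  have := e0 2; have := e0 1; have := e1 2.
  rewrite /cross /vec3 !mxE /= => h0 h2 h1; apply: row3P; rewrite [RHS]mxE.
  - by rewrite -[RHS]h0; ring.
  - by apply: oppr_inj; rewrite oppr0 -[RHS]h1; ring.
  - by rewrite -[RHS]h2; ring.
have [|x [y e]] := @det3_eq0_comb u w v uw.
  apply/eqP/negPn/negP => d0.
  have /cross_neq0P : exists z, det3 u v z != 0.
    by exists w; rewrite -oppr_eq0 in d0; move: d0; rewrite /det3; congr (_ != 0); ring.
  by rewrite uv0 eqxx.
exists x; rewrite e; suff -> : y = 0 by rewrite scale0r addr0.
apply/eqP/negPn/negP => y0; move: uv0; rewrite e => uv0; case/negP: uw.
apply/eqP/(scalerI y0); rewrite scaler0 -[RHS]uv0; vec.
Qed.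

Lemma crossZ x y u v : cross (x *: u) (y *: v) = (x * y) *: cross u v.
Proof. vec. Qed.

Lemma cross_swap u v : cross u v = - cross v u.
Proof. vec. Qed.

Lemma cross_proptoE u v : propto u v -> cross u v = 0.
Proof. by case=> x _ ->; vec. Qed.

Lemma cross_neq0l u v : cross u v != 0 -> u != 0.
Proof. by apply: contraNneq => ->; apply/eqP; vec. Qed.

Lemma cross_mulmx (g : 'M[F]_3) u v : g \in unitmx ->
  (cross (u *m g) (v *m g) != 0) = (cross u v != 0).
Proof.
rewrite unitmxE unitfE => g0; apply/cross_neq0P/cross_neq0P => -[w].
  move=> d0; exists (w *m invmx g); apply: contraNneq d0 => d0.
  by rewrite -[w](mulmxKV (_ : g \in unitmx)) ?det3_mulmx ?d0 ?mulr0 // unitmxE unitfE.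
by move=> d0; exists (w *m g); rewrite det3_mulmx mulf_neq0.
Qed.

Lemma meetZ x y c c' u v w z :
  meet (x *: u) (y *: v) (c *: w) (c' *: z) = (x * y * c * c') *: meet u v w z.
Proof. vec. Qed.

Lemma meet_propto u v w z u' v' w' z' : propto u' u -> propto v' v ->
  propto w' w -> propto z' z -> propto (meet u' v' w' z') (meet u v w z).
Proof.
move=> [a a0 ->] [b b0 ->] [c c0 ->] [d d0 ->].
by exists (a * b * c * d); rewrite ?mulf_neq0 ?meetZ.
Qed.

Lemma cross_propto u v u' v' : propto u' u -> propto v' v ->
  propto (cross u' v') (cross u v).
Proof.
by move=> [a a0 ->] [b b0 ->]; exists (a * b); rewrite ?mulf_neq0 ?crossZ.
Qed.

Lemma det3_propto u v w u' v' w' : propto u' u -> propto v' v ->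
  propto w' w -> (det3 u' v' w' == 0) = (det3 u v w == 0).
Proof.
move=> [a a0 ->] [b b0 ->] [c c0 ->].
by rewrite det3Z mulf_eq0 (negPf (mulf_neq0 (mulf_neq0 a0 b0) c0)).
Qed.

Lemma meet_mulmx (g : 'M[F]_3) u v w z :
  meet (u *m g) (v *m g) (w *m g) (z *m g) = \det g *: (meet u v w z *m g).
Proof.
by rewrite /meet !det3_mulmx mulmxBl -!scalemxAl scalerBr !scalerA.
Qed.

Lemma det3_meetl u v w z : det3 u v (meet u v w z) = 0.
Proof. by rewrite /meet /det3 !mxE; ring. Qed.

Lemma det3_meetr u v w z : det3 w z (meet u v w z) = 0.
Proof. by rewrite /meet /det3 !mxE; ring. Qed.

(** The cross product of w with the meet is, up to sign, [det3 u v w] times [cross w z]. *)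
Lemma meet_neq0 u v w z : cross w z != 0 -> det3 u v w != 0 ->
  meet u v w z != 0.
Proof.
move=> wz0 d0; apply: contraNneq wz0 => m0; apply/eqP/(scalerI d0).
rewrite scaler0; have -> : det3 u v w *: cross w z = - cross w (meet u v w z) by vec.
by rewrite m0; vec.
Qed.

(** The point p has coordinates (x, y) on the line <w, z>, subject to x det(u, v, w) + y det(u, v,
    z) = 0. One of these determinants is nonzero because the meet is, so (x, y) is determined up to
    a factor. *)
Lemma meet_prop u v w z p : cross w z != 0 -> meet u v w z != 0 -> p != 0 ->
  det3 u v p = 0 -> det3 w z p = 0 -> propto p (meet u v w z).
Proof.
move=> wz0 m0 p0 uvp wzp; have [x [y e]] := det3_eq0_comb wz0 wzp.
have {}uvp : x * det3 u v w + y * det3 u v z = 0.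
  by rewrite -uvp e /det3 !mxE; ring.
move: p0; rewrite {p wzp}e => p0.
suff [c ec] : exists c, x *: w + y *: z = c *: meet u v w z.
  by exists c => //; apply: contraNneq p0 => c0; rewrite ec c0 scale0r.
have [dz|dz] := eqVneq (det3 u v z) 0; last first.
  have -> : y = - (x * det3 u v w) / det3 u v z.
    by apply: (mulIf dz); rewrite mulfVK //; apply/eqP; rewrite -addr_eq0 addrC uvp.
  exists (x / det3 u v z); rewrite /meet scalerBr !scalerA -scaleNr.
  by congr (_ *: _ + _ *: _); field.
have dw : det3 u v w != 0.
  by apply: contraNneq m0 => dw; rewrite /meet dz dw !scale0r subr0.
have -> : x = - (y * det3 u v z) / det3 u v w.
  by apply: (mulIf dw); rewrite mulfVK //; apply/eqP; rewrite -addr_eq0 uvp.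
exists (- y / det3 u v w); rewrite /meet scalerBr !scalerA -scaleNr.
by congr (_ *: _ + _ *: _); field.
Qed.

Lemma det3_eq0_line p q u v w : cross p q != 0 ->
  det3 p q u = 0 -> det3 p q v = 0 -> det3 p q w = 0 -> det3 u v w = 0.
Proof.
move=> pq /(det3_eq0_comb pq)[x [y ->]] /(det3_eq0_comb pq)[x' [y' ->]].
by move=> /(det3_eq0_comb pq)[x'' [y'' ->]]; rewrite /det3 !mxE; ring.
Qed.
End Vectors.

(** * Points of the real projective plane and their homogeneous coordinates *)

Section Points.
Variable R : realType.
Implicit Types (u v w z : 'rV[R]_3) (p q s t : RP2 R).

Lemma RP2_vec p : exists2 v, v != 0 & val p = <[v]>%VS.
Proof.
have dp := eqP (valP p); exists (vpick (val p)).
  by rewrite vpick0 -dimv_eq0 dp.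
apply/esym/eqP; rewrite eqEdim -memvE memv_pick dp dim_vline.
by rewrite vpick0 -dimv_eq0 dp.
Qed.

Lemma RP2_default : \dim <[vec3 1 0 0 : 'rV[R]_3]> == 1%N.
Proof.
rewrite dim_vline eqb1; apply/negP => /eqP/rowP/(_ 0).
by rewrite !mxE /= => /eqP; rewrite oner_eq0.
Qed.

(* The point with homogeneous coordinates v (a junk point if v = 0). *)
Definition pt v : RP2 R :=
  insubd (exist (fun L : {vspace 'rV[R]_3} => \dim L == 1%N) _ RP2_default) <[v]>%VS.

Lemma val_pt v : v != 0 -> val (pt v) = <[v]>%VS.
Proof. by move=> v0; rewrite /pt val_insubd dim_vline v0. Qed.

Lemma vline_neq0 p v : val p = <[v]>%VS -> v != 0.
Proof. by move=> e; have := valP p; rewrite /= e dim_vline eqb1. Qed.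

Lemma vline_eqP u v : u != 0 -> (<[u]> = <[v]>)%VS <-> propto u v.
Proof.
move=> u0; split=> [e|[c c0 ->]].
  have /vlineP[c ec] : (u \in <[v]>)%VS by rewrite -e memv_line.
  by exists c => //; apply: contraNneq u0 => c0; rewrite ec c0 scale0r.
apply/eqP; rewrite eqEsubv -!memvE memvZ ?memv_line //=.
by rewrite -[X in X \in _](scalerK c0) memvZ ?memv_line.
Qed.

Lemma vline_propto p u v : val p = <[u]>%VS -> val p = <[v]>%VS -> propto u v.
Proof. by move=> eu ev; apply/vline_eqP; rewrite -?eu ?(vline_neq0 eu). Qed.

Lemma RP2_neqP p q u v : val p = <[u]>%VS -> val q = <[v]>%VS ->
  (p != q) = (cross u v != 0).
Proof.
move=> eu ev; congr (~~ _); apply/eqP/eqP => [epq|uv0].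
  have [c _ ->] := vline_propto (esym (etrans (esym eu) (congr1 val epq))
     : val q = <[u]>%VS) ev.
  by rewrite -[v in cross _ v]scale1r crossZ /cross /vec3; apply: row3P;
     rewrite !mxE /=; ring.
apply: val_inj; rewrite eu ev.
have [x ex] := cross_eq0_prop (vline_neq0 eu) uv0.
apply/esym/vline_eqP; first exact: vline_neq0 ev.
exists x => //; have := vline_neq0 ev; rewrite ex.
by apply: contraNneq => ->; rewrite scale0r.
Qed.

Lemma subv_line2 (L : {vspace 'rV[R]_3}) v : (<[v]> <= L)%VS = (v \in L).
Proof. by rewrite memvE. Qed.

Lemma dimv_line2 u v : (\dim (<[u]> + <[v]>) <= 2)%N.
Proof.
apply: leq_trans (dimv_add_leqif _ _) _; rewrite !dim_vline.
by case: (u != 0); case: (v != 0).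
Qed.

Lemma memv_line2 u v w : cross u v != 0 ->
  (w \in (<[u]> + <[v]>)%VS) = (det3 u v w == 0).
Proof.
move=> uv; apply/idP/eqP => [/memv_addP[_ /vlineP[x ->]] [_ /vlineP[y ->] ->]|].
  exact: det3_combr.
move/(det3_eq0_comb uv) => [x [y ->]].
by rewrite memv_add ?memvZ ?memv_line.
Qed.

Lemma det3_neq0_full u v w : det3 u v w != 0 ->
  (<[u]> + <[v]> + <[w]>)%VS = fullv.
Proof.
move=> d0; apply/eqP; rewrite eqEsubv subvf /=; apply/subvP => z _.
have e := cramer u v z w; rewrite -(scalerK d0 z) memvZ // e.
by rewrite !memv_add ?memvZ ?memv_line.
Qed.

Lemma collinearP p q s u v w :
  val p = <[u]>%VS -> val q = <[v]>%VS -> val s = <[w]>%VS ->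
  collinear p q s <-> det3 u v w = 0.
Proof.
move=> eu ev ew; rewrite /collinear eu ev ew; split.
  move=> d2; apply/eqP/negPn/negP => /det3_neq0_full d3.
  by rewrite d3 dimvf in d2.
move=> d0; have [uv|uv] := eqVneq (cross u v) 0; last first.
  by rewrite (addv_idPl _) ?dimv_line2 // subv_line2 memv_line2 // d0.
have [x ->] := cross_eq0_prop (vline_neq0 eu) uv.
have -> : (<[u]> + <[x *: u]>)%VS = <[u]>%VS.
  by apply/addv_idPl; rewrite subv_line2 memvZ ?memv_line.
exact: dimv_line2.
Qed.

Lemma line_through_eq p q s t u v w z :
  val p = <[u]>%VS -> val q = <[v]>%VS -> val s = <[w]>%VS -> val t = <[z]>%VS ->
  cross u v != 0 -> cross w z != 0 -> meet u v w z = 0 ->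
  line_through p q = line_through s t.
Proof.
move=> eu ev ew ez uv wz m0; rewrite /line_through eu ev ew ez.
have dw : det3 u v w = 0.
  by apply/eqP; apply: contra_eqT m0; exact: meet_neq0.
have dz : det3 u v z = 0.
  apply/eqP; apply: contra_eqT m0 => dz; rewrite -oppr_eq0.
  have -> : - meet u v w z = meet u v z w by rewrite /meet opprB.
  by apply: meet_neq0 => //; rewrite cross_swap oppr_eq0.
have wx x : det3 u v x = 0 -> det3 w z x = 0.
  move=> dx; have [c [d ex]] := det3_eq0_comb uv dx.
  exact: det3_eq0_line uv dw dz dx.
apply/eqP; rewrite eqEsubv !subv_add !subv_line2 !memv_line2 // dw dz !eqxx /=.
by rewrite andbT !wx ?eqxx // ?det3_uvu ?det3_uvv.
Qed.

Lemma line_through_meet p q s t u v w z :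
  val p = <[u]>%VS -> val q = <[v]>%VS -> val s = <[w]>%VS -> val t = <[z]>%VS ->
  cross u v != 0 -> meet u v w z != 0 -> line_through p q <> line_through s t.
Proof.
move=> eu ev ew ez uv m0; rewrite /line_through eu ev ew ez => e.
have dw : det3 u v w = 0.
  by apply/eqP; rewrite -memv_line2 // e (subvP (addvSl _ _)) ?memv_line.
have dz : det3 u v z = 0.
  by apply/eqP; rewrite -memv_line2 // e (subvP (addvSr _ _)) ?memv_line.
by case/eqP: m0; rewrite /meet dw dz !scale0r subr0.
Qed.

Lemma proj_transform_val (g : 'M[R]_3) p q v : val p = <[v]>%VS ->
  proj_transform g p q -> val q = <[v *m g]>%VS.
Proof. by rewrite /proj_transform => -> ->; rewrite limg_line lfunE. Qed.
End Points.

(** * Recursion on a natural-number measure *)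

Section MeasureRecursion.
Variables (T A : Type) (h : T -> nat) (F : (T -> A) -> T -> A) (g0 : T -> A).

(** Iterating [(h x).+1] times is enough: if F reads its argument only at points of smaller measure,
    the initial function [g0] does not influence the value. *)
Definition mfix (x : T) : A := iter (h x).+1 F g0 x.

Lemma mfixE :
  (forall g g' x, (forall y, (h y < h x)%N -> g y = g' y) -> F g x = F g' x) ->
  forall x, mfix x = F mfix x.
Proof.
move=> Fh; suff key n x : (h x < n)%N -> iter n F g0 x = mfix x.
  by move=> x; rewrite {1}/mfix iterS; apply: Fh => y /key.
have [k] := ubnP (h x); elim: k => // k IHk in n x *.
case: n => // n hk hn; rewrite /mfix !iterS; apply: Fh => y hy.
by rewrite !IHk //; apply: leq_trans hy _; rewrite -ltnS.
Qed.
End MeasureRecursion.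

Lemma fstD (x y : Z2) : (x + y).1 = x.1 + y.1. Proof. by []. Qed.
Lemma sndD (x y : Z2) : (x + y).2 = x.2 + y.2. Proof. by []. Qed.
Lemma fstN (x : Z2) : (- x).1 = - x.1. Proof. by []. Qed.
Lemma sndN (x : Z2) : (- x).2 = - x.2. Proof. by []. Qed.
Definition Z2E := (fstD, sndD, fstN, sndN).

(** * Meshes and their extension from a window of rows *)

Section Mesh.
Variables (R : realType) (S : Ypin).
Local Notation a := (pa S).
Local Notation b := (pb S).
Local Notation c := (pc S).
Local Notation d := (pd S).
Implicit Types (V v : Z2 -> 'rV[R]_3) (Q r : Z2).

Lemma Ypin_rows : [/\ a.2 <= b.2, b.2 < c.2 & c.2 <= d.2].
Proof. by case: S => pa pb pc pd ? /= /andP[/andP[-> ->] ->]. Qed.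

(** The order asserted by the theorem, as a natural number. *)
Definition width : nat := `|Num.max (c.2 - a.2)%R (d.2 - b.2)%R|%N.

Lemma width_bounds : [/\ c.2 - a.2 <= width%:Z, d.2 - b.2 <= width%:Z,
  width%:Z = c.2 - a.2 \/ width%:Z = d.2 - b.2 & (0 < width)%N].
Proof. by have [] := Ypin_rows; rewrite /width; split; lia. Qed.

(* The line of a new point in its role d (resp. a): it is spanned by the points
   in the roles b and c, unless this would involve a point of the row that is
   being computed. *)
Definition e1 : Z2 := if c.2 < d.2 then b else a.
Definition e2 : Z2 := if c.2 < d.2 then c else b.
Definition f1 : Z2 := if a.2 < b.2 then b else c.
Definition f2 : Z2 := if a.2 < b.2 then c else d.

(** The point Q has the role c in the copy of S at Q - c and the role d in the copy at Q - d. *)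
Definition meetF V Q : 'rV[R]_3 :=
  meet (V (Q - c + a)) (V (Q - c + b)) (V (Q - d + e1)) (V (Q - d + e2)).

Definition meetB V Q : 'rV[R]_3 :=
  meet (V (Q - b + c)) (V (Q - b + d)) (V (Q - a + f1)) (V (Q - a + f2)).

Definition ndvec V r : seq 'rV[R]_3 :=
  [:: cross (V (r + a)) (V (r + b)); cross (V (r + a)) (V (r + c));
      cross (V (r + a)) (V (r + d)); cross (V (r + b)) (V (r + c));
      cross (V (r + b)) (V (r + d)); cross (V (r + c)) (V (r + d));
      meetF V r; meetB V r].

(** Over the reals this single polynomial tests whether a vector vanishes. *)
Definition sqnorm (u : 'rV[R]_3) : R := u 0 0 ^+ 2 + u 0 1 ^+ 2 + u 0 2 ^+ 2.

Lemma sqnorm_eq0 (u : 'rV[R]_3) : (sqnorm u == 0) = (u == 0).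
Proof.
apply/eqP/eqP => [|->]; last by rewrite /sqnorm !mxE expr0n /= !addr0.
move=> /eqP; rewrite /sqnorm !paddr_eq0 ?addr_ge0 ?sqr_ge0 // !sqrf_eq0.
by move=> /andP[/andP[/eqP u0 /eqP u1] /eqP u2]; apply: row3P; rewrite mxE.
Qed.

(* A single number whose nonvanishing expresses all the nondegeneracy
   conditions at r. *)
Definition nd V r : R := \prod_(u <- ndvec V r) sqnorm u.

Lemma nd_neq0 V r : (nd V r != 0) = all (fun u => u != 0) (ndvec V r).
Proof.
rewrite /nd; elim: (ndvec V r) => [|u s IHs]; first by rewrite big_nil oner_eq0.
by rewrite big_cons mulf_eq0 negb_or IHs sqnorm_eq0.
Qed.

Lemma ndP V r : nd V r != 0 <->
  [/\ [/\ cross (V (r + a)) (V (r + b)) != 0, cross (V (r + a)) (V (r + c)) != 0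
        & cross (V (r + a)) (V (r + d)) != 0],
      [/\ cross (V (r + b)) (V (r + c)) != 0, cross (V (r + b)) (V (r + d)) != 0
        & cross (V (r + c)) (V (r + d)) != 0],
      meetF V r != 0 & meetB V r != 0].
Proof.
rewrite nd_neq0 /ndvec; do !move: (cross _ _); move: (meetF V r) (meetB V r).
move=> F B u1 u2 u3 u4 u5 u6 /=.
split=> [/and5P[-> -> -> -> /and5P[-> -> -> ->]] //|].
by move=> [[-> -> ->] [-> -> ->] -> ->].
Qed.

(** The vectors are homogeneous coordinates. Two collinear triples suffice for the four points,
    since those in the roles b and c are distinct. *)
Record good V : Prop := Good {
  good_abc : forall r, det3 (V (r + a)) (V (r + b)) (V (r + c)) = 0;
  good_bcd : forall r, det3 (V (r + b)) (V (r + c)) (V (r + d)) = 0;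
  good_nd : forall r, nd V r != 0 }.

Definition ext_step v V Q : 'rV[R]_3 :=
  if width%:Z < Q.2 then meetF V Q else if Q.2 <= 0 then meetB V Q else v Q.

(** The distance of the row of Q from the window of rows 1, ..., [width]; the extension is computed
    outwards along it. *)
Definition rowdist Q : nat :=
  (`|(Num.max 0 (Q.2 - width%:Z))%R| + `|(Num.max 0 (1 - Q.2))%R|)%N.

Definition ext v : Z2 -> 'rV[R]_3 := mfix rowdist (ext_step v) (fun=> 0).

(** The choice of [e1] and [e2] keeps all arguments in the [width] rows below Q: with b and c the
    depth is at most d.2 - b.2, and if c and d share a row, then a and b are at depth at most c.2 -
    a.2. *)
Lemma meetF_local (P : Z2 -> Prop) Q :
  (forall Q', Q.2 - width%:Z <= Q'.2 < Q.2 -> P Q') ->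
  [/\ P (Q - c + a), P (Q - c + b), P (Q - d + e1) & P (Q - d + e2)].
Proof.
have [? ? ?] := Ypin_rows; have [? ? ? ?] := width_bounds.
by rewrite /e1 /e2; case: (ltP c.2 d.2) => ? PQ;
  split; apply: PQ; rewrite !Z2E; lia.
Qed.

Lemma meetB_local (P : Z2 -> Prop) Q :
  (forall Q', Q.2 < Q'.2 <= Q.2 + width%:Z -> P Q') ->
  [/\ P (Q - b + c), P (Q - b + d), P (Q - a + f1) & P (Q - a + f2)].
Proof.
have [? ? ?] := Ypin_rows; have [? ? ? ?] := width_bounds.
by rewrite /f1 /f2; case: (ltP a.2 b.2) => ? PQ;
  split; apply: PQ; rewrite !Z2E; lia.
Qed.

Lemma extE v Q : ext v Q = ext_step v (ext v) Q.
Proof.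
apply: mfixE => V V' {}Q VV'; rewrite /ext_step; case: ifPn => [hQ|hQ']; first rewrite /meetF.
  have [|-> -> -> ->] // := @meetF_local (fun Q' => V Q' = V' Q') Q.
  by move=> Q' hQ'; apply: VV'; rewrite /rowdist; lia.
case: ifPn => // hQ; rewrite /meetB.
have [|-> -> -> ->] // := @meetB_local (fun Q' => V Q' = V' Q') Q.
by move=> Q' hQ''; apply: VV'; rewrite /rowdist; lia.
Qed.

Lemma ext_window v Q : 0 < Q.2 <= width%:Z -> ext v Q = v Q.
Proof. by rewrite extE /ext_step => ?; rewrite !ifF //; lia. Qed.

Lemma ext_above v Q : width%:Z < Q.2 -> ext v Q = meetF (ext v) Q.
Proof. by rewrite {1}extE /ext_step => ->. Qed.

Lemma ext_below v Q : Q.2 <= 0 -> ext v Q = meetB (ext v) Q.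
Proof. by rewrite {1}extE /ext_step => ?; rewrite ifF ?ifT //; lia. Qed.

(** Induction away from the window, upwards and downwards. The bounds [lo] and [hi] allow its use
    for arrays that obey the recursion in finitely many rows only. *)
Lemma window_ind (P : Z2 -> Prop) (lo hi : int) : lo <= 1 -> width%:Z <= hi ->
  (forall Q, 0 < Q.2 <= width%:Z -> P Q) ->
  (forall Q, width%:Z < Q.2 <= hi ->
    (forall Q', Q.2 - width%:Z <= Q'.2 < Q.2 -> P Q') -> P Q) ->
  (forall Q, lo <= Q.2 <= 0 ->
    (forall Q', Q.2 < Q'.2 <= Q.2 + width%:Z -> P Q') -> P Q) ->
  forall Q, lo <= Q.2 <= hi -> P Q.
Proof.
move=> hlo hhi Pw PF PB Q; have [n] := ubnP (rowdist Q).
elim: n => // n IHn in Q *; rewrite /rowdist => hn hQ.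
have [hF|hF] := ltP width%:Z Q.2.
  by apply: PF => [|Q' hQ']; [lia|apply: IHn; [rewrite /rowdist|]; lia].
have [hB|hB] := lerP Q.2 0; last by apply: Pw; lia.
by apply: PB => [|Q' hQ']; [lia|apply: IHn; [rewrite /rowdist|]; lia].
Qed.

(** Meets of proportional vectors are proportional, so an array that obeys both intersection rules
    up to scalars is, up to scalars, the extension of its window. *)
Lemma ext_propto v V (lo hi : int) : lo <= 1 -> width%:Z <= hi ->
  (forall Q, 0 < Q.2 <= width%:Z -> propto (v Q) (V Q)) ->
  (forall Q, width%:Z < Q.2 <= hi -> propto (V Q) (meetF V Q)) ->
  (forall Q, lo <= Q.2 <= 0 -> propto (V Q) (meetB V Q)) ->
  forall Q, lo <= Q.2 <= hi -> propto (ext v Q) (V Q).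
Proof.
move=> hlo hhi vV VF VB; apply: window_ind => // Q hQ.
- by rewrite ext_window //; exact: vV.
- move/meetF_local => [? ? ? ?]; rewrite ext_above; last by case/andP: hQ.
  by apply: propto_trans _ (propto_sym (VF Q hQ)); exact: meet_propto.
- move/meetB_local => [? ? ? ?]; rewrite ext_below; last by case/andP: hQ.
  by apply: propto_trans _ (propto_sym (VB Q hQ)); exact: meet_propto.
Qed.

Lemma ext_propto_ext v v' :
  (forall Q, 0 < Q.2 <= width%:Z -> propto (v Q) (v' Q)) ->
  forall Q, propto (ext v Q) (ext v' Q).
Proof.
move=> vv' Q; apply: (@ext_propto _ _ (Num.min 1 Q.2) (Num.max width%:Z Q.2));
  try lia.
- by move=> Q' hQ'; rewrite ext_window //; exact: vv'.
- by move=> Q' /andP[hQ' _]; rewrite ext_above //; exact: propto_refl.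
- by move=> Q' /andP[_ hQ']; rewrite ext_below //; exact: propto_refl.
Qed.

Lemma nd_propto V V' r : (forall Q, propto (V Q) (V' Q)) ->
  nd V r != 0 -> nd V' r != 0.
Proof.
move=> VV' /ndP[[? ? ?] [? ? ?] nF nB].
have cV x y : cross (V x) (V y) != 0 -> cross (V' x) (V' y) != 0.
  by rewrite (propto_neq0 (cross_propto (VV' x) (VV' y))).
apply/ndP; split; [by split; exact: cV|by split; exact: cV| |].
  by rewrite -(propto_neq0 (meet_propto (VV' _) (VV' _) (VV' _) (VV' _))).
by rewrite -(propto_neq0 (meet_propto (VV' _) (VV' _) (VV' _) (VV' _))).
Qed.

Lemma good_propto V V' : (forall Q, propto (V Q) (V' Q)) -> good V -> good V'.
Proof.
move=> VV' [abc bcd ndV]; split=> r; last exact: nd_propto VV' (ndV r).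
  by apply/eqP; rewrite -(det3_propto (VV' _) (VV' _) (VV' _)) abc.
by apply/eqP; rewrite -(det3_propto (VV' _) (VV' _) (VV' _)) bcd.
Qed.

Lemma nd_shift V s r : nd (fun Q => V (Q + s)) r = nd V (r + s).
Proof.
rewrite /nd /ndvec /meetF /meetB.
have e x y : r + x + y + s = r + s + x + y by rewrite addrAC (addrAC r).
have e' x : r + x + s = r + s + x by rewrite addrAC.
by rewrite !(e', e).
Qed.
End Mesh.

Section GoodMesh.
Variables (R : realType) (S : Ypin).
Local Notation a := (pa S).
Local Notation b := (pb S).
Local Notation c := (pc S).
Local Notation d := (pd S).
Local Notation width := (width S).
Implicit Types (V v : Z2 -> 'rV[R]_3) (Q r x y z : Z2).

Definition pin : seq Z2 := [:: a; b; c; d].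

Lemma pin_uniq : uniq pin.
Proof. by rewrite /pin; case: S. Qed.

Lemma e_pin : [/\ e1 S \in pin, e2 S \in pin & e1 S != e2 S].
Proof.
have := pin_uniq; rewrite /e1 /e2 /pin /= !inE !negb_or.
by case: ifP => _ /and4P[/and3P[ab _ _] /andP[bc _] _ _];
  rewrite !eqxx !orbT.
Qed.

Lemma f_pin : [/\ f1 S \in pin, f2 S \in pin & f1 S != f2 S].
Proof.
have := pin_uniq; rewrite /f1 /f2 /pin /= !inE !negb_or.
by case: ifP => _ /and4P[_ /andP[bc _] cd _]; rewrite !eqxx !orbT; split.
Qed.

Lemma mem_pin : [/\ a \in pin, b \in pin, c \in pin & d \in pin].
Proof. by rewrite !inE !eqxx !orbT. Qed.

Section Good.
Variable V : Z2 -> 'rV[R]_3.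
Hypothesis gV : good S V.

Lemma good_cross r x y : x \in pin -> y \in pin -> x != y ->
  cross (V (r + x)) (V (r + y)) != 0.
Proof.
have /ndP[[ab ac ad] [bc bd cd] _ _] := good_nd gV r.
have sw (u w : 'rV[R]_3) : cross u w != 0 -> cross w u != 0.
  by rewrite cross_swap oppr_eq0.
rewrite !inE => /or4P[] /eqP-> /or4P[] /eqP->; rewrite ?eqxx // => _.
all: by [|apply: sw].
Qed.

Lemma good_neq0 Q : V Q != 0.
Proof.
have /ndP[[ab _ _] _ _ _] := good_nd gV (Q - a).
by move: (cross_neq0l ab); rewrite subrK.
Qed.

(** All four points lie on the line spanned by those in the roles b and c. *)
Lemma good_det3 r x y z : x \in pin -> y \in pin -> z \in pin ->
  det3 (V (r + x)) (V (r + y)) (V (r + z)) = 0.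
Proof.
have /ndP[_ [bc _ _] _ _] := good_nd gV r.
have bcP t : t \in pin -> det3 (V (r + b)) (V (r + c)) (V (r + t)) = 0.
  rewrite !inE => /or4P[] /eqP->; rewrite ?det3_uvu ?det3_uvv //.
    by rewrite -det3_rot (good_abc gV).
  exact: (good_bcd gV).
by move=> /bcP xP /bcP yP /bcP zP; exact: det3_eq0_line bc xP yP zP.
Qed.

Lemma good_meetF Q : propto (V Q) (meetF S V Q).
Proof.
have [e1P e2P e12] := e_pin; have [aP bP cP dP] := mem_pin; rewrite /meetF.
have /ndP[_ _ + _] := good_nd gV Q; rewrite /meetF => nF.
apply: meet_prop nF (good_neq0 Q) _ _; first exact: good_cross.
  by rewrite -{3}(subrK c Q); exact: good_det3.
by rewrite -{3}(subrK d Q); exact: good_det3.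
Qed.

Lemma good_meetB Q : propto (V Q) (meetB S V Q).
Proof.
have [f1P f2P f12] := f_pin; have [aP bP cP dP] := mem_pin; rewrite /meetB.
have /ndP[_ _ _ +] := good_nd gV Q; rewrite /meetB => nB.
apply: meet_prop nB (good_neq0 Q) _ _; first exact: good_cross.
  by rewrite -{3}(subrK b Q); exact: good_det3.
by rewrite -{3}(subrK a Q); exact: good_det3.
Qed.

Lemma ext_good_propto v :
  (forall Q, 0 < Q.2 <= width%:Z -> propto (v Q) (V Q)) ->
  forall Q, propto (ext S v Q) (V Q).
Proof.
move=> vV Q.
apply: (@ext_propto _ S v V (Num.min 1 Q.2) (Num.max width%:Z Q.2)); try lia.
- exact: vV.
- by move=> Q' _; exact: good_meetF.
- by move=> Q' _; exact: good_meetB.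
Qed.
End Good.

(** The incidences whose three points all lie in rows 1, ..., [width]. *)
Definition window_rel v : Prop :=
  (forall r, 0 < (r + a).2 -> (r + c).2 <= width%:Z ->
     det3 (v (r + a)) (v (r + b)) (v (r + c)) = 0) /\
  (forall r, 0 < (r + b).2 -> (r + d).2 <= width%:Z ->
     det3 (v (r + b)) (v (r + c)) (v (r + d)) = 0).

(** A triple inside the window is collinear by hypothesis. Any other triple sticks out above or
    below, and its outermost point was constructed on the line in question. *)
Lemma ext_good v : window_rel v -> (forall r, nd S (ext S v) r != 0) ->
  good S (ext S v).
Proof.
move=> [w1 w2] ndv; have [ab bc cd] := Ypin_rows S.
have [wd1 wd2 wd3 wd4] := width_bounds S.
set V := ext S v.
have onF Q : width%:Z < Q.2 ->
    det3 (V (Q - c + a)) (V (Q - c + b)) (V Q) = 0 /\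
    det3 (V (Q - d + e1 S)) (V (Q - d + e2 S)) (V Q) = 0.
  by move=> hQ; rewrite {3 6}/V ext_above //; split; [exact: det3_meetl | exact: det3_meetr].
have onB Q : Q.2 <= 0 ->
    det3 (V (Q - b + c)) (V (Q - b + d)) (V Q) = 0 /\
    det3 (V (Q - a + f1 S)) (V (Q - a + f2 S)) (V Q) = 0.
  by move=> hQ; rewrite {3 6}/V ext_below //; split; [exact: det3_meetl | exact: det3_meetr].
have inw Q : 0 < Q.2 -> Q.2 <= width%:Z -> V Q = v Q.
  by move=> ? ?; apply: ext_window; lia.
split=> // r; have /ndP[[nab nac nad] [nbc nbd ncd] _ _] := ndv r.
- have [hc|hc] := ltP width%:Z (r + c).2.
    by have [] := onF _ hc; rewrite !addrK.
  have [ha|ha] := lerP (r + a).2 0; last first.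
    move: hc ha; rewrite !Z2E => hc ha.
    by rewrite !inw ?w1 ?Z2E //; lia.
  have [hf _ _] := f_pin; have [_] := onB _ ha; rewrite !addrK /f1 /f2.
  case: ifPn => hab; first by rewrite -det3_rot.
  move=> cda.
  (* Here a and b share their row, and both were put on the line through c and d. *)
  have hb : (r + b).2 <= 0 by move: ha; rewrite !Z2E; lia.
  have [] := onB _ hb; rewrite !addrK => cdb _.
  exact: det3_eq0_line ncd cda cdb (det3_uvu _ _).
- have [hb|hb] := lerP (r + b).2 0.
    by have [] := onB _ hb; rewrite !addrK -det3_rot.
  have [hd|hd] := lerP (r + d).2 width%:Z.
    by move: hb hd; rewrite !Z2E => hb hd; rewrite !inw ?w2 ?Z2E //; lia.
  have [_] := onF _ hd; rewrite !addrK /e1 /e2; case: ifPn => // hcd abd.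
  (* Here c and d share their row, and both were put on the line through a and b. *)
  have hc : width%:Z < (r + c).2 by move: hd; rewrite !Z2E; lia.
  have [] := onF _ hc; rewrite !addrK => abc _.
  exact: det3_eq0_line nab (det3_uvv _ _) abc abd.
Qed.

Lemma good_window V v : good S V ->
  (forall Q, 0 < Q.2 <= width%:Z -> propto (v Q) (V Q)) -> window_rel v.
Proof.
move=> gV vV; have [ab bc cd] := Ypin_rows S.
split=> r; rewrite !Z2E => h1 h2; apply/eqP.
  by rewrite (det3_propto (vV _ _) (vV _ _) (vV _ _)) ?Z2E ?(good_abc gV) //; lia.
by rewrite (det3_propto (vV _ _) (vV _ _) (vV _ _)) ?Z2E ?(good_bcd gV) //; lia.
Qed.

Lemma good_shift V s : good S V -> good S (fun Q => V (Q + s)).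
Proof.
move=> [abc bcd ndV]; split=> r; last by rewrite nd_shift.
  by rewrite !(addrAC r _ s) abc.
by rewrite !(addrAC r _ s) bcd.
Qed.

Lemma meetF_mulmx (g : 'M[R]_3) V Q :
  meetF S (fun Q => V Q *m g) Q = \det g *: (meetF S V Q *m g).
Proof. exact: meet_mulmx. Qed.

Lemma meetB_mulmx (g : 'M[R]_3) V Q :
  meetB S (fun Q => V Q *m g) Q = \det g *: (meetB S V Q *m g).
Proof. exact: meet_mulmx. Qed.

Lemma good_mulmx (g : 'M[R]_3) V : g \in unitmx -> good S V ->
  good S (fun Q => V Q *m g).
Proof.
move=> gu [abc bcd ndV]; have g0 : \det g != 0 by rewrite -unitfE -unitmxE.
have mulg0 (u : 'rV_3) : u != 0 -> \det g *: (u *m g) != 0.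
  move=> u0; rewrite scaler_eq0 (negPf g0) /=.
  by apply: contraNneq u0 => ug; rewrite -(mulmxK gu u) ug mul0mx.
split=> r; [by rewrite det3_mulmx abc mulr0|by rewrite det3_mulmx bcd mulr0|].
have /ndP[[nab nac nad] [nbc nbd ncd] nF nB] := ndV r.
apply/ndP; rewrite meetF_mulmx meetB_mulmx.
by split; [split; rewrite cross_mulmx | split; rewrite cross_mulmx
  | exact: mulg0 | exact: mulg0].
Qed.
End GoodMesh.

(** * Polynomial dependence *)

Section FunctionRings.
Variables (R : realType) (T : Type) (C : (T -> R) -> Prop).

(** All constructions are polynomial in the coordinates. Two rings of functions are needed:
    polynomials in a real parameter, and polynomials in the homogeneous coordinates of an array. *)
Record function_ring : Prop := FunctionRing {
  fr_const : forall k, C (fun=> k);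
  fr_add : forall f g, C f -> C g -> C (fun t => f t + g t);
  fr_mul : forall f g, C f -> C g -> C (fun t => f t * g t) }.

Definition fr_vec (u : T -> 'rV[R]_3) : Prop := forall l, C (fun t => u t 0 l).

Hypothesis frC : function_ring.

Lemma fr_eq f g : C f -> f =1 g -> C g.
Proof. by move=> Cf /funext <-. Qed.

Lemma fr_opp f : C f -> C (fun t => - f t).
Proof.
move=> Cf; apply: (@fr_eq (fun t => -1 * f t)) => [|t]; last by rewrite mulN1r.
exact: (fr_mul frC) (fr_const frC _) Cf.
Qed.

Lemma fr_sub f g : C f -> C g -> C (fun t => f t - g t).
Proof. by move=> Cf Cg; apply: (fr_add frC) => //; exact: fr_opp. Qed.

Lemma fr_prod I (s : seq I) (f : I -> T -> R) : (forall i, C (f i)) ->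
  C (fun t => \prod_(i <- s) f i t).
Proof.
move=> Cf; elim: s => [|i s IHs].
  by apply: fr_eq (fr_const frC 1) _ => t; rewrite big_nil.
by apply: fr_eq (fr_mul frC (Cf i) IHs) _ => t; rewrite big_cons.
Qed.

Lemma fr_sum I (s : seq I) (f : I -> T -> R) : (forall i, C (f i)) ->
  C (fun t => \sum_(i <- s) f i t).
Proof.
move=> Cf; elim: s => [|i s IHs].
  by apply: fr_eq (fr_const frC 0) _ => t; rewrite big_nil.
by apply: fr_eq (fr_add frC (Cf i) IHs) _ => t; rewrite big_cons.
Qed.

Lemma fr_exp f k : C f -> C (fun t => f t ^+ k).
Proof.
move=> Cf; elim: k => [|k IHk]; first exact: (fr_const frC).
by apply: fr_eq (fr_mul frC Cf IHk) _ => t; rewrite exprS.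
Qed.

Lemma fr_det3 u v w : fr_vec u -> fr_vec v -> fr_vec w ->
  C (fun t => det3 (u t) (v t) (w t)).
Proof.
move=> Cu Cv Cw; rewrite /det3.
by apply: (fr_add frC); [apply: fr_sub|]; (apply: (fr_mul frC); first exact: Cu);
  apply: fr_sub; apply: (fr_mul frC); (exact: Cv || exact: Cw).
Qed.

Lemma fr_vecZ f u : C f -> fr_vec u -> fr_vec (fun t => f t *: u t).
Proof.
move=> Cf Cu l; apply: fr_eq (fr_mul frC Cf (Cu l)) _ => t; by rewrite !mxE.
Qed.

Lemma fr_vecD u v : fr_vec u -> fr_vec v -> fr_vec (fun t => u t + v t).
Proof.
move=> Cu Cv l; apply: fr_eq (fr_add frC (Cu l) (Cv l)) _ => t; by rewrite !mxE.
Qed.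

Lemma fr_vec_const u : fr_vec (fun=> u).
Proof. by move=> l; exact: (fr_const frC). Qed.

Lemma fr_vec_mulmx (g : 'M[R]_3) u : fr_vec u -> fr_vec (fun t => u t *m g).
Proof.
move=> Cu l.
apply: fr_eq (@fr_sum _ (index_enum 'I_3) (fun j t => u t 0 j * g j l) _) _.
  by move=> j; apply: (fr_mul frC) => //; exact: (fr_const frC).
by move=> t; rewrite mxE.
Qed.

Lemma fr_cross u v : fr_vec u -> fr_vec v -> fr_vec (fun t => cross (u t) (v t)).
Proof.
move=> Cu Cv.
have Cuv i j : C (fun t => u t 0 i * v t 0 j - u t 0 j * v t 0 i).
  by apply: fr_sub; apply: (fr_mul frC); (exact: Cu || exact: Cv).
by apply: ord3P; apply: fr_eq (Cuv _ _) _ => t; rewrite mxE /=.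
Qed.

Lemma fr_meet u v w z : fr_vec u -> fr_vec v -> fr_vec w -> fr_vec z ->
  fr_vec (fun t => meet (u t) (v t) (w t) (z t)).
Proof.
move=> Cu Cv Cw Cz l.
apply: (@fr_eq (fun t => det3 (u t) (v t) (z t) * w t 0 l
                        - det3 (u t) (v t) (w t) * z t 0 l)).
  by apply: fr_sub; apply: (fr_mul frC) => //; exact: fr_det3.
by move=> t; rewrite !mxE.
Qed.

Lemma fr_sqnorm u : fr_vec u -> C (fun t => sqnorm (u t)).
Proof. by move=> Cu; rewrite /sqnorm; do 2?apply: (fr_add frC); exact: fr_exp. Qed.

Variable S : Ypin.

Lemma fr_meetF (V : T -> Z2 -> 'rV[R]_3) Q :
  (forall Q', Q.2 - (width S)%:Z <= Q'.2 < Q.2 -> fr_vec (V ^~ Q')) ->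
  fr_vec (fun t => meetF S (V t) Q).
Proof.
by move=> /(@meetF_local S (fun Q' => fr_vec (V ^~ Q'))) [? ? ? ?]; exact: fr_meet.
Qed.

Lemma fr_meetB (V : T -> Z2 -> 'rV[R]_3) Q :
  (forall Q', Q.2 < Q'.2 <= Q.2 + (width S)%:Z -> fr_vec (V ^~ Q')) ->
  fr_vec (fun t => meetB S (V t) Q).
Proof.
by move=> /(@meetB_local S (fun Q' => fr_vec (V ^~ Q'))) [? ? ? ?]; exact: fr_meet.
Qed.

Lemma fr_vec_eq u v : u =1 v -> fr_vec u -> fr_vec v.
Proof. by move=> /funext ->. Qed.

(** Each point of the extension arises from the window by finitely many meets, which are polynomial
    in their arguments. *)
Lemma fr_ext (v : T -> Z2 -> 'rV[R]_3) :
  (forall Q, 0 < Q.2 <= (width S)%:Z -> fr_vec (v ^~ Q)) ->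
  forall Q, fr_vec (fun t => ext S (v t) Q).
Proof.
move=> Cv Q.
have key := @window_ind S (fun Q => fr_vec (fun t => ext S (v t) Q))
  (Num.min 1 Q.2) (Num.max (width S)%:Z Q.2).
apply: key; try lia.
- move=> Q' hQ'; apply: fr_vec_eq (Cv _ hQ') => t.
  by rewrite ext_window.
- move=> Q' /andP[hQ' _] IH; apply: fr_vec_eq (fr_meetF IH) => t.
  by rewrite [RHS]ext_above.
- move=> Q' /andP[_ hQ'] IH; apply: fr_vec_eq (fr_meetB IH) => t.
  by rewrite [RHS]ext_below.
Qed.

Lemma fr_nd (V : T -> Z2 -> 'rV[R]_3) r : (forall Q, fr_vec (V ^~ Q)) ->
  C (fun t => nd S (V t) r).
Proof.
move=> CV; have CF := fr_meetF (fun Q' _ => CV Q').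
have CB := fr_meetB (fun Q' _ => CV Q').
apply: (@fr_eq (fun t => foldr *%R 1 (map (@sqnorm R) (ndvec S (V t) r)))).
  rewrite /ndvec /map /foldr.
  do 6![apply: (fr_mul frC); first by apply: fr_sqnorm; exact: fr_cross].
  apply: (fr_mul frC); first by apply: fr_sqnorm; exact: CF.
  apply: (fr_mul frC); first by apply: fr_sqnorm; exact: CB.
  exact: (fr_const frC).
by move=> t; rewrite foldrE big_map.
Qed.

Lemma fr_ceval n (f : cpoly R n) (v : T -> 'I_n -> int -> 'rV[R]_3) :
  (forall j i, fr_vec (fun t => v t j i)) -> C (fun t => ceval f (v t)).
Proof.
move=> Cv; apply: fr_sum => m; apply: (fr_mul frC); first exact: (fr_const frC).
apply: fr_prod => k; apply: fr_exp.
by case: (cvar f k) => [[j i] l]; exact: Cv.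
Qed.
End FunctionRings.

Section Instances.
Variable R : realType.

Definition polyfun (f : R -> R) : Prop := exists p : {poly R}, forall t, p.[t] = f t.

Lemma polyfun_ring : function_ring polyfun.
Proof.
split=> [k|f g [p pE] [q qE]|f g [p pE] [q qE]].
- by exists k%:P => t; rewrite hornerC.
- by exists (p + q) => t; rewrite hornerD pE qE.
- by exists (p * q) => t; rewrite hornerM pE qE.
Qed.

Lemma polyfun_id : polyfun id.
Proof. by exists 'X => t; rewrite hornerX. Qed.

Variable n : nat.

Definition cfun (f : ('I_n -> int -> 'rV[R]_3) -> R) : Prop :=
  exists c : cpoly R n, forall v, ceval c v = f v.

Lemma cfun_coord j i : fr_vec cfun (fun v => v j i).
Proof.
move=> l; exists (@CPoly R n 1 (fun=> (j, i, l)) (mpoly.mpolyX R (mpoly.mnm1 ord0))).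
by move=> v; rewrite /ceval /= mpoly.mevalXU.
Qed.

(** Each [cpoly] comes with its own finite family of variables; before adding or multiplying, the
    two families are concatenated. *)
Lemma cfun_pair (c1 c2 : cpoly R n) : exists k (cv : 'I_k -> 'I_n * int * 'I_3)
  (p1 p2 : mpoly.mpoly k R), forall v,
  ceval (CPoly cv p1) v = ceval c1 v /\ ceval (CPoly cv p2) v = ceval c2 v.
Proof.
case: c1 c2 => k1 cv1 p1 [k2 cv2 p2].
exists (k1 + k2)%N, (fun k => match fintype.split k with inl i => cv1 i | inr i => cv2 i end).
exists (mpoly.comp_mpoly [tuple mpoly.mpolyX R (mpoly.mnm1 (lshift k2 i)) | i < k1] p1).
exists (mpoly.comp_mpoly [tuple mpoly.mpolyX R (mpoly.mnm1 (rshift k1 i)) | i < k2] p2).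
by move=> v; rewrite /ceval !mpoly.comp_mpoly_meval /=;
  split; congr mpoly.meval; apply/funext => i; rewrite tnth_mktuple mpoly.mevalXU
  -?[lshift _ _]/(unsplit (inl i)) -?[rshift _ _]/(unsplit (inr i)) unsplitK.
Qed.

Lemma cfun_ring : function_ring cfun.
Proof.
split=> [k|f g [c1 c1E] [c2 c2E]|f g [c1 c1E] [c2 c2E]].
- exists (@CPoly R n 0 (fun i => False_rect _ (notF (ltn_ord i))) (mpoly.mpolyC 0 k)) => v.
  by rewrite /ceval mpoly.mevalC.
- have [k [cv [p1 [p2 cE]]]] := cfun_pair c1 c2; exists (CPoly cv (p1 + p2)) => v.
  by rewrite -c1E -c2E; have [<- <-] := cE v; exact: mpoly.mevalD.
- have [k [cv [p1 [p2 cE]]]] := cfun_pair c1 c2; exists (CPoly cv (p1 * p2)) => v.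
  by rewrite -c1E -c2E; have [<- <-] := cE v; exact: mpoly.mevalM.
Qed.
End Instances.

Section Avoidance.
Variable R : realType.

(* R is uncountable, so countably many nonzero polynomials have a common
   non-root. *)
Lemma polyfun_avoid (f : nat -> R -> R) : (forall n, polyfun (f n)) ->
  (forall n, exists t, f n t != 0) -> exists t, forall n, f n t != 0.
Proof.
move=> /choice[p pE] fn0.
pose Z := (\bigcup_(n in [set: nat]) [set t | f n t = 0])%classic.
have cZ : countable Z.
  apply: bigcup_countable => // n _; apply: finite_set_countable.
  have pn0 : p n != 0.
    have [t] := fn0 n; rewrite -pE; apply: contraNneq => ->; by rewrite horner0.
  have -> : [set t | f n t = 0]%classic = [set t | root (p n) t]%classic.
    by apply/seteqP; split=> t /=; rewrite -pE rootE => /eqP.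
  apply: (sub_finite_set _ (finite_seq (polyrcf.rootsR (p n)))) => t /=.
  by rewrite /= -polyrcf.roots_on_rootsR.
apply/not_existsP => all0.
have ZT : Z = [set: R]%classic.
  apply/seteqP; split=> // t _; have /existsNP[n /negP/negPn/eqP fnt] := all0 t.
  by exists n.
have := countable_lebesgue_measure0 cZ; rewrite ZT.
by rewrite -set_itvNyy lebesgue_measure_itv /= => /eqP; rewrite (gt_eqF (ltry _)) .
Qed.
End Avoidance.

(** * Rows of good meshes *)

Section Rows.
Variables (R : realType) (n : nat).
Implicit Types (v : 'I_n -> int -> 'rV[R]_3) (V : Z2 -> 'rV[R]_3)
  (A : polygons R n) (Q : Z2).

(** The index j of ['I_n] stands for row j + 1. Outside rows 1, ..., n the value is 0, which
    represents no point. *)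
Definition arr v Q : 'rV[R]_3 :=
  if Q.2 is Posz k.+1 then
    if insub k is Some j then v j Q.1 else 0
  else 0.

Definition win V (j : 'I_n) (i : int) : 'rV[R]_3 := V (i, j.+1%:Z).

Lemma arrE v (j : 'I_n) i : arr v (i, j.+1%:Z) = v j i.
Proof. by rewrite /arr /= insubT //= => ?; congr v; apply: val_inj. Qed.

Lemma row_index Q : 0 < Q.2 <= n%:Z -> exists j : 'I_n, Q = (Q.1, j.+1%:Z).
Proof.
move=> hQ; have hj : (`|Q.2|.-1 < n)%N by lia.
by exists (Ordinal hj); case: Q hQ hj => q1 q2 /= *; congr pair; lia.
Qed.

Lemma lifts_exist A : exists v, lifts v A.
Proof.
have /choice[f fE] : forall p : RP2 R, exists u, val p = <[u]>%VS.
  by move=> p; have [u _] := RP2_vec p; exists u.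
by exists (fun j i => f (A j i)) => j i; exact: fE.
Qed.

Lemma lifts_propto v v' A : lifts v A -> lifts v' A ->
  forall Q, 0 < Q.2 <= n%:Z -> propto (arr v Q) (arr v' Q).
Proof.
move=> vA v'A Q /row_index[j ->]; rewrite !arrE.
exact: vline_propto (vA j _) (v'A j _).
Qed.

Lemma lifts_rows v P k : lifts v (rows n k P) ->
  forall Q, 0 < Q.2 <= n%:Z -> val (P (Q + (0, k))) = <[arr v Q]>%VS.
Proof.
move=> vP Q /row_index[j ->]; rewrite arrE -vP /rows; congr (val (P _)).
by rewrite [LHS]surjective_pairing !Z2E /= addr0 addrC.
Qed.

Lemma fr_arr T (C : (T -> R) -> Prop) (v : T -> 'I_n -> int -> 'rV[R]_3) Q :
  function_ring C -> (forall j i, fr_vec C (fun t => v t j i)) ->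
  fr_vec C (fun t => arr (v t) Q).
Proof.
move=> frC Cv; have C0 := fr_vec_const frC (0 : 'rV[R]_3).
by rewrite /arr; case: Q.2 => [[|k]|k] //; case: insub.
Qed.

Definition zvanish (c : cpoly R n) : set (polygons R n) := [set A | vanishes c A]%classic.

Lemma zvanish_closed c : zclosed (zvanish c).
Proof.
exists [set c]%classic; apply/seteqP; split=> A /= cA; first by move=> f ->.
exact: cA.
Qed.

Lemma sub_zclosure (X : set (polygons R n)) : (X `<=` zclosure X)%classic.
Proof. by move=> A XA f; apply. Qed.

Lemma zclosure_closed (X : set (polygons R n)) : zclosed (zclosure X).
Proof. by exists [set f | forall B, X B -> vanishes f B]%classic. Qed.

Lemma generic_imp (X : set (polygons R n)) (P Q : polygons R n -> Prop) :
  (forall A, P A -> Q A) -> generic X P -> generic X Q.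
Proof. by move=> PQ [U [cU dU UP]]; exists U; split=> // A XA UA; exact/PQ/UP. Qed.

Lemma Nvanishes (f : cpoly R n) A : ~ vanishes f A ->
  exists2 v, lifts v A & ceval f v != 0.
Proof.
by move=> /existsNP[v /not_implyP[vA /eqP fv]]; exists v.
Qed.
End Rows.

Section GoodRows.
Variables (R : realType) (S : Ypin) (n : nat).
Implicit Types (v : 'I_n -> int -> 'rV[R]_3) (V : Z2 -> 'rV[R]_3)
  (A : polygons R n) (Q : Z2).

Definition good_rows : set (polygons R n) :=
  [set A | exists2 V, good S V & lifts (win V) A]%classic.

Definition mesh_of V : mesh R := fun Q => pt (V Q).

Lemma val_mesh_of V Q : good S V -> val (mesh_of V Q) = <[V Q]>%VS.
Proof. by move=> gV; rewrite val_pt // (good_neq0 gV). Qed.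

Lemma lifts_mesh_of V A : good S V -> lifts (win V) A -> rows n 0 (mesh_of V) = A.
Proof.
move=> gV VA; apply/funext => j; apply/funext => i; apply: val_inj.
by rewrite (VA j i) /rows add0r val_mesh_of.
Qed.

Lemma good_rows_mesh_of V k : good S V -> good_rows (rows n k (mesh_of V)).
Proof.
move=> gV; exists (fun Q => V (Q + (0, k))); first exact: good_shift.
move=> j i; rewrite /rows val_mesh_of // /win; congr (<[V _]>%VS).
by rewrite [RHS]surjective_pairing !Z2E /= addr0 addrC.
Qed.

(** Nonzero scalars do not affect goodness, so a good mesh can be rescaled to agree with prescribed
    lifts. *)
Lemma good_lift A v : good_rows A -> lifts v A ->
  exists2 V, good S V & forall (j : 'I_n) i, V (i, j.+1%:Z) = v j i.
Proof.
move=> [V gV VA] vA.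
exists (fun Q => if 0 < Q.2 <= n%:Z then arr v Q else V Q); last first.
  by move=> j i; rewrite ifT ?arrE //=; have := ltn_ord j; lia.
apply: good_propto gV => Q; case: ifPn => [|_]; last exact: propto_refl.
by move/row_index => [j ->]; rewrite arrE; exact: vline_propto (VA j _) (vA j _).
Qed.

(** An array as in the second hypothesis is good when the extension of its window is nondegenerate
    at every r. Each of these countably many conditions is the nonvanishing of one polynomial, hence
    open. *)
Lemma generic_good_rows (X : set (polygons R n)) : ((width S)%:Z <= n%:Z) ->
  (forall A v, X A -> lifts v A -> window_rel S (arr v) /\
     forall Q, (width S)%:Z < Q.2 <= n%:Z -> propto (arr v Q) (meetF S (arr v) Q)) ->
  (X `<=` zclosure (X `&` good_rows))%classic ->
  generic X good_rows.
Proof.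
move=> hn HX dX.
have [c cE] : exists c : Z2 -> cpoly R n,
    forall r v, ceval (c r) v = nd S (ext S (arr v)) r.
  suff /choice[c cE] : forall r, cfun (fun v => nd S (ext S (@arr R n v)) r).
    by exists c.
  move=> r; apply: (fr_nd (@cfun_ring R n)) => Q.
  apply: (fr_ext (@cfun_ring R n)) => Q' _.
  by apply: fr_arr (@cfun_ring R n) _ => j i; exact: cfun_coord.
have ndA r A v : ~ vanishes (c r) A -> lifts v A -> nd S (ext S (arr v)) r != 0.
  move=> /Nvanishes[v' v'A]; rewrite cE => nd0 vA.
  apply: nd_propto nd0; apply: ext_propto_ext => Q hQ.
  by apply: lifts_propto v'A vA _ _; lia.
(* The points of Z^2 are enumerated by [unpickle]; indices that code no point impose no
   condition. *)
pose O k : set (polygons R n) :=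
  if unpickle k is Some r then (~` zvanish (c r))%classic else setT.
exists O; split=> [k||A XA OA].
- rewrite /O; case: unpickle => [r|]; first by rewrite setCK; exact: zvanish_closed.
  (* The empty set is closed: it is the zero set of the constant 1, because every array has a
     lift. *)
  rewrite setCT; have [e eE] := fr_const (@cfun_ring R n) 1.
  have -> : set0 = zvanish e; last exact: zvanish_closed.
  apply/esym; rewrite -subset0 => A; have [v vA] := lifts_exist A.
  by move=> /(_ v vA); rewrite eE => /eqP; rewrite oner_eq0.
- move=> A /dX + f fO; apply=> B [XB [V gV VB]]; apply: fO; split=> // k _.
  rewrite /O; case: unpickle => // r /(_ _ VB); rewrite cE.
  have extV : forall Q, propto (V Q) (ext S (arr (@win R n V)) Q).
    move=> Q; apply/propto_sym/(ext_good_propto gV) => Q' hQ'.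
    have [|j ->] := @row_index n Q'; first by lia.
    by rewrite arrE; exact: propto_refl.
  by apply/eqP; exact: nd_propto extV (good_nd gV r).
- have [v vA] := lifts_exist A; have [wv fv] := HX A v XA vA.
  have gV : good S (ext S (arr v)).
    apply: ext_good => // r; apply: ndA vA => cA.
    by have := OA (pickle r); rewrite /O pickleK.
  exists (ext S (arr v)) => // j i.
  have : propto (ext S (arr v) (i, j.+1%:Z)) (arr v (i, j.+1%:Z)).
    apply: (@ext_propto _ S _ (arr v) 1 n%:Z) => //=; last by have := ltn_ord j; lia.
    + by move=> Q _; exact: propto_refl.
    + by move=> Q hQ; lia.
  rewrite arrE vA /win => /propto_sym/(vline_eqP _ (vline_neq0 (vA j i))).
  exact.
Qed.
End GoodRows.

(** * Polynomial paths of good meshes *)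

Section Paths.
Variables (R : realType) (S : Ypin).
Local Notation a := (pa S).
Local Notation b := (pb S).
Local Notation c := (pc S).
Local Notation d := (pd S).
Local Notation width := (width S).
Implicit Types (V v : Z2 -> 'rV[R]_3) (Q r : Z2) (t : R).

(** The points selected by [con] lie on the line through two points of smaller measure. The free
    points and the coefficients of the constrained ones are interpolated linearly, and the
    constrained points are recomputed by recursion. *)
Lemma linear_path (h : Z2 -> nat) (con : pred Z2) (l1 l2 : Z2 -> Z2)
    (u0 u1 : Z2 -> 'rV[R]_3) :
  (forall Q, con Q -> (h (l1 Q) < h Q)%N /\ (h (l2 Q) < h Q)%N) ->
  (forall Q, con Q -> exists x y, u0 Q = x *: u0 (l1 Q) + y *: u0 (l2 Q)) ->
  (forall Q, con Q -> exists x y, u1 Q = x *: u1 (l1 Q) + y *: u1 (l2 Q)) ->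
  exists w : R -> Z2 -> 'rV[R]_3,
    [/\ forall Q, fr_vec (@polyfun R) (w ^~ Q), w 0 =1 u0, w 1 =1 u1 &
        forall t Q, con Q -> det3 (w t (l1 Q)) (w t (l2 Q)) (w t Q) = 0].
Proof.
move=> hl c0 c1.
have coef (u : Z2 -> 'rV[R]_3) :
    (forall Q, con Q -> exists x y, u Q = x *: u (l1 Q) + y *: u (l2 Q)) ->
  exists f : Z2 -> R * R, forall Q, con Q ->
      u Q = (f Q).1 *: u (l1 Q) + (f Q).2 *: u (l2 Q).
  move=> cu; suff /choice[f fE] : forall Q, exists k : R * R, con Q ->
      u Q = k.1 *: u (l1 Q) + k.2 *: u (l2 Q) by exists f.
  move=> Q; have [/cu[x [y e]]|nQ] := boolP (con Q); last by exists (0, 0).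
  by exists (x, y).
have [k0 {c0}c0] := coef _ c0; have [k1 {c1}c1] := coef _ c1.
pose step t (g : Z2 -> 'rV[R]_3) Q := if con Q then
    ((1 - t) * (k0 Q).1 + t * (k1 Q).1) *: g (l1 Q)
    + ((1 - t) * (k0 Q).2 + t * (k1 Q).2) *: g (l2 Q)
  else (1 - t) *: u0 Q + t *: u1 Q.
pose w t := mfix h (step t) (fun=> 0).
have wE t Q : w t Q = step t (w t) Q.
  apply: mfixE => g g' {}Q gg'; rewrite /step; case: ifP => // /hl[h1 h2].
  by rewrite !gg'.
have frp := polyfun_ring R.
have fri : forall x y : R, polyfun (fun t => (1 - t) * x + t * y).
  move=> x y; have fid := polyfun_id R.
  have frk (k : R) : polyfun (fun=> k) := fr_const frp k.
  have f1 := fr_sub frp (frk 1) fid.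
  exact: (fr_add frp (fr_mul frp f1 (frk x)) (fr_mul frp fid (frk y))).
exists w; split.
- move=> Q; have [k] := ubnP (h Q); elim: k => // k IHk in Q *; rewrite ltnS => hQ.
  apply: (@fr_vec_eq _ _ _ (fun t => step t (w t) Q)) => [t|]; first by rewrite wE.
  rewrite /step; case cQ : (con Q).
    by have [h1 h2] := hl _ cQ; apply: (fr_vecD frp); apply: (fr_vecZ frp) => //;
      apply: IHk; apply: leq_trans hQ.
  move=> l; apply: fr_eq (fri (u0 Q 0 l) (u1 Q 0 l)) _ => t.
  by rewrite !mxE.
- move=> Q; have [k] := ubnP (h Q); elim: k => // k IHk in Q *; rewrite ltnS => hQ.
  rewrite wE /step; case: ifPn => [cQ|_]; last by rewrite subr0 scale1r scale0r addr0.
  have [h1 h2] := hl _ cQ; rewrite subr0 !mul1r !mul0r !addr0.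
  by rewrite !IHk -?c0 //; apply: leq_trans hQ.
- move=> Q; have [k] := ubnP (h Q); elim: k => // k IHk in Q *; rewrite ltnS => hQ.
  rewrite wE /step; case: ifPn => [cQ|_]; last by rewrite subrr scale1r scale0r add0r.
  have [h1 h2] := hl _ cQ; rewrite subrr !mul1r !mul0r !add0r.
  by rewrite !IHk -?c1 //; apply: leq_trans hQ.
- move=> t Q cQ; rewrite [w t Q]wE /step cQ; exact: det3_combr.
Qed.

(** What is needed to solve an incidence for one of its points: c from a and b, or b from c and
    d. *)
Definition window_reg v : Prop :=
  (forall r, 0 < (r + a).2 -> (r + c).2 <= width%:Z ->
     cross (v (r + a)) (v (r + b)) != 0) /\
  (forall r, 0 < (r + b).2 -> (r + d).2 <= width%:Z ->
     cross (v (r + c)) (v (r + d)) != 0).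

Lemma good_window_reg V : good S V -> window_reg V.
Proof.
by move=> gV; split=> r _ _; have /ndP[[? ? ?] [? ? ?] _ _] := good_nd gV r.
Qed.

(* Only one of the two families of incidences occurs in a window of minimal
   width. Those of type (a, b, c) are solved for c upwards, those of type
   (b, c, d) for b downwards, which also works if c and d share their row. *)
Lemma window_path (u0 u1 : Z2 -> 'rV[R]_3) :
  window_rel S u0 -> window_reg u0 -> window_rel S u1 -> window_reg u1 ->
  exists w : R -> Z2 -> 'rV[R]_3,
    [/\ forall Q, fr_vec (@polyfun R) (w ^~ Q), w 0 =1 u0, w 1 =1 u1 &
        forall t, window_rel S (w t)].
Proof.
move=> rel0 reg0 rel1 reg1; have [ab bc cd] := Ypin_rows S.
have [wd1 wd2 [wdE|wdE] wd4] := width_bounds S.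
- pose con Q := (0 < Q.2) && ((Q - b + d).2 <= width%:Z).
  have [|||w [fw w0 w1 wcon]] := @linear_path (fun Q => `|(width%:Z - Q.2)%R|%N) con
      (fun Q => Q - b + c) (fun Q => Q - b + d) u0 u1.
  + by move=> Q; rewrite /con !Z2E; lia.
  + move=> Q /andP[Q1 Q2]; apply: det3_eq0_comb.
      by apply: reg0.2; rewrite ?subrK.
    rewrite -det3_rot -{1}(subrK b Q); apply: rel0.2; by rewrite ?subrK.
  + move=> Q /andP[Q1 Q2]; apply: det3_eq0_comb.
      by apply: reg1.2; rewrite ?subrK.
    rewrite -det3_rot -{1}(subrK b Q); apply: rel1.2; by rewrite ?subrK.
  exists w; split=> // t; split=> r; first by rewrite !Z2E; lia.
  move=> r1 r2; have := wcon t (r + b); rewrite /con !addrK r1 r2 => /(_ isT).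
  by rewrite -det3_rot.
- pose con Q := (0 < (Q - c + a).2) && (Q.2 <= width%:Z).
  have [|||w [fw w0 w1 wcon]] := @linear_path (fun Q => `|Q.2|%N) con
      (fun Q => Q - c + a) (fun Q => Q - c + b) u0 u1.
  + by move=> Q; rewrite /con !Z2E; lia.
  + move=> Q /andP[Q1 Q2]; apply: det3_eq0_comb.
      by apply: reg0.1; rewrite ?subrK.
    rewrite -{3}(subrK c Q); apply: rel0.1; by rewrite ?subrK.
  + move=> Q /andP[Q1 Q2]; apply: det3_eq0_comb.
      by apply: reg1.1; rewrite ?subrK.
    rewrite -{3}(subrK c Q); apply: rel1.1; by rewrite ?subrK.
  exists w; split=> // t; split=> r; last by rewrite !Z2E; lia.
  by move=> r1 r2; have := wcon t (r + c); rewrite /con !addrK r1 r2 => /(_ isT).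
Qed.

(** The array U1 need not be good. It is joined to the good mesh V0 by a polynomial path, on which
    good meshes occur wherever countably many nonzero polynomials do not vanish. *)
Lemma good_path (n : nat) V0 (U1 : Z2 -> 'rV[R]_3) : width%:Z <= n%:Z ->
  good S V0 -> window_rel S U1 -> window_reg U1 ->
  (forall Q, width%:Z < Q.2 <= n%:Z -> propto (U1 Q) (meetF S U1 Q)) ->
  exists W : R -> Z2 -> 'rV[R]_3,
    [/\ forall Q, fr_vec (@polyfun R) (W ^~ Q),
        forall Q, 0 < Q.2 <= width%:Z -> W 0 Q = V0 Q,
        forall Q, 0 < Q.2 <= n%:Z -> W 1 Q = U1 Q &
        forall g, polyfun g -> (exists t, g t != 0) ->
          exists t, g t != 0 /\ good S (W t)].
Proof.
move=> hn gV0 rel1 reg1 F1.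
have rel0 : window_rel S V0.
  by apply: (good_window gV0) => Q _; exact: propto_refl.
have [w [fw w0 w1 wrel]] := window_path rel0 (good_window_reg gV0) rel1 reg1.
have extU Q : 0 < Q.2 <= n%:Z -> propto (ext S U1 Q) (U1 Q).
  move=> hQ; apply: (@ext_propto _ S U1 U1 1 n%:Z) => // Q'; last by lia.
  by move=> _; exact: propto_refl.
(* At t = 1 the extension recovers U1 only up to scalars; the constant factors [k Q] correct
   this. *)
have [k kE] : exists k : Z2 -> R, forall Q, [/\ k Q != 0,
    0 < Q.2 <= n%:Z -> U1 Q = k Q *: ext S U1 Q &
    0 < Q.2 <= width%:Z -> k Q = 1].
  suff /choice[k kE] : forall Q, exists k : R, [/\ k != 0,
    0 < Q.2 <= n%:Z -> U1 Q = k *: ext S U1 Q &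
    0 < Q.2 <= width%:Z -> k = 1] by exists k.
  move=> Q.
  have [hQ|hQ] := boolP (0 < Q.2 <= width%:Z).
    by exists 1; split=> // _; rewrite ?oner_neq0 // ext_window // scale1r.
  have [/extU/propto_sym[k k0 kE]|hQ'] := boolP (0 < Q.2 <= n%:Z).
    by exists k; split.
  by exists 1; split=> //; exact: oner_neq0.
have k0 Q : k Q != 0 by have [] := kE Q.
have frp := polyfun_ring R.
have fext Q : fr_vec (@polyfun R) (fun t => ext S (w t) Q).
  by apply: (fr_ext frp) => Q' _; exact: fw.
exists (fun t Q => k Q *: ext S (w t) Q); split.
- by move=> Q; apply: (fr_vecZ frp) (fext Q); exact: (fr_const frp).
- move=> Q hQ; have [_ _ /(_ hQ) ->] := kE Q.
  by rewrite scale1r ext_window // w0.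
- move=> Q hQ; have [_ /(_ hQ) -> _] := kE Q.
  by congr (_ *: ext S _ _); apply/funext => Q'; rewrite w1.
move=> g pg g0.
(* The conditions are g and the nondegeneracy at each r; the latter holds at t = 0 because V0 is
   good. *)
pose f i t := if i is j.+1 then
    if unpickle j is Some r then nd S (ext S (w t)) r else 1
  else g t.
have [t ft] : exists t, forall i, f i t != 0.
  apply: polyfun_avoid => -[|j] //; rewrite /f; case: (unpickle j) => [r|].
  - exact: (fr_nd frp).
  - exact: (fr_const frp).
  - exists 0; apply: nd_propto (good_nd gV0 r) => Q; apply/propto_sym.
    by apply: (ext_good_propto gV0) => Q' _; rewrite w0; exact: propto_refl.
  - by exists 0; exact: oner_neq0.
exists t; split; first exact: ft 0%N.
apply: (@good_propto _ S (ext S (w t))) => [Q|].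
  by apply/propto_sym; exists (k Q).
by apply: ext_good => // r; have := ft (pickle r).+1; rewrite /f pickleK.
Qed.
End Paths.

(** * The S-map of minimal order *)

Section RowMaps.
Variables (R : realType) (n : nat).
Implicit Types (v : 'I_n -> int -> 'rV[R]_3) (A : polygons R n).
Variable G : ('I_n -> int -> 'rV[R]_3) -> int -> 'rV[R]_3.

Lemma ratrow_of : (forall i, fr_vec (@cfun R n) (G ^~ i)) ->
  exists phi : ratrow R n, forall A B, row_value phi A B <->
    forall i v, lifts v A -> val (B i) = <[G v i]>%VS.
Proof.
move=> cG; have /choice[phi phiE] : forall i, exists p : 'I_3 -> cpoly R n,
    forall l v, ceval (p l) v = G v i 0 l.
  by move=> i; have /choice[p pE] := cG i; exists p.
exists phi => A B; suff e i v : \row_l ceval (phi i l) v = G v i.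
  by split=> BE i v vA; rewrite (BE i v vA) e.
by apply/rowP => l; rewrite mxE phiE.
Qed.

(** The factor det g is the one that a meet acquires under g; it does not change the point. *)
Lemma ratrow_equivariant (X : set (polygons R n)) (phi : ratrow R n) :
  (forall A B, row_value phi A B <->
    forall i v, lifts v A -> val (B i) = <[G v i]>%VS) ->
  (forall g v i, G (fun j i => v j i *m g) i = \det g *: (G v i *m g)) ->
  PGL_equivariant X phi.
Proof.
move=> phiE Gg g A A' B B' gu _ _ AA' /phiE AB /phiE AB' i.
have [v vA] := lifts_exist A; rewrite /proj_transform (AB i v vA) limg_line.
rewrite lfunE /= (AB' i (fun j i => v j i *m g)); last first.
  by move=> j k; exact: proj_transform_val (vA j k) (AA' j k).
rewrite Gg; apply/vline_eqP; last by exists (\det g); rewrite // -unitfE -unitmxE.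
rewrite -Gg; apply: (@vline_neq0 _ (B' i)); apply: AB' => j k.
exact: proj_transform_val (vA j k) (AA' j k).
Qed.

Lemma arr_mulmx (g : 'M[R]_3) v Q :
  arr (fun j i => v j i *m g) Q = arr v Q *m g.
Proof.
rewrite /arr; case: Q.2 => [[|k]|k]; rewrite ?mul0mx //.
by case: insub => [j|] //; rewrite mul0mx.
Qed.
End RowMaps.

Section Stability.
Variables (R : realType) (n : nat).

(** Composing a polynomial that vanishes on the stable set Y with g gives another one that vanishes
    on Y. *)
Lemma PGL_stable_zclosure (Y : set (polygons R n)) :
  PGL_stable Y -> PGL_stable (zclosure Y).
Proof.
move=> sY g A B gu AB YA f fY w wB.
have frc := @cfun_ring R n.
have [c cE] : cfun (fun v => ceval f (fun j i => v j i *m g)).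
  apply: (fr_ceval frc) => j i; apply: (fr_vec_mulmx frc); exact: cfun_coord.
have cA : vanishes c A.
  apply: YA => C YC u uC; rewrite cE.
  have ug0 j i : u j i *m g != 0.
    apply: contraNneq (vline_neq0 (uC j i)) => ug.
    by rewrite -(mulmxK gu (u j i)) ug mul0mx.
  apply: (fY (fun j i => pt (u j i *m g))) => [|j i]; last by rewrite val_pt.
  apply: (sY g C) => // j i; rewrite /proj_transform uC limg_line lfunE /=.
  exact: val_pt.
have wg : (fun j i => w j i *m invmx g *m g) = w.
  by apply/funext => j; apply/funext => i; rewrite mulmxKV.
have := cA (fun j i => w j i *m invmx g); rewrite cE wg; apply => j i.
have [v vA] := lifts_exist A.
rewrite vA; apply/vline_eqP; first exact: vline_neq0 (vA j i).
have [k k0 ->] := vline_propto (wB j i) (proj_transform_val (vA j i) (AB j i)).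
by apply/propto_sym; exists k => //; rewrite -scalemxAl mulmxK.
Qed.

(** If all the equations of C held on X, they would hold on its closure. *)
Lemma zclosed_witness (X C : set (polygons R n)) : zclosed C ->
  ~ (zclosure X `<=` C)%classic ->
  exists f A v, [/\ forall B, C B -> vanishes f B, X A, lifts v A & ceval f v != 0].
Proof.
move=> [I ->] /existsNP[A /not_implyP[XA /existsNP[f /not_implyP[If fA]]]].
have /existsNP[B /not_implyP[XB /Nvanishes[v vB fv]]] : ~ forall B, X B -> vanishes f B.
  by move=> /XA.
by exists f, B, v; split=> // D; apply.
Qed.
End Stability.

Lemma uniq3E (T : eqType) (x y z : T) :
  uniq [:: x; y; z] = [&& x != y, x != z & y != z].
Proof. by rewrite /= !inE negb_or !andbT andbA. Qed.

Lemma uniq4E (T : eqType) (x y z t : T) : uniq [:: x; y; z; t] =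
  [&& [&& x != y, x != z & x != t], (y != z) && (y != t) & z != t].
Proof. by rewrite /= !inE !negb_or andbT. Qed.

Section Smap.
Variables (R : realType) (S : Ypin).
Local Notation a := (pa S).
Local Notation b := (pb S).
Local Notation c := (pc S).
Local Notation d := (pd S).
Local Notation width := (width S).
Local Notation Y := (@good_rows R S width).
Implicit Types (V : Z2 -> 'rV[R]_3) (Q r : Z2).

Lemma good_rows_PGL_stable (n : nat) : PGL_stable (@good_rows R S n).
Proof.
move=> g A B gu AB [V gV VA]; exists (fun Q => V Q *m g); first exact: good_mulmx.
by move=> j i; exact: proj_transform_val (VA j i) (AB j i).
Qed.

(** If neither closed set contained the closure, there would be polynomials f1 and f2, vanishing on
    C1 and C2, that are nonzero at two good windows. On a path joining these windows some good
    window makes both nonzero, so it lies in neither set. *)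
Lemma zirreducible_good : (exists V, good S V) -> zirreducible (zclosure Y).
Proof.
move=> [V0 gV0]; split.
  by exists (rows width 0 (mesh_of V0)); apply/sub_zclosure/good_rows_mesh_of.
move=> C1 C2 cC1 cC2 sub12; apply: contrapT => /not_orP[].
move=> /(zclosed_witness cC1)[f1 [A1 [v1 [fC1 YA1 v1A1 f1v]]]].
move=> /(zclosed_witness cC2)[f2 [A2 [v2 [fC2 YA2 v2A2 f2v]]]].
have [V1 gV1 V1E] := good_lift YA1 v1A1; have [V2 gV2 V2E] := good_lift YA2 v2A2.
have winE V v : (forall (j : 'I_width) i, V (i, j.+1%:Z) = v j i) -> win V = v.
  by move=> e; apply/funext => j; apply/funext => i; exact: e.
have [||Q|W [fW W0 W1 gW]] := @good_path R S width V1 V2 (lexx _) gV1.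
- by apply: (good_window gV2) => Q _; exact: propto_refl.
- exact: good_window_reg.
- by lia.
have frp := polyfun_ring R.
have W0E : win (W 0) = v1.
  by rewrite -(winE _ _ V1E); apply/funext => j; apply/funext => i;
     rewrite /win W0 //=; have := ltn_ord j; lia.
have W1E : win (W 1) = v2.
  by rewrite -(winE _ _ V2E); apply/funext => j; apply/funext => i;
     rewrite /win W1 //=; have := ltn_ord j; lia.
have pf (f : cpoly R width) : polyfun (fun t => ceval f (win (W t))).
  by apply: (fr_ceval frp) => j i; exact: fW.
(* The sequence f1, f2, f2, ... gives a parameter at which the product is nonzero, as [gW]
   requires. *)
have [t f12] : exists t, forall k : nat,
    ceval (if k is 0 then f1 else f2) (win (W t)) != 0.
  apply: polyfun_avoid => // -[|k]; first by exists 0; rewrite W0E.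
  by exists 1; rewrite W1E.
have [|t' [f12' gWt]] := gW (fun t => ceval f1 (win (W t)) * ceval f2 (win (W t)))
    (fr_mul frp (pf f1) (pf f2)).
  by exists t; rewrite mulf_neq0 //; [exact: (f12 0%N)|exact: (f12 1%N)].
have Wlift : lifts (win (W t')) (rows width 0 (mesh_of (W t'))).
  by move=> j i; rewrite /rows add0r (val_mesh_of _ gWt).
have [|/fC1/(_ _ Wlift)|/fC2/(_ _ Wlift)] := sub12 (rows width 0 (mesh_of (W t'))).
- by apply/sub_zclosure/good_rows_mesh_of.
- by move=> e; rewrite e mul0r eqxx in f12'.
- by move=> e; rewrite e mulr0 eqxx in f12'.
Qed.

(** The intersection rule may be applied to any lift of the rows, as a change of lift only rescales
    the meet. *)
Lemma good_fwd V k i v : good S V -> lifts v (rows width k (mesh_of V)) ->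
  <[V (i, (k + width.+1%:Z)%R)]>%VS = <[meetF S (arr v) (i, width.+1%:Z)]>%VS.
Proof.
move=> gV vV; pose U Q := V (Q + (0, k)).
have gU : good S U by exact: good_shift.
have vU Q : 0 < Q.2 <= width%:Z -> propto (arr v Q) (U Q).
  by move=> hQ; apply: vline_propto (lifts_rows vV hQ) _; rewrite (val_mesh_of _ gV).
apply/vline_eqP; first exact: good_neq0 gV _.
have -> : V (i, k + width.+1%:Z) = U (i, width.+1%:Z).
  by rewrite /U; congr V; rewrite [RHS]surjective_pairing !Z2E /= addr0 addrC.
apply: propto_trans (good_meetF gU _) _; apply/propto_sym.
have [|? ? ? ?] := @meetF_local S (fun Q => propto (arr v Q) (U Q)) (i, width.+1%:Z).
  by move=> Q /= hQ; apply: vU; lia.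
exact: meet_propto.
Qed.

Lemma good_bwd V (k : int) i v : good S V -> lifts v (rows width (k + 1) (mesh_of V)) ->
  <[V (i, (k + 1)%R)]>%VS = <[meetB S (arr v) (i, 0%R)]>%VS.
Proof.
move=> gV vV; pose U Q := V (Q + (0, k + 1)).
have gU : good S U by exact: good_shift.
have vU Q : 0 < Q.2 <= width%:Z -> propto (arr v Q) (U Q).
  by move=> hQ; apply: vline_propto (lifts_rows vV hQ) _; rewrite (val_mesh_of _ gV).
apply/vline_eqP; first exact: good_neq0 gV _.
have -> : V (i, k + 1) = U (i, 0).
  by rewrite /U; congr V; rewrite [RHS]surjective_pairing !Z2E /= addr0 add0r.
apply: propto_trans (good_meetB gU _) _; apply/propto_sym.
have [|? ? ? ?] := @meetB_local S (fun Q => propto (arr v Q) (U Q)) (i, 0).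
  by move=> Q /= hQ; apply: vU; lia.
exact: meet_propto.
Qed.

Lemma good_collinear_distinct V : good S V -> collinear_distinct S (mesh_of V).
Proof.
move=> gV r; have [aP bP cP dP] := mem_pin S.
have /ndP[[ab ac ad] [bc bd cd] _ _] := good_nd gV r; split.
  rewrite /collinear4 !(val_mesh_of _ gV); apply: leq_trans (dimv_line2 (V (r + b)) (V (r + c))).
  by apply: dimvS; rewrite !subv_add !subv_line2 !memv_line2 //
    !(good_det3 gV) // !eqxx.
have neq Q Q' : (mesh_of V Q != mesh_of V Q') = (cross (V Q) (V Q') != 0).
  exact: RP2_neqP (val_mesh_of Q gV) (val_mesh_of Q' gV).
by rewrite uniq4E; apply/and3P; split; [apply/and3P; split|apply/andP; split|];
  rewrite neq.
Qed.

(** The point above the window is a nonzero meet of four vectors of the window, so three of these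
    are independent. *)
Lemma good_spanning (A : polygons R width) : good_rows S A -> spanning A.
Proof.
move=> [V gV VA] L AL.
have inL Q : 0 < Q.2 <= width%:Z -> (<[V Q]> <= L)%VS.
  by move=> /row_index[j ->]; rewrite -VA; exact: AL.
have /ndP[_ _ + _] := good_nd gV (0, width.+1%:Z).
have [|i1 i2 i3 i4] := @meetF_local S (fun Q => <[V Q]> <= L)%VS (0, width.+1%:Z).
  by move=> Q /= hQ; apply: inL; lia.
rewrite /meetF; set u := V _ in i1 *; set v := V _ in i2 *; set w := V _ in i3 *.
set z := V _ in i4 * => nF.
have fullL x : (<[x]> <= L)%VS -> det3 u v x != 0 -> L = fullv.
  move=> xL /det3_neq0_full e; apply/eqP.
  by rewrite eqEsubv subvf -e !subv_add i1 i2.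
have [dw|] := eqVneq (det3 u v w) 0; last exact: fullL.
have [dz|] := eqVneq (det3 u v z) 0; last exact: fullL.
by case/eqP: nF; rewrite /meet dw dz !scale0r subr0.
Qed.

(** The map adds row [width] + 1 by [meetF], its inverse adds row 0 by [meetB]. The generic
    properties hold at all good windows, where they are read off from the good mesh. *)
Lemma Smap_width : (exists V, good S V) -> exists phi : ratrow R width,
  (forall V k, good S V -> fwd_at phi (mesh_of V) k) /\
  is_Smap S (zclosure Y) phi.
Proof.
move=> exg; have frc := @cfun_ring R width.
have carr Q : fr_vec (@cfun R width) (fun v => arr v Q).
  by apply: fr_arr => // j i; exact: cfun_coord.
have [phi phiE] := @ratrow_of R width (fun v i => meetF S (arr v) (i, width.+1%:Z))
  (fun i => fr_meetF frc (fun Q _ => carr Q)).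
have [psi psiE] := @ratrow_of R width (fun v i => meetB S (arr v) (i, 0))
  (fun i => fr_meetB frc (fun Q _ => carr Q)).
have fwd V k : good S V -> fwd_at phi (mesh_of V) k.
  by move=> gV; apply/phiE => i v vV; rewrite (val_mesh_of _ gV) (good_fwd i gV vV).
have bwd V k : good S V -> bwd_at psi (mesh_of V) k.
  by move=> gV; apply/psiE => i v vV; rewrite (val_mesh_of _ gV) (good_bwd i gV vV).
have arrg (g : 'M[R]_3) v : arr (fun j i => v j i *m g) = (fun Q => @arr R width v Q *m g).
  by apply/funext => Q; exact: arr_mulmx.
(* The relations within a window are polynomial, so they pass from good windows to the closure, in
   which good windows are dense. *)
have genY : generic (zclosure Y) Y.
  apply: (@generic_good_rows R S width _ (lexx _)) => [A v XA vA|A XA f fY].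
    split=> [|Q]; last by lia.
    have zeroX (f : ('I_width -> int -> 'rV[R]_3) -> R) : cfun f ->
        (forall V, good S V -> forall v, (forall Q, 0 < Q.2 <= width%:Z ->
           propto (arr v Q) (V Q)) -> f v = 0) -> f v = 0.
      move=> [p pE] f0; rewrite -pE; apply: XA vA => B [V gV VB] u uB.
      rewrite pE; apply: (f0 V gV) => Q hQ.
      have := lifts_propto uB VB hQ; have [j ->] := row_index hQ.
      by rewrite [X in propto _ X]arrE.
    split=> r h1 h2.
      apply: (zeroX (fun v => det3 (arr v (r + a)) (arr v (r + b)) (arr v (r + c)))).
        exact: (fr_det3 frc).
      by move=> V gV u uV; have [w _] := good_window gV uV; exact: w.
    apply: (zeroX (fun v => det3 (arr v (r + b)) (arr v (r + c)) (arr v (r + d)))).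
      exact: (fr_det3 frc).
    by move=> V gV u uV; have [_ w] := good_window gV uV; exact: w.
  by apply: XA => B YB; apply: fY; split=> //; exact: sub_zclosure.
exists phi; split=> //; split; [split|split].
- exact: zclosure_closed.
- exact: zirreducible_good.
- exact/PGL_stable_zclosure/good_rows_PGL_stable.
- exact: generic_imp good_spanning genY.
exists psi.
have XV V k : good S V -> zclosure Y (rows width k (mesh_of V)).
  by move=> gV; apply/sub_zclosure/good_rows_mesh_of.
split.
- by apply: ratrow_equivariant phiE _ => g v i; rewrite arrg meetF_mulmx.
- by apply: ratrow_equivariant psiE _ => g v i; rewrite arrg meetB_mulmx.
- by split; apply: generic_imp genY => A [V gV VA]; exists (mesh_of V);
    (split; [exact: (lifts_mesh_of gV VA)|auto|auto|auto]).
apply: generic_imp genY => A [V gV VA]; exists (mesh_of V); split.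
- exact: (lifts_mesh_of gV VA).
- by move=> k; split; auto.
- exact: good_collinear_distinct.
Qed.
End Smap.

(** * Reduction of T_{2,S} to the minimal order *)

Section Reduction.
Variables (R : realType) (S : Ypin).
Local Notation a := (pa S).
Local Notation b := (pb S).
Local Notation c := (pc S).
Local Notation d := (pd S).
Local Notation width := (width S).
Local Notation m := (order2 S).
Implicit Types (V : Z2 -> 'rV[R]_3) (Q r : Z2).

Lemma order2E : m%:Z = d.2 - a.2.
Proof. by have [] := Ypin_rows S; rewrite /order2; lia. Qed.

Lemma width_le_order2 : (width <= m)%N.
Proof.
have [? ? ?] := Ypin_rows S; have [? ? ? ?] := width_bounds S.
by have := order2E; lia.
Qed.

Lemma L1_rangeP r : L1_range S r <-> (0 < (r + a).2) && ((r + c).2 <= m%:Z).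
Proof. by rewrite /L1_range !Z2E; split; lia. Qed.

Lemma L2_rangeP r : L2_range S r <-> (0 < (r + b).2) && ((r + d).2 <= m%:Z).
Proof. by rewrite /L2_range !Z2E; split; lia. Qed.

(** Above the window, Q lies on the line of (L1) at Q - c and on that of (L2) at Q - d. These lines
    are distinct by the last condition of [X2_reg], so Q is their meet. *)
Lemma X2_reg_facts (A : polygons R m) v : X2_reg R S A -> lifts v A ->
  [/\ forall r, L1_range S r ->
        det3 (arr v (r + a)) (arr v (r + b)) (arr v (r + c)) = 0 /\
        cross (arr v (r + a)) (arr v (r + b)) != 0,
      forall r, L2_range S r ->
        [/\ det3 (arr v (r + b)) (arr v (r + c)) (arr v (r + d)) = 0,
            cross (arr v (r + b)) (arr v (r + c)) != 0 &
            cross (arr v (r + c)) (arr v (r + d)) != 0] &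
      forall Q, width%:Z < Q.2 <= m%:Z ->
        propto (arr v Q) (meetF S (arr v) Q)].
Proof.
move=> [[P [PA P1 P2]] [P' [P'A P'1 P'2 P'12]]] vA.
have [ab bc cd] := Ypin_rows S; have [wd1 wd2 wd3 wd4] := width_bounds S.
have mE := order2E.
have PE Q : 0 < Q.2 -> Q.2 <= m%:Z -> val (P Q) = <[arr v Q]>%VS.
  move=> h1 h2; rewrite -PA in vA.
  have := lifts_rows vA (_ : 0 < Q.2 <= m%:Z); rewrite h1 h2 => /(_ isT).
  by rewrite (_ : (0, 0) = 0 :> Z2) ?addr0.
have P'E Q : 0 < Q.2 -> Q.2 <= m%:Z -> val (P' Q) = <[arr v Q]>%VS.
  move=> h1 h2; rewrite -P'A in vA.
  have := lifts_rows vA (_ : 0 < Q.2 <= m%:Z); rewrite h1 h2 => /(_ isT).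
  by rewrite (_ : (0, 0) = 0 :> Z2) ?addr0.
have F1 r : L1_range S r ->
    det3 (arr v (r + a)) (arr v (r + b)) (arr v (r + c)) = 0 /\
    cross (arr v (r + a)) (arr v (r + b)) != 0.
  move=> hr; have /L1_rangeP := hr; rewrite !Z2E => hr'.
  have := P'1 r hr; rewrite uniq3E => /and3P[nab nac nbc]; split.
    by apply/(collinearP (PE _ _ _) (PE _ _ _) (PE _ _ _)); rewrite ?Z2E; [lia..|exact: P1].
  by rewrite -(RP2_neqP (P'E _ _ _) (P'E _ _ _)) // Z2E; lia.
have F2 r : L2_range S r ->
    [/\ det3 (arr v (r + b)) (arr v (r + c)) (arr v (r + d)) = 0,
        cross (arr v (r + b)) (arr v (r + c)) != 0 &
        cross (arr v (r + c)) (arr v (r + d)) != 0].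
  move=> hr; have /L2_rangeP := hr; rewrite !Z2E => hr'.
  have := P'2 r hr; rewrite uniq3E => /and3P[nbc nbd ncd]; split.
  - by apply/(collinearP (PE _ _ _) (PE _ _ _) (PE _ _ _)); rewrite ?Z2E; [lia..|exact: P2].
  - by rewrite -(RP2_neqP (P'E _ _ _) (P'E _ _ _)) // Z2E; lia.
  - by rewrite -(RP2_neqP (P'E _ _ _) (P'E _ _ _)) // Z2E; lia.
split=> // Q /andP[hQ1 hQ2].
(* Rows between [width] and d.2 - a.2 exist only if d is above c, because [width] is at least c.2 -
   a.2. *)
have hcd : c.2 < d.2 by lia.
have h1 : L1_range S (Q - c) by apply/L1_rangeP; rewrite !Z2E; lia.
have h2 : L2_range S (Q - d) by apply/L2_rangeP; rewrite !Z2E; lia.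
have [d1 x1] := F1 _ h1; have [d2 x2 _] := F2 _ h2.
rewrite /meetF /e1 /e2 hcd; apply: meet_prop => //.
- apply/eqP => m0; have := P'12 (Q - c - d); rewrite subrK addrAC subrK => /(_ h1 h2).
  have ed x : Q - c - d + x + d = Q - c + x by rewrite addrAC subrK.
  have ec x : Q - c - d + x + c = Q - d + x by rewrite addrAC (addrAC Q) subrK.
  apply; rewrite !ed !ec.
  by apply: line_through_eq m0 => //; apply: P'E; rewrite !Z2E; lia.
- by apply: (@vline_neq0 _ (P Q)); apply: PE; lia.
- by rewrite subrK in d1.
- by rewrite subrK in d2.
Qed.

Lemma good_X2_reg V : good S V -> X2_reg R S (rows m 0 (mesh_of V)).
Proof.
move=> gV; have vE Q := val_mesh_of Q gV; have [aP bP cP dP] := mem_pin S.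
have col x y z r : x \in pin S -> y \in pin S -> z \in pin S ->
    collinear (mesh_of V (r + x)) (mesh_of V (r + y)) (mesh_of V (r + z)).
  by move=> *; apply/(collinearP (vE _) (vE _) (vE _)); exact: (good_det3 gV).
have neq Q Q' : cross (V Q) (V Q') != 0 -> mesh_of V Q != mesh_of V Q'.
  by rewrite (RP2_neqP (vE Q) (vE Q')).
split; first by exists (mesh_of V); split=> // r _; exact: col.
exists (mesh_of V); split=> // r.
- move=> _; have /ndP[[ab ac ad] [bc bd cd] _ _] := good_nd gV r.
  by rewrite uniq3E; apply/and3P; split; exact: neq.
- move=> _; have /ndP[[ab ac ad] [bc bd cd] _ _] := good_nd gV r.
  by rewrite uniq3E; apply/and3P; split; exact: neq.
move=> /L1_rangeP h1 /L2_rangeP h2; have [? ? ?] := Ypin_rows S.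
have hcd : c.2 < d.2.
  by move: h1 h2; have := order2E; rewrite !Z2E; lia.
(* The two lines through this point are distinct because their meet is nonzero. *)
have /ndP[_ _ + _] := good_nd gV (r + c + d).
rewrite /meetF /e1 /e2 hcd !addrK (addrAC r c d) !addrK.
rewrite !(addrAC r _ d) !(addrAC r _ c).
have /ndP[[ab _ _] _ _ _] := good_nd gV (r + d).
exact: line_through_meet (vE _) (vE _) (vE _) (vE _) ab.
Qed.

Lemma X2_reg_window (A : polygons R m) v : X2_reg R S A -> lifts v A ->
  [/\ window_rel S (arr v), window_reg S (arr v) &
    forall Q, width%:Z < Q.2 <= m%:Z -> propto (arr v Q) (meetF S (arr v) Q)].
Proof.
have hwm := width_le_order2.
move=> XA vA; have [F1 F2 F3] := X2_reg_facts XA vA.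
split=> //; split=> r h1 h2.
- by have [|] := F1 r; first by apply/L1_rangeP; lia.
- by have [|] := F2 r; first by apply/L2_rangeP; lia.
- by have [|] := F1 r; first by apply/L1_rangeP; lia.
- by have [|] := F2 r; first by apply/L2_rangeP; lia.
Qed.

(** A polynomial nonzero at the given array, which is the end of a path from a good mesh, is also
    nonzero at some good array on the path. *)
Lemma X2_reg_dense : (exists V, good S V) ->
  (X2_reg R S `<=` zclosure (X2_reg R S `&` @good_rows R S m))%classic.
Proof.
move=> [V0 gV0] A XA f fY v vA; have hwm : width%:Z <= m%:Z.
  by have := width_le_order2; lia.
have [rel1 reg1 F1] := X2_reg_window XA vA.
have [W [fW W0 W1 gW]] := good_path hwm gV0 rel1 reg1 F1.
apply/eqP/negPn/negP => fv.
have W1E : win (W 1) = v.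
  apply/funext => j; apply/funext => i; rewrite /win W1 ?arrE //=.
  by have := ltn_ord j; lia.
have [||t [ft gWt]] := gW (fun t => ceval f (win (W t))).
- by apply: (fr_ceval (polyfun_ring R)) => j i; exact: fW.
- by exists 1; rewrite W1E.
case/eqP: ft; apply: (fY (rows m 0 (mesh_of (W t)))).
  by split; [exact: good_X2_reg|exact: good_rows_mesh_of].
by move=> j i; rewrite /rows add0r (val_mesh_of _ gWt).
Qed.

Lemma reducible_width : (exists V, good S V) -> reducible_to R S width.
Proof.
move=> exg; have [phi [fwd Sphi]] := Smap_width exg.
split; first exact: width_le_order2.
exists (zclosure (@good_rows R S width)), phi; split=> //.
have hwm : width%:Z <= m%:Z by have := width_le_order2; lia.
apply: (@generic_imp _ _ _ (@good_rows R S m)) => [A [V gV VA]|].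
  exists (mesh_of V); split; first exact: lifts_mesh_of gV VA.
    by move=> k _; apply/sub_zclosure/good_rows_mesh_of.
  by move=> k _; exact: fwd.
apply: generic_good_rows => // [A v XA vA|]; last exact: X2_reg_dense.
by have [] := X2_reg_window XA vA.
Qed.
End Reduction.

(** * Minimality *)

Section Perturbation.
Variables (R : realType) (S : Ypin).
Local Notation a := (pa S).
Local Notation b := (pb S).
Local Notation c := (pc S).
Local Notation d := (pd S).
Local Notation width := (width S).
Implicit Types (V : Z2 -> 'rV[R]_3) (Q r : Z2).

(* Fixing the coefficients of the linear relations between the lifts of a mesh
   makes their deformations linear; we move one point along the line joining
   the two others and all other points in the same direction. *)
Lemma perturb_triple V (p q s Q0 : Z2) (k l : int) :
  p.2 <= s.2 -> q.2 <= s.2 ->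
  k * p.1 + l * p.2 < k * s.1 + l * s.2 -> k * q.1 + l * q.2 < k * s.1 + l * s.2 ->
  (forall r, cross (V (r + p)) (V (r + q)) != 0) ->
  (forall r, det3 (V (r + p)) (V (r + q)) (V (r + s)) = 0) ->
  exists w : R -> Z2 -> 'rV[R]_3,
    [/\ forall Q, fr_vec (@polyfun R) (w ^~ Q), w 0 =1 V,
        forall t r, det3 (w t (r + p)) (w t (r + q)) (w t (r + s)) = 0,
        forall t Q, Q.2 < Q0.2 -> w t Q = V Q &
        forall t, w t Q0 = V Q0 + t *: V (Q0 - s + p)].
Proof.
move=> ps qs lps lqs Vpq Vpqs.
have /choice[xy xyE] Q : exists xy : R * R,
    V Q = xy.1 *: V (Q - s + p) + xy.2 *: V (Q - s + q).
  have := Vpqs (Q - s); rewrite subrK => /(det3_eq0_comb (Vpq _))[x [y e]].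
  by exists (x, y).
pose lam Q : int := k * (Q.1 - Q0.1) + l * (Q.2 - Q0.2).
(* Let e be the point of role p on the line on which Q0 has the role s. Then [g Q] says by which
   multiple of t e the point Q is displaced: Q0 by t e itself, other points in lower rows or with
   [lam Q <= 0] not at all, and the rest as the coefficients of V dictate. *)
pose step (g : Z2 -> R) Q := if Q == Q0 then 1 else
  if (Q.2 < Q0.2) || (lam Q <= 0) then 0
  else (xy Q).1 * g (Q - s + p) + (xy Q).2 * g (Q - s + q).
pose h Q := `|(Num.max 0 (lam Q))%R|%N.
pose g := mfix h step (fun=> 0).
have lamp Q : lam (Q - s + p) < lam Q.
  by rewrite /lam !Z2E; move: lps; nia.
have lamq Q : lam (Q - s + q) < lam Q.
  by rewrite /lam !Z2E; move: lqs; nia.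
have gE Q : g Q = step g Q.
  apply: mfixE => g1 g2 {}Q g12; rewrite /step; case: eqP => // _.
  case: ifPn => // /norP[_]; rewrite -ltNge => Q_gt0.
  have := lamp Q; have := lamq Q; move=> hq hp.
  by congr (_ * _ + _ * _); apply: g12; rewrite /h; lia.
have lam0 : lam Q0 = 0 by rewrite /lam !subrr !mulr0 addr0.
have g0 : g Q0 = 1 by rewrite gE /step eqxx.
have glow Q : Q != Q0 -> (Q.2 < Q0.2) || (lam Q <= 0) -> g Q = 0.
  by move=> /negPf nQ hQ; rewrite gE /step nQ hQ.
have gp : g (Q0 - s + p) = 0.
  have hp := lamp Q0; apply: glow; last by rewrite -lam0 (ltW hp) orbT.
  by apply: contraTneq hp => ->; rewrite ltxx.
have gq : g (Q0 - s + q) = 0.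
  have hq := lamq Q0; apply: glow; last by rewrite -lam0 (ltW hq) orbT.
  by apply: contraTneq hq => ->; rewrite ltxx.
(* If Q belongs to the fixed region, so do its two predecessors: they are in no higher row, have
   smaller [lam] and differ from Q0. *)
have grel Q : Q != Q0 ->
    g Q = (xy Q).1 * g (Q - s + p) + (xy Q).2 * g (Q - s + q).
  move=> nQ; have [hQ|hQ] := boolP ((Q.2 < Q0.2) || (lam Q <= 0)); last first.
    by rewrite {1}gE /step (negPf nQ) (negPf hQ).
  have low Q' : Q'.2 <= Q.2 -> lam Q' < lam Q -> g Q' = 0.
    move=> r' l'; apply: glow; last by case/orP: hQ => ?; apply/orP; [left|right]; lia.
    by apply/eqP => e; move: r' l'; rewrite e lam0; case/orP: hQ; lia.
  have -> : g (Q - s + p) = 0 by apply: low (lamp Q); rewrite !Z2E; lia.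
  have -> : g (Q - s + q) = 0 by apply: low (lamq Q); rewrite !Z2E; lia.
  by rewrite (glow Q nQ hQ) !mulr0 addr0.
pose e := V (Q0 - s + p); pose w t Q := V Q + (t * g Q) *: e.
have frp := polyfun_ring R.
exists w; split.
- move=> Q; apply: (fr_vecD frp); first exact: (fr_vec_const frp).
  apply: (fr_vecZ frp); last exact: (fr_vec_const frp).
  by apply: (fr_mul frp (polyfun_id R)); exact: (fr_const frp).
- by move=> Q; rewrite /w mul0r scale0r addr0.
(* At Q0 the relation between the coefficients changes, but Q0 moves towards a point of its own
   line, whose two spanning points stay fixed. *)
- move=> t r; have [e0|nQ] := eqVneq (r + s) Q0.
    have -> : r = Q0 - s by rewrite -e0 addrK.
    rewrite subrK /w gp gq g0 mulr0 scale0r !addr0 mulr1 -/e [V Q0]xyE -/e.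
    by rewrite [X in det3 _ _ X]addrAC -scalerDl; exact: det3_combr.
  have := grel _ nQ; have := xyE (r + s); rewrite !addrK /w => -> ->.
  move: (xy _).1 (xy _).2 => x y.
  rewrite -[X in det3 _ _ X](_ : x *: (V (r + p) + (t * g (r + p)) *: e)
    + y *: (V (r + q) + (t * g (r + q)) *: e) = _) ?det3_combr //.
  rewrite !scalerDr !scalerA addrACA -scalerDl; congr (_ + _ *: _); ring.
- move=> t Q hQ; rewrite /w glow ?mulr0 ?scale0r ?addr0 ?hQ //.
  by apply: contraTneq hQ => ->; rewrite ltxx.
- by move=> t; rewrite /w g0 mulr1.
Qed.

(** When c and d share a row, rows do not separate them, and the functional has to be tilted. *)
Lemma separating_functional : exists k l : int,
  k * b.1 + l * b.2 < k * d.1 + l * d.2 /\ k * c.1 + l * c.2 < k * d.1 + l * d.2.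
Proof.
have [ab bc cd] := Ypin_rows S; have [cd'|cd'] := ltP c.2 d.2.
  by exists 0, 1; lia.
have e2 : c.2 = d.2 by lia.
have e1 : d.1 != c.1.
  have := pin_uniq S; rewrite /pin uniq4E => /and3P[_ _].
  by apply: contraNneq => e1; rewrite [c]surjective_pairing [d]surjective_pairing e1 e2.
(* The sign makes the difference between d and c positive; the large weight of the row makes the
   difference between d and b at least 1, since b is in a lower row. *)
exists (Num.sg (d.1 - c.1)), (1 + `|d.1 - b.1|).
by move: bc e1; rewrite e2; case: sgrP; nia.
Qed.

(** The window is deformed by [perturb_triple] and then extended anew; all but countably many
    parameters give a good mesh. *)
Lemma good_perturb V Q0 : good S V -> 0 < Q0.2 <= width%:Z ->
  exists V', [/\ good S V', forall Q, 0 < Q.2 < Q0.2 -> V' Q = V Q &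
    cross (V Q0) (V' Q0) != 0].
Proof.
move=> gV hQ0; have [ab bc cd] := Ypin_rows S.
have [wd1 wd2 wd3 wd4] := width_bounds S; have [aP bP cP dP] := mem_pin S.
suff [w [x [fw w0 wrel wlow [xy wQ0]]]] : exists (w : R -> Z2 -> 'rV[R]_3) (x : 'rV[R]_3),
    [/\ forall Q, fr_vec (@polyfun R) (w ^~ Q), w 0 =1 V,
        forall t, window_rel S (w t), forall t Q, Q.2 < Q0.2 -> w t Q = V Q &
        cross (V Q0) x != 0 /\ forall t, w t Q0 = V Q0 + t *: x].
  have frp := polyfun_ring R.
  (* The conditions are t != 0, so that the point at Q0 really moves, and nondegeneracy at each r,
     which holds at t = 0. *)
  pose f i t := if i is j.+1 then
    if unpickle j is Some r then nd S (ext S (w t)) r else 1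
  else t.
  have [t ft] : exists t, forall i, f i t != 0.
    apply: polyfun_avoid => -[|j]; rewrite /f.
    + exact: polyfun_id.
    + case: (unpickle j) => [r|]; last exact: (fr_const frp).
      by apply: (fr_nd frp) => Q; apply: (fr_ext frp) => Q' _; exact: fw.
    + by exists 1; exact: oner_neq0.
    + case: (unpickle j) => [r|]; last by exists 0; exact: oner_neq0.
      exists 0; apply: nd_propto (good_nd gV r) => Q; apply/propto_sym.
      by apply: (ext_good_propto gV) => Q' _; rewrite w0; exact: propto_refl.
  exists (ext S (w t)); split.
  - by apply: ext_good => // r; have := ft (pickle r).+1; rewrite /f pickleK.
  - by move=> Q hQ; rewrite ext_window ?wlow //; lia.
  - rewrite ext_window // wQ0; have -> : cross (V Q0) (V Q0 + t *: x) = t *: cross (V Q0) x.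
      by rewrite /cross /vec3; apply: row3P; rewrite !mxE /=; ring.
    by rewrite scaler_eq0 negb_or xy andbT; exact: (ft 0%N).
have pinW x y : x \in pin S -> y \in pin S -> x != y ->
    cross (V Q0) (V (Q0 - x + y)) != 0.
  by move=> xP yP nxy; rewrite -{1}(subrK x Q0); exact: (good_cross gV).
have := pin_uniq S; rewrite /pin uniq4E => /and3P[/and3P[nab nac nad] /andP[nbc nbd] ncd].
case: wd3 => wdE.
(* If [width] is c.2 - a.2, no triple (a, b, c) fits in the window, so only the triples (b, c, d)
   have to be preserved. *)
- have [k [l [lb lc]]] := separating_functional.
  have [||//|//|||w [fw w0 wrel wlow wQ0]] := @perturb_triple V b c d Q0 k l.
  + exact: le_trans (ltW bc) cd.
  + exact: cd.
  + by move=> r; exact: (good_cross gV).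
  + by move=> r; exact: (good_det3 gV).
  exists w, (V (Q0 - d + b)); split=> // [t|].
    by split=> r; [rewrite !Z2E; clear - wdE ab bc cd; lia | move=> _ _; exact: wrel].
  by split=> //; apply: pinW; rewrite // eq_sym.
(* Otherwise only the triples (a, b, c) fit, and the row itself separates c from a and b. *)
- have [||||||w [fw w0 wrel wlow wQ0]] := @perturb_triple V a b c Q0 0 1.
  + exact: le_trans ab (ltW bc).
  + exact: ltW bc.
  + by rewrite !mul0r !mul1r !add0r; exact: le_lt_trans ab bc.
  + by rewrite !mul0r !mul1r !add0r.
  + by move=> r; exact: (good_cross gV).
  + by move=> r; exact: (good_det3 gV).
  exists w, (V (Q0 - c + a)); split=> // [t|].
    by split=> r; [move=> _ _; exact: wrel | rewrite !Z2E; clear - wdE ab bc cd; lia].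
  by split=> //; apply: pinW; rewrite // eq_sym.
Qed.

(** If k < [width], a reduction to order k would make row k + 1 a function of the rows before it. A
    good mesh with a point of row k + 1 moved and rows 1, ..., k unchanged contradicts this. *)
Lemma lower_bound (k : nat) : (exists V, good S V) -> reducible_to R S k ->
  (width <= k)%N.
Proof.
move=> exg [km [X' [phi [_ [U [cU dU UP]]]]]]; rewrite leqNgt; apply/negP => kw.
have wm := width_le_order2 S; have km' : (k < order2 S)%N := leq_trans kw wm.
pose m := order2 S; pose res (v : 'I_m -> int -> 'rV[R]_3) (j : 'I_k) := v (widen_ord km j).
pose F v := \row_l ceval (phi 0 l) (res v).
pose last_row : 'I_m := Ordinal km'.
have frc := @cfun_ring R m.
have cF : fr_vec (@cfun R m) F.
  move=> l; apply: (@fr_eq _ _ _ (fun v => ceval (phi 0 l) (res v))) => [|v].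
    by apply: (fr_ceval frc) => j i; exact: cfun_coord.
  by rewrite mxE.
have FU A v : X2_reg R S A -> (forall i, U i A) -> lifts v A ->
    propto (v last_row 0) (F v).
  move=> XA UA vA; have [P [PA _ /(_ 0%N km') fP]] := UP A XA UA.
  apply/(vline_eqP _ (vline_neq0 (vA last_row 0))); rewrite -vA -PA.
  have := fP 0 (res v); rewrite /rows !add0r /=; apply => j i.
  by rewrite /res -(vA (widen_ord km j) i) -PA /rows !add0r.
(* The vanishing of a polynomial cross product extends from the dense set on which [phi] gives row k
   + 1 to all of [X2_reg]. *)
have Fcross A v : X2_reg R S A -> lifts v A -> cross (v last_row 0) (F v) = 0.
  move=> XA vA; apply/rowP => l; rewrite [RHS]mxE.
  have [p pE] := fr_cross frc (@cfun_coord R m last_row 0) cF l.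
  rewrite -pE; apply: (dU A XA) vA => B [XB UB] u uB; rewrite pE.
  by rewrite (cross_proptoE (FU B u XB (fun i => UB i I) uB)) mxE.
have [A [v [XA YA vA Fv]]] : exists A v,
    [/\ X2_reg R S A, good_rows S A, lifts v A & F v != 0].
  have [A XA UA] : exists2 A, X2_reg R S A & forall i, U i A.
    (* If the dense set were empty, even the constant 1 would vanish on the rows of V0. *)
    apply: contrapT => nA; have [V0 gV0] := exg.
    have [p pE] := fr_const frc 1.
    have pV : vanishes p (rows m 0 (mesh_of V0)).
      apply: (dU _ (good_X2_reg gV0)) => B [XB UB].
      by case: nA; exists B => // i; exact: UB.
    have [v vV] := lifts_exist (rows m 0 (mesh_of V0)).
    by have := pV v vV; rewrite pE => /eqP; rewrite oner_eq0.
  have [v vA] := lifts_exist A.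
  have F0 : F v != 0.
    by rewrite -(propto_neq0 (FU A v XA UA vA)); exact: vline_neq0 (vA last_row 0).
  have [l Fl] : exists l, F v 0 l != 0.
    apply: contrapT => nl; case/eqP: F0; apply/rowP => l; rewrite [RHS]mxE.
    by apply/eqP/negPn/negP => Fl; apply: nl; exists l.
  have [p pE] := cF l.
  have /existsNP[B /not_implyP[[XB YB] /Nvanishes[u uB pu]]] :
      ~ forall B, (X2_reg R S `&` @good_rows R S m)%classic B -> vanishes p B.
    by move=> /(X2_reg_dense exg XA)/(_ v vA); rewrite pE => /eqP; exact/negP.
  exists B, u; split=> //; move: pu; rewrite pE.
  by apply: contraNneq => ->; rewrite mxE.
have [V gV VE] := good_lift YA vA.
have [|V' [gV' V'V VV']] := @good_perturb V (0, k.+1%:Z) gV; first by rewrite /=; lia.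
have V'lift : lifts (win V') (rows m 0 (mesh_of V')).
  by move=> j i; rewrite /rows add0r (val_mesh_of _ gV').
have FV' : F (win V') = F v.
  rewrite /F; suff -> : res (win V') = res v by [].
  apply/funext => j; apply/funext => i; rewrite /res -VE /win V'V //=.
  by have := ltn_ord j; lia.
(* The points of V and V' at (0, k + 1) are distinct, but both would be proportional to the nonzero
   vector [F v]. *)
have := Fcross _ _ (good_X2_reg gV') V'lift; rewrite FV'.
have := Fcross _ _ XA vA; rewrite -VE.
move=> /(cross_eq0_prop (good_neq0 gV _))[x Fx].
rewrite Fx -[win V' _ _]scale1r crossZ mul1r => /eqP; rewrite scaler_eq0.
have /negPf-> /= : x != 0.
  by apply: contraNneq Fv => x0; rewrite Fx x0 scale0r.
by rewrite cross_swap oppr_eq0; exact/negP.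
Qed.
End Perturbation.

(** * Existence of good meshes *)

Lemma uniq_map_inj (T1 T2 : eqType) (f : T1 -> T2) (s : seq T1) :
  uniq [seq f x | x <- s] -> {in s &, injective f}.
Proof.
elim: s => [|z s IHs] //= /andP[fz /IHs fs] x y; rewrite !inE.
move=> /predU1P[->|xs] /predU1P[->|ys] // e; last exact: fs.
  by rewrite e map_f in fz.
by rewrite -e map_f in fz.
Qed.

(** * Real cubic factors of a pencil of polynomials *)

Section RealFactors.
Variable R : realType.
Implicit Types (p q w : {poly R}).

(** Either there is a nonreal root x + iy, which gives the factor X^2 - 2xX + x^2 + y^2, or two real
    roots can be split off. *)
Lemma monic_quadratic_dvdp p : (2 < size p)%N ->
  exists w, [/\ w \is monic, size w = 3%N & w %| p].
Proof.
pose toC : {rmorphism R -> complex.complex R} := complex.real_complex R.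
have cplx_root q : (1 < size q)%N -> exists x y : R,
    root (map_poly toC q) (complex.Complex x y).
  move=> sq; have /closed_rootP[[x y] rxy] : size (map_poly toC q) != 1%N.
    by rewrite size_map_poly neq_ltn sq orbT.
  by exists x, y.
have real_root q x : root (map_poly toC q) (complex.Complex x 0) -> root q x.
  by rewrite (fmorph_root toC).
have quad q x y : y != 0 -> root (map_poly toC q) (complex.Complex x y) ->
    exists w, [/\ w \is monic, size w = 3%N & w %| q].
  move=> y0 rq.
  pose w : {poly R} := 'X^2 + ((- (2 * x)) *: 'X + (x ^+ 2 + y ^+ 2)%:P).
  have sr : (size ((- (2 * x)) *: 'X + (x ^+ 2 + y ^+ 2)%:P)%R < 3)%N.
    apply: leq_ltn_trans (size_polyD _ _) _; rewrite gtn_max.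
    rewrite (leq_ltn_trans (size_scale_leq _ _)) ?size_polyX //.
    by rewrite (leq_ltn_trans (size_polyC_leq1 _)).
  have sw : size w = 3%N by rewrite /w size_polyDl size_polyXn.
  have mw : w \is monic.
    by rewrite monicE /w lead_coefDl ?size_polyXn // lead_coefXn.
  (* The remainder has degree at most 1 and vanishes at x + iy with y != 0, so it is zero. *)
  exists w; split=> //; rewrite /dvdp; set r := q %% w.
  have rw : (size r <= 2)%N by rewrite -ltnS -sw ltn_modp monic_neq0.
  have rE : r = (r`_0)%:P + r`_1 *: 'X.
    apply/polyP => -[|[|k]]; rewrite !(coefD, coefC, coefZ, coefX) /=.
    - by rewrite mulr0 addr0.
    - by rewrite mulr1 add0r.
    - by rewrite mulr0 addr0 nth_default //; apply: leq_trans rw _.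
  have : (map_poly toC q).[complex.Complex x y] = 0 by apply/rootP.
  rewrite (divp_eq q w) -/r rmorphD rmorphM /= hornerD hornerM.
  have -> : (map_poly toC w).[complex.Complex x y] = 0.
    rewrite /w !rmorphD /= map_polyXn map_polyZ map_polyX !map_polyC /=.
    rewrite !hornerE expr2 /=; apply/eqP; rewrite complex.eq_complex /=; apply/andP.
    by split; apply/eqP => /=; ring.
  rewrite mulr0 add0r rE rmorphD /= map_polyC map_polyZ map_polyX /= !hornerE.
  move/eqP; rewrite complex.eq_complex /= => /andP[/eqP h0 /eqP h1].
  have r1 : r`_1 = 0 by apply: (mulIf y0); rewrite mul0r -[RHS]h1; ring.
  have r0 : r`_0 = 0 by rewrite -[RHS]h0 r1; ring.
  by rewrite r0 r1 scale0r addr0.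
move=> sp; have [|x [y rp]] := cplx_root p; first by apply: leq_trans sp.
have [y0|] := eqVneq y 0; last by move=> ?; exact: quad rp.
rewrite {y}y0 in rp; have := real_root _ _ rp; rewrite -dvdp_XsubCl => /dvdpP[q pE].
have q0 : q != 0 by apply: contraTneq sp => q0; rewrite pE q0 mul0r size_poly0.
have sq : (1 < size q)%N.
  by move: sp; rewrite pE size_Mmonic ?monicXsubC // size_XsubC addn2.
have [x' [y' rq]] := cplx_root q sq.
have [y0|y0] := eqVneq y' 0; last first.
  by have [w [mw sw wq]] := quad q x' y' y0 rq; exists w; rewrite pE dvdp_mulr.
rewrite {y'}y0 in rq; have := real_root _ _ rq; rewrite -dvdp_XsubCl => xq.
exists (('X - x'%:P) * ('X - x%:P)); split.
- by rewrite rpredM ?monicXsubC.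
- by rewrite size_Mmonic ?monicXsubC ?monic_neq0 ?monicXsubC // !size_XsubC.
- by rewrite pE dvdp_mul.
Qed.

Lemma monic_cubic_dvdp p x : (3 < size p)%N -> root p x ->
  exists w, [/\ w \is monic, size w = 4%N & w %| p].
Proof.
rewrite -dvdp_XsubCl => + /dvdpP[q pE]; rewrite {p}pE => sp.
have q0 : q != 0 by apply: contraTneq sp => ->; rewrite mul0r size_poly0.
have [|w [mw sw wq]] := @monic_quadratic_dvdp q.
  by move: sp; rewrite size_Mmonic ?monicXsubC // size_XsubC addn2.
exists (w * ('X - x%:P)); split; first by rewrite rpredM ?monicXsubC.
  by rewrite size_Mmonic ?monicXsubC ?monic_neq0 // sw size_XsubC.
by rewrite dvdp_mul.
Qed.

(** Numerator and denominator of the rational function prod (X - x_i)^(n_i). *)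
Definition pos_part (s : seq (int * R)) : {poly R} :=
  \prod_(e <- s) ('X - e.2%:P) ^+ `|(Num.max 0 e.1)%R|%N.
Definition neg_part (s : seq (int * R)) : {poly R} :=
  \prod_(e <- s) ('X - e.2%:P) ^+ `|(Num.max 0 (- e.1))%R|%N.

(* Every level set of the rational function prod (X - x_i)^(n_i) of degree at
   least 3 contains the roots of a real cubic if it contains a real point. *)
Lemma cubic_factor (s : seq (int * R)) : uniq [seq e.2 | e <- s] ->
  \sum_(e <- s) e.1 = 0 -> 3 <= \sum_(e <- s) Num.max 0 e.1 ->
  exists k w, [/\ k != 0, w \is monic, size w = 4%N,
    w %| pos_part s - k *: neg_part s & forall e, e \in s -> ~~ root w e.2].
Proof.
move=> us s0 s3.
have mono (h : int * R -> nat) : \prod_(e <- s) ('X - e.2%:P) ^+ h e \is monic.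
  by apply: monic_prod => e _; rewrite monic_exp ?monicXsubC.
have sizeE (h : int * R -> nat) :
    size (\prod_(e <- s) ('X - e.2%:P) ^+ h e) = (\sum_(e <- s) h e).+1.
  elim: s {us s0 s3 mono} => [|e s IHs]; first by rewrite !big_nil size_poly1.
  rewrite !big_cons size_monicM ?monic_exp ?monicXsubC //; last first.
    by rewrite -size_poly_eq0 IHs.
  by rewrite IHs size_exp_XsubC addSn addnS.
have root_part (h : int * R -> nat) x :
    root (\prod_(e <- s) ('X - e.2%:P) ^+ h e) x =
    has (fun e => (0 < h e)%N && (e.2 == x)) s.
  rewrite rootE horner_prod prodf_seq_eq0; apply: eq_has => e /=.
  by rewrite horner_exp hornerXsubC expf_eq0 subr_eq0 eq_sym.
set f := pos_part s; set g := neg_part s.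
have mf : f \is monic := mono _; have mg : g \is monic := mono _.
have sumZ (h : int * R -> nat) :
    (\sum_(e <- s) h e)%N%:Z = \sum_(e <- s) (h e)%:Z.
  exact: (big_morph Posz PoszD (erefl _)).
pose n := (\sum_(e <- s) `|(Num.max 0 e.1)%R|)%N.
have nE : n%:Z = \sum_(e <- s) Num.max 0 e.1.
  by rewrite /n sumZ; apply: eq_bigr => e _; lia.
have nE' : n = (\sum_(e <- s) `|(Num.max 0 (- e.1))%R|)%N.
  apply/eqP; rewrite -eqz_nat nE sumZ -subr_eq0 -sumrB; apply/eqP; rewrite -[RHS]s0.
  by apply: eq_bigr => e _; lia.
have n3 : (2 < n)%N by rewrite -ltz_nat nE; lia.
have szf : size f = n.+1 by exact: sizeE.
have szg : size g = n.+1 by rewrite nE'; exact: sizeE.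
have fg x : root f x -> ~~ root g x.
  rewrite !root_part => /hasP[e es /andP[e0 /eqP ex]].
  apply/negP => /hasP[e' es' /andP[e0' /eqP ex']].
  have ee' : e = e' by apply: (uniq_map_inj us) es es' _; rewrite ex.
  by move: e0 e0'; rewrite -ee'; lia.
have [x1 fx1] : exists x, root f x.
  have [e es e0] : exists2 e : int * R, e \in s & 0 < e.1.
    apply: contrapT => ns; suff n0 : n = 0%N by rewrite n0 in n3.
    apply: big1_seq => e /andP[_ es]; have [e0|e0] := lerP e.1 0; first by lia.
    by case: ns; exists e.
  exists e.2; rewrite root_part; apply/hasP; exists e => //.
  by rewrite /= eqxx andbT; lia.
(* The polynomial f is nonzero and vanishes at x1, where g does not, so f and g are independent. *)
have lin (l m : R) : (l != 0) || (m != 0) -> l *: f + m *: g != 0.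
  move=> lm; apply: contraTneq lm => lm0.
  have := congr1 (horner^~ x1) lm0; rewrite /= !hornerE (rootP fx1) mulr0 add0r.
  move=> /eqP; rewrite mulf_eq0 -[g.[x1] == 0]/(root g x1) (negPf (fg _ fx1)) orbF.
  move=> m0; rewrite (eqP m0) scale0r addr0 in lm0 *; rewrite eqxx orbF negbK.
  by move/eqP: lm0; rewrite scaler_eq0 -[f == 0]size_poly_eq0 szf orbF.
(* A point outside the roots of [bad] gives a level k that is nonzero, differs from 1, so that f - k
   g keeps the degree of f, and is not attained by f / g at any of the x_i. *)
pose bad := f * g * (f - g) * \prod_(e <- s) (f.[e.2] *: g - g.[e.2] *: f).
have bad0 : bad != 0.
  have fg0 : f - g != 0.
    by have := lin 1 (-1); rewrite scale1r scaleN1r oner_eq0; apply.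
  apply: mulf_neq0.
    by apply: mulf_neq0 => //; apply: mulf_neq0; exact: monic_neq0.
  rewrite prodf_seq_neq0; apply/allP => e es /=; rewrite addrC -scaleNr lin //.
  rewrite oppr_eq0 -negb_and; apply/negP => /andP[ge fe].
  by have := fg e.2 fe; rewrite rootE ge.
have [x0] : exists x, ~~ root bad x.
  exists (polyrcf.cauchy_bound bad); apply: (polyrcf.ge_cauchy_bound bad0).
  by rewrite in_itv /= lexx.
rewrite /root !hornerM !mulf_eq0 !negb_or => /andP[/andP[/andP[f0 g0] fg0] sx0].
pose k := f.[x0] / g.[x0]; exists k.
have k0 : k != 0 by rewrite mulf_neq0 ?invr_eq0.
pose p := f - k *: g.
have rp : root p x0 by rewrite rootE !hornerE /k divfK // subrr.
have sp : (3 < size p)%N.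
  have pn : p`_n != 0.
    rewrite coefB coefZ; move: mf mg; rewrite !monicE /lead_coef szf szg /=.
    move=> /eqP-> /eqP->; rewrite mulr1 subr_eq0 eq_sym.
    apply: contraNneq fg0 => k1; rewrite !hornerE subr_eq0.
    by rewrite -[f.[x0]](divfK g0) -/k k1 mul1r.
  apply: leq_ltn_trans n3 _; rewrite ltnNge; apply: contraNN pn => /leq_sizeP h.
  by rewrite h.
have [w [mw sw wp]] := monic_cubic_dvdp sp rp.
exists w; split=> // e es; apply/negP => /(root_dvdp wp).
rewrite rootE !hornerE => /eqP fe.
move: sx0; rewrite horner_prod prodf_seq_neq0 => /allP/(_ e es) /=.
rewrite !hornerE subr_eq0 => /eqP; apply.
have -> : f.[e.2] = k * g.[e.2] by apply/eqP; rewrite -subr_eq0 fe.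
by rewrite /k; field.
Qed.
End RealFactors.

(** * Characters of Z^2 with prescribed values on the differences of points of S *)

Section Monomials.
Variables (K : comUnitRingType) (w1 w2 w3 : K).
Hypotheses (u1 : w1 \is a GRing.unit) (u2 : w2 \is a GRing.unit)
  (u3 : w3 \is a GRing.unit).

(** A character of Z^3, whose generators stand for b - a, c - a and d - a before their relation is
    imposed. *)
Definition monom (x : int * int * int) : K := w1 ^ x.1.1 * w2 ^ x.1.2 * w3 ^ x.2.

Lemma monomD x y : monom (x + y) = monom x * monom y.
Proof.
by case: x y => [[x1 x2] x3] [[y1 y2] y3]; rewrite /monom /= !exprzDr //; ring.
Qed.

Lemma monom0 : monom 0 = 1. Proof. by rewrite /monom !expr0z !mulr1. Qed.

Lemma monom_unit x : monom x \is a GRing.unit.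
Proof. by rewrite /monom !unitrM ?unitrXz. Qed.

Lemma monom_eq1 x (n : int) : monom x = 1 -> monom (x *~ n) = 1.
Proof.
move=> x1; have nat1 (k : nat) : monom (x *+ k) = 1.
  by elim: k => [|k IHk]; rewrite ?mulr0n ?monom0 // mulrSr monomD IHk mul1r.
case: n => k; first exact: nat1.
by have := monomD (x *+ k.+1) (- (x *+ k.+1)); rewrite subrr monom0 nat1 mul1r => <-.
Qed.
End Monomials.

Section Circuit.
Variable S : Ypin.
Local Notation a := (pa S).
Local Notation b := (pb S).
Local Notation c := (pc S).
Local Notation d := (pd S).

Definition det2 (x y : Z2) : int := x.1 * y.2 - x.2 * y.1.

(* The coefficients of the affine relation between the points of S; up to sign,
   each is twice the area of the triangle formed by the three other points. *)
Definition coef_b := det2 (c - a) (d - a).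
Definition coef_c := det2 (d - a) (b - a).
Definition coef_d := det2 (b - a) (c - a).
Definition coef_a := - (coef_b + coef_c + coef_d).

(** The degree of the polynomial from which the cubic is factored; it is twice the area of the hull
    of S. *)
Definition degree : int :=
  Num.max 0 coef_a + Num.max 0 coef_b + Num.max 0 coef_c + Num.max 0 coef_d.

Definition comb (x : int * int * int) : Z2 :=
  (b - a) *~ x.1.1 + (c - a) *~ x.1.2 + (d - a) *~ x.2.

Lemma triple_mulrz (u v w n : int) :
  ((u, v, w) : int * int * int) *~ n = (u * n, v * n, w * n).
Proof.
rewrite [LHS]surjective_pairing [(_ *~ _).1]surjective_pairing.
by rewrite (raddfMz (@fst (int * int) int)) (raddfMz (@snd (int * int) int))
  (raddfMz (@fst int int)) (raddfMz (@snd int int)) !mulrzz.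
Qed.

Lemma combE x : comb x =
  ((b - a).1 * x.1.1 + (c - a).1 * x.1.2 + (d - a).1 * x.2,
   (b - a).2 * x.1.1 + (c - a).2 * x.1.2 + (d - a).2 * x.2).
Proof.
have mulzE (z : Z2) (n : int) : z *~ n = (z.1 * n, z.2 * n).
  have fstM : (z *~ n).1 = z.1 *~ n by exact: (raddfMz (@fst int int)).
  have sndM : (z *~ n).2 = z.2 *~ n by exact: (raddfMz (@snd int int)).
  by rewrite [LHS]surjective_pairing fstM sndM !mulrzz.
by rewrite /comb !mulzE.
Qed.

Lemma comb_surj z : exists x, z = comb x.
Proof.
suff [x [y [t e]]] : exists x y t, z = (b - a) *~ x + (c - a) *~ y + (d - a) *~ t.
  by exists (x, y, t).
by case: S.
Qed.

(** Write (1, 0) and (0, 1) as integer combinations of b - a, c - a, d - a. By Cauchy-Binet their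
    determinant 1 is an integer combination of the three minors. *)
Lemma coef_bezout : exists k1 k2 k3 : int,
  k1 * coef_b + k2 * coef_c + k3 * coef_d = 1.
Proof.
have [[[x1 x2] x3]] := comb_surj (1, 0); have [[[y1 y2] y3]] := comb_surj (0, 1).
rewrite !combE /= => -[y_1 y_2] [x_1 x_2].
exists (x2 * y3 - x3 * y2), (x3 * y1 - x1 * y3), (x1 * y2 - x2 * y1).
rewrite -[RHS](_ : (1 : int) * 1 - 0 * 0 = 1) //.
rewrite {1}x_1 {1}y_2 {1}x_2 {1}y_1 /coef_b /coef_c /coef_d /det2; ring.
Qed.

(** The equations make x parallel to the vector of coefficients. These are coprime, so pairing x
    with the Bezout coefficients gives the integer factor. *)
Lemma comb_kernel x : comb x = 0 ->
  exists n : int, x = (coef_b, coef_c, coef_d) *~ n.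
Proof.
have [k1 [k2 [k3 k1E]]] := coef_bezout; case: x => [[x1 x2] x3].
rewrite combE /= => -[h1 h2].
exists (k1 * x1 + k2 * x2 + k3 * x3); rewrite triple_mulrz.
move: h1 h2 k1E; rewrite /coef_b /coef_c /coef_d /det2 /=.
move: (b.1 - a.1) (b.2 - a.2) (c.1 - a.1) (c.2 - a.2) (d.1 - a.1) (d.2 - a.2).
move=> B1 B2 C1 C2 D1 D2 h1 h2 k1E.
have e12 : x1 * (D1 * B2 - D2 * B1) = x2 * (C1 * D2 - C2 * D1).
  apply/eqP; rewrite -subr_eq0.
  have -> : x1 * (D1 * B2 - D2 * B1) - x2 * (C1 * D2 - C2 * D1) =
    D1 * (B2 * x1 + C2 * x2 + D2 * x3) - D2 * (B1 * x1 + C1 * x2 + D1 * x3) by ring.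
  by rewrite h1 h2 !mulr0 subrr.
have e13 : x1 * (B1 * C2 - B2 * C1) = x3 * (C1 * D2 - C2 * D1).
  apply/eqP; rewrite -subr_eq0.
  have -> : x1 * (B1 * C2 - B2 * C1) - x3 * (C1 * D2 - C2 * D1) =
    C2 * (B1 * x1 + C1 * x2 + D1 * x3) - C1 * (B2 * x1 + C2 * x2 + D2 * x3) by ring.
  by rewrite h1 h2 !mulr0 subrr.
have e23 : x2 * (B1 * C2 - B2 * C1) = x3 * (D1 * B2 - D2 * B1).
  apply/eqP; rewrite -subr_eq0.
  have -> : x2 * (B1 * C2 - B2 * C1) - x3 * (D1 * B2 - D2 * B1) =
    B1 * (B2 * x1 + C2 * x2 + D2 * x3) - B2 * (B1 * x1 + C1 * x2 + D1 * x3) by ring.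
  by rewrite h1 h2 !mulr0 subrr.
move: e12 e13 e23 k1E {h1 h2}; move: (C1 * D2 - _) (D1 * B2 - _) (B1 * C2 - _).
move=> kb kc kd e12 e13 e23 k1E.
have split3 x : x = k1 * (x * kb) + k2 * (x * kc) + k3 * (x * kd).
  by rewrite -[LHS]mulr1 -k1E; ring.
congr (_, _, _); rewrite [LHS]split3 ?e12 ?e13; try by ring.
  by rewrite -e12 e23; ring.
by rewrite -e13 -e23; ring.
Qed.

Lemma combD x y : comb (x + y) = comb x + comb y.
Proof.
case: x y => [[x1 x2] x3] [[y1 y2] y3]; rewrite !combE /=.
by congr pair => /=; ring.
Qed.

Lemma combB x y : comb (x - y) = comb x - comb y.
Proof. by apply: (addIr (comb y)); rewrite -combD !subrK. Qed.

Lemma combMz x (n : int) : comb (x *~ n) = comb x *~ n.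
Proof.
case: x => [[x1 x2] x3]; rewrite triple_mulrz !combE /=.
have -> (z1 z2 : int) : (z1, z2) *~ n = (z1 * n, z2 * n) :> Z2.
  by rewrite [LHS]surjective_pairing (raddfMz (@fst int int))
    (raddfMz (@snd int int)) !mulrzz.
by congr pair; ring.
Qed.

(* A multiplicative function on Z^2 is determined by its values on the
   differences of the points of S, which are subject to one relation only. *)
Lemma character_exists (K : comUnitRingType) (w1 w2 w3 : K) :
  w1 \is a GRing.unit -> w2 \is a GRing.unit -> w3 \is a GRing.unit ->
  monom w1 w2 w3 (coef_b, coef_c, coef_d) = 1 ->
  exists chi : Z2 -> K, [/\ forall z, chi z \is a GRing.unit,
    forall z, chi (z + (b - a)) = chi z * w1,
    forall z, chi (z + (c - a)) = chi z * w2 &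
    forall z, chi (z + (d - a)) = chi z * w3].
Proof.
move=> u1 u2 u3 rel.
have [x ex] := comb_surj (1, 0); have [y ey] := comb_surj (0, 1).
(* An additive section of [comb], built from preimages of the unit vectors. *)
pose pre (z : Z2) := x *~ z.1 + y *~ z.2.
have preE z : comb (pre z) = z.
  rewrite /pre combD !combMz -ex -ey [RHS]surjective_pairing.
  have mulzE (z1 z2 n : int) : (z1, z2) *~ n = (z1 * n, z2 * n) :> Z2.
    by rewrite [LHS]surjective_pairing (raddfMz (@fst int int))
      (raddfMz (@snd int int)) !mulrzz.
  by rewrite !mulzE; congr pair => /=; ring.
exists (fun z => monom w1 w2 w3 (pre z)).
have preD z t u : comb u = t ->
    monom w1 w2 w3 (pre (z + t)) = monom w1 w2 w3 (pre z) * monom w1 w2 w3 u.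
  move=> ut; rewrite -monomD //.
  (* Two preimages differ by a multiple of the relation, on which [monom] is 1. *)
  have [n en] : exists n : int, pre (z + t) - (pre z + u) = (coef_b, coef_c, coef_d) *~ n.
    by apply: comb_kernel; rewrite combB (combD (pre z)) !preE ut subrr.
  rewrite -[pre (z + t)](subrK (pre z + u)) en (monomD u1 u2 u3 (_ *~ n)).
  by rewrite (monom_eq1 u1 u2 u3 n rel) mul1r.
split=> z; first exact: monom_unit.
- rewrite (preD _ _ (1, 0, 0)); last by rewrite /comb /= mulr1z !mulr0z !addr0.
  by rewrite /monom /= expr1z !expr0z !mulr1.
- rewrite (preD _ _ (0, 1, 0)).
    by rewrite /monom /= expr1z !expr0z mulr1 mul1r.
  by rewrite /comb /= mulr1z !mulr0z add0r addr0.
- rewrite (preD _ _ (0, 0, 1)); last by rewrite /comb /= mulr1z !mulr0z !add0r.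
  by rewrite /monom /= expr1z !expr0z !mul1r.
Qed.
End Circuit.

(** * The algebra R[X]/w for a monic cubic w, represented by matrices *)

Section CubicAlgebra.
Variables (R : realType) (w : {poly R}).
Hypotheses (mw : w \is monic) (sw : size w = 4%N).

Lemma mk_monic_cubic : mk_monic w = w.
Proof. by rewrite /mk_monic sw mw. Qed.

Lemma in_qpoly_dvdp p : w %| p -> in_qpoly w p = 0.
Proof.
move=> /dvdpP[q ->]; rewrite rmorphM /=.
suff -> : in_qpoly w w = 0 by rewrite mulr0.
by apply: val_inj; rewrite /= mk_monic_cubic Pdiv.RingMonic.rmodpp.
Qed.

(** Since X - x divides w - w(x), modulo w it divides a nonzero constant. *)
Lemma in_qpoly_XsubC_unit x : ~~ root w x ->
  in_qpoly w ('X - x%:P) \is a GRing.unit.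
Proof.
move=> wx; have : w %| w - (w.[x])%:P + (w.[x])%:P by rewrite subrK.
have /factor_theorem[q ->] : root (w - (w.[x])%:P) x by rewrite rootE !hornerE subrr.
move/in_qpoly_dvdp; rewrite rmorphD rmorphM /= => /eqP; rewrite addr_eq0 => /eqP e.
have wx0 : in_qpoly w (w.[x])%:P \is a GRing.unit.
  rewrite -[(w.[x])%:P]mulr1 mul_polyC linearZ /= rmorph1.
  by rewrite scaler_unit ?unitr1 // unitfE.
by move: wx0; rewrite -unitrN -e unitrM => /andP[].
Qed.

(** Multiplication by X in the basis 1, X, X^2, acting on row vectors. *)
Definition companion3 : 'M[R]_3 :=
  \matrix_(i < 3) nth 0 [:: vec3 0 1 0; vec3 0 0 1; vec3 (- w`_0) (- w`_1) (- w`_2)] i.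

Lemma mul_companion3 (u : 'rV[R]_3) : u *m companion3 =
  vec3 (- w`_0 * u 0 2) (u 0 0 - w`_1 * u 0 2) (u 0 1 - w`_2 * u 0 2).
Proof.
have e0 : (lift ord0 ord0 : 'I_3) = 1 by apply: val_inj.
have e1 : (lift ord0 (lift ord0 ord0) : 'I_3) = 2 by apply: val_inj.
by apply: row3P; rewrite !mxE !big_ord_recl big_ord0 !mxE /= ?e0 ?e1; ring.
Qed.

(** The matrix w(C) kills the first basis vector by computation. It commutes with C, so it also
    kills the images of this vector under C, which are the other two. *)
Lemma companion3_root : horner_mx companion3 w = 0.
Proof.
have wE : w = 'X^3 + w`_2 *: 'X^2 + w`_1 *: 'X + (w`_0)%:P.
  apply/polyP => -[|[|[|[|k]]]];
    rewrite !(coefD, coefZ, coefXn, coefX, coefC) /= ?mulr0 ?mulr1 ?addr0 ?add0r //.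
    by have := monicP mw; rewrite /lead_coef sw.
  by rewrite nth_default // sw.
have e0w : vec3 1 0 0 *m horner_mx companion3 w = 0.
  rewrite wE !rmorphD /= !linearZ /= !rmorphXn /= horner_mx_X horner_mx_C.
  rewrite !exprS expr0 mulr1 !mulmxDr -!scalemxAr -!mulmxE !mulmxA mul_mx_scalar.
  by rewrite !mul_companion3 /vec3; apply: row3P; rewrite !mxE /=; ring.
have comm : horner_mx companion3 w *m companion3 = companion3 *m horner_mx companion3 w.
  by apply: comm_horner_mx.
have e1w : vec3 0 1 0 *m horner_mx companion3 w = 0.
  have -> : vec3 0 1 0 = vec3 1 0 0 *m companion3.
    by rewrite mul_companion3; apply: row3P; rewrite !mxE /=; ring.
  by rewrite -mulmxA -comm mulmxA e0w mul0mx.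
have e2w : vec3 0 0 1 *m horner_mx companion3 w = 0.
  have -> : vec3 0 0 1 = vec3 0 1 0 *m companion3.
    by rewrite mul_companion3; apply: row3P; rewrite !mxE /=; ring.
  by rewrite -mulmxA -comm mulmxA e1w mul0mx.
have all0 (u : 'rV_3) : u *m horner_mx companion3 w = 0.
  have -> : u = u 0 0 *: vec3 1 0 0 + u 0 1 *: vec3 0 1 0 + u 0 2 *: vec3 0 0 1.
    by apply: row3P; rewrite !mxE /=; ring.
  by rewrite !mulmxDl -!scalemxAl e0w e1w e2w !scaler0 !addr0.
by apply/row_matrixP => i; rewrite rowE all0 row0.
Qed.

(** Multiplication by x; applied to [vec3 1 0 0] it gives the coordinate vector of x. *)
Definition reg_mx (x : {poly %/ w}) : 'M[R]_3 := horner_mx companion3 (val x : {poly R}).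

Lemma reg_mx_in p : reg_mx (in_qpoly w p) = horner_mx companion3 p.
Proof.
rewrite /reg_mx /= mk_monic_cubic.
rewrite {2}(Pdiv.RingMonic.rdivp_eq mw p) rmorphD rmorphM /=.
by rewrite companion3_root mulr0 add0r.
Qed.

Lemma reg_mxM x y : reg_mx (x * y) = reg_mx x *m reg_mx y.
Proof.
by rewrite [x * y](_ : _ = in_qpoly w (val x * val y)) // reg_mx_in rmorphM.
Qed.

Lemma reg_mx1 : reg_mx 1 = 1%:M.
Proof. by rewrite -(rmorph1 (in_qpoly w)) reg_mx_in rmorph1. Qed.

Lemma reg_mx_unit x : x \is a GRing.unit -> reg_mx x \in unitmx.
Proof.
move=> ux; have := mulmx1_unit (_ : reg_mx x *m reg_mx x^-1 = 1%:M).
by rewrite -reg_mxM mulrV // reg_mx1 => /(_ erefl)[].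
Qed.

Lemma reg_mxZ k x : reg_mx (k *: x) = k *: reg_mx x.
Proof. by rewrite /reg_mx -linearZ. Qed.

Lemma e0_linear s : vec3 1 0 0 *m reg_mx (in_qpoly w ('X - s%:P)) = vec3 (- s) 1 0.
Proof.
rewrite reg_mx_in rmorphB /= horner_mx_X horner_mx_C mulmxBr mul_companion3.
by rewrite mul_mx_scalar /vec3; apply: row3P; rewrite !mxE /=; ring.
Qed.

Lemma e0_quadratic s t :
  vec3 1 0 0 *m reg_mx (in_qpoly w ('X - s%:P) * in_qpoly w ('X - t%:P)) =
  vec3 (s * t) (- (s + t)) 1.
Proof.
rewrite reg_mxM mulmxA e0_linear reg_mx_in rmorphB /= horner_mx_X horner_mx_C.
rewrite mulmxBr mul_companion3.
by rewrite mul_mx_scalar /vec3; apply: row3P; rewrite !mxE /=; ring.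
Qed.
End CubicAlgebra.

Section GoodFromConic.
Variables (R : realType) (S : Ypin) (V : Z2 -> 'rV[R]_3) (sg : Z2 -> R).
Hypothesis sg_inj : {in pin S &, injective sg}.
Hypothesis V1 : forall r, exists2 Y : 'M[R]_3, Y \in unitmx &
  forall x, x \in pin S -> propto (V (r + x)) (vec3 (- sg x) 1 0 *m Y).
Hypothesis V2 : forall r, exists2 Y : 'M[R]_3, Y \in unitmx &
  forall x y, x \in pin S -> y \in pin S ->
    propto (V (r + x + y)) (vec3 (sg x * sg y) (- (sg x + sg y)) 1 *m Y).

(* In suitable coordinates, the points r + x lie on a line, and each line of
   points r + z + x is tangent to one fixed conic at r + z + z. *)
Lemma good_from_conic : good S V.
Proof.
have [aP bP cP dP] := mem_pin S.
have := pin_uniq S; rewrite /pin /= !inE !negb_or.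
move=> /and4P[/and3P[nab nac nad] /andP[nbc nbd] ncd _].
have sgN x y : x \in pin S -> y \in pin S -> x != y -> sg x - sg y != 0.
  by move=> xP yP; apply: contraNneq => /subr0_eq/(sg_inj xP yP)/eqP.
have det0 r x y z : x \in pin S -> y \in pin S -> z \in pin S ->
    det3 (V (r + x)) (V (r + y)) (V (r + z)) = 0.
  have [Y uY VY] := V1 r; move=> /VY Vx /VY Vy /VY Vz.
  apply/eqP; rewrite (det3_propto Vx Vy Vz) det3_mulmx mulf_eq0; apply/orP; right.
  by apply/eqP; rewrite /det3 /vec3 !mxE /=; ring.
have cross0 r x y : x \in pin S -> y \in pin S -> x != y ->
    cross (V (r + x)) (V (r + y)) != 0.
  have [Y uY VY] := V1 r; move=> xP yP nxy.
  rewrite (propto_neq0 (cross_propto (VY x xP) (VY y yP))) cross_mulmx //.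
  apply: contraNneq (sgN _ _ xP yP nxy) => /rowP/(_ 2).
  by rewrite /cross /vec3 !mxE /= => h; apply/eqP/oppr_inj; rewrite oppr0 -[RHS]h; ring.
have meet0 r x y x' y' z z' : x \in pin S -> y \in pin S -> x' \in pin S ->
    y' \in pin S -> z \in pin S -> z' \in pin S ->
    z != z' -> x != y -> x' != y' -> z != x' ->
    meet (V (r + z + x)) (V (r + z + y)) (V (r + z' + x')) (V (r + z' + y')) != 0.
  have [Y uY VY] := V2 r; move=> xP yP x'P y'P zP z'P nzz nxy nxy' nzx.
  rewrite (propto_neq0 (meet_propto (VY _ _ zP xP) (VY _ _ zP yP)
    (VY _ _ z'P x'P) (VY _ _ z'P y'P))) meet_mulmx scaler_eq0 negb_or.
  rewrite -unitfE -unitmxE uY /=.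
  set m := meet _ _ _ _; suff m0 : m != 0.
    by apply: contraNneq m0 => mY; rewrite -(mulmxK uY m) mY mul0mx.
  apply: meet_neq0.
    apply: contraNneq (sgN _ _ x'P y'P nxy') => /rowP/(_ 0).
    by rewrite /cross /vec3 !mxE /= => h; apply/eqP/oppr_inj; rewrite oppr0 -[RHS]h; ring.
  (* Read the vectors as quadratics: the first two span the multiples of X - sg z, while the roots
     sg z' and sg x' of the third differ from sg z. *)
  have := mulf_neq0 (mulf_neq0 (sgN _ _ xP yP nxy) (sgN _ _ zP z'P nzz)) (sgN _ _ zP x'P nzx).
  by apply: contraNneq => h; apply/eqP/oppr_inj; rewrite oppr0 -[RHS]h /det3 /vec3 !mxE /=; ring.
have [e1P e2P e12] := e_pin S; have [f1P f2P f12] := f_pin S.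
have de1 : pd S != e1 S.
  by rewrite /e1; case: ifP => _; rewrite eq_sym.
have af1 : pa S != f1 S by rewrite /f1; case: ifP.
split=> r; [exact: det0|exact: det0|apply/ndP; split].
- by split; exact: cross0.
- by split; exact: cross0.
- have rd : r - pc S = r - pd S - pc S + pd S by rewrite addrAC subrK.
  have rc : r - pd S = r - pd S - pc S + pc S by rewrite subrK.
  have := meet0 (r - pd S - pc S) _ _ _ _ _ _ aP bP e1P e2P dP cP.
  by rewrite -rd -rc eq_sym; exact.
- have ra : r - pb S = r - pa S - pb S + pa S by rewrite addrAC subrK.
  have rb : r - pa S = r - pa S - pb S + pb S by rewrite subrK.
  have := meet0 (r - pa S - pb S) _ _ _ _ _ _ cP dP f1P f2P aP bP.
  by rewrite -ra -rb; exact.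
Qed.
End GoodFromConic.

(** * Construction of a good mesh from a cubic algebra *)

Section Existence.
Variables (R : realType) (S : Ypin).
Local Notation a := (pa S).
Local Notation b := (pb S).
Local Notation c := (pc S).
Local Notation d := (pd S).

Lemma exprz_parts (K : comUnitRingType) (u : K) (n : int) : u \is a GRing.unit ->
  u ^ n * u ^+ `|(Num.max 0 (- n))%R|%N = u ^+ `|(Num.max 0 n)%R|%N.
Proof. by move=> uu; rewrite !exprnP -exprzDr //; congr (_ ^ _); lia. Qed.

Lemma exprMz_com (K : comUnitRingType) (x y : K) (n : int) :
  x \is a GRing.unit -> y \is a GRing.unit -> (x * y) ^ n = x ^ n * y ^ n.
Proof. by move=> ux uy; apply: exprMz_comm => //; exact: mulrC. Qed.

(** The powers of q given by the Bezout coefficients contribute a factor q^-1 to the monomial, which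
    turns the relation with value q into one with value 1. *)
Lemma monom_rescaled (K : comUnitRingType) (q l0 l1 l2 l3 : K)
    (k1 k2 k3 n1 n2 n3 : int) :
  q \is a GRing.unit -> l0 \is a GRing.unit -> l1 \is a GRing.unit ->
  l2 \is a GRing.unit -> l3 \is a GRing.unit ->
  k1 * n1 + k2 * n2 + k3 * n3 = 1 ->
  l0 ^ (- (n1 + n2 + n3)) * l1 ^ n1 * l2 ^ n2 * l3 ^ n3 = q ->
  monom (q ^ (- k1) * l1 * l0^-1) (q ^ (- k2) * l2 * l0^-1)
    (q ^ (- k3) * l3 * l0^-1) (n1, n2, n3) = 1.
Proof.
move=> uq u0 u1 u2 u3 kE rel; rewrite /monom /=.
rewrite !exprMz_com ?unitrM ?unitrV ?unitrXz ?u0 ?u1 ?u2 ?u3 // !exprz_exp !exprz_inv.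
transitivity (q ^ (- k1 * n1 + - k2 * n2 + - k3 * n3) *
  (l0 ^ (- n1 + - n2 + - n3) * l1 ^ n1 * l2 ^ n2 * l3 ^ n3)).
  rewrite !exprzDr //; ring.
have -> : - n1 + - n2 + - n3 = - (n1 + n2 + n3) by ring.
have -> : - k1 * n1 + - k2 * n2 + - k3 * n3 = -1 by rewrite -kE; ring.
by rewrite rel exprN1 mulVr.
Qed.

(** The pairwise distinct roots s_x attached to the points of S. *)
Definition slope (z : Z2) : R :=
  if z == a then 0 else if z == b then 1 else if z == c then 2 else 3.

Lemma slopeE : [/\ slope a = 0, slope b = 1, slope c = 2 & slope d = 3].
Proof.
have := pin_uniq S; rewrite /pin /= !inE !negb_or.
move=> /and4P[/and3P[nab nac nad] /andP[nbc nbd] ncd _].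
by rewrite /slope !eqxx (eq_sym b a) (eq_sym c a) (eq_sym c b) (eq_sym d a)
  (eq_sym d b) (eq_sym d c) (negPf nab) (negPf nac) (negPf nad) (negPf nbc) (negPf nbd) (negPf ncd).
Qed.

Lemma slope_inj : {in pin S &, injective slope}.
Proof.
have [sa sb sc sd] := slopeE => x y; rewrite !inE.
by move=> /or4P[] /eqP-> /or4P[] /eqP->; rewrite ?sa ?sb ?sc ?sd => e //;
  exfalso; clear -e; lra.
Qed.

Lemma exists_good : 3 <= degree S -> exists V : Z2 -> 'rV[R]_3, good S V.
Proof.
move=> deg3; have [sa sb sc sd] := slopeE.
pose s : seq (int * R) :=
  [:: (coef_a S, 0); (coef_b S, 1); (coef_c S, 2); (coef_d S, 3)].
have [||| k [w [k0 mw sw fgw wroot]]] := @cubic_factor R s.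
- rewrite /= !inE !negb_or andbT; do ![apply/andP; split]; apply/eqP; lra.
- by rewrite !big_cons big_nil /= /coef_a; ring.
- by move: deg3; rewrite !big_cons big_nil /= /degree; lia.
pose l (x : R) := in_qpoly w ('X - x%:P).
have lu i : (i < 4)%N -> l (i%:R) \is a GRing.unit.
  move=> i4; apply: in_qpoly_XsubC_unit => //.
  case: i i4 => [|[|[|[|]]]] // _; [apply: (wroot (coef_a S, 0))
  | apply: (wroot (coef_b S, 1)) | apply: (wroot (coef_c S, 2))
  | apply: (wroot (coef_d S, 3))]; by rewrite !inE eqxx ?orbT.
have l0 : l 0 \is a GRing.unit := lu 0%N isT.
have l1 : l 1 \is a GRing.unit := lu 1%N isT.
have l2 : l 2 \is a GRing.unit := lu 2%N isT.
have l3 : l 3 \is a GRing.unit := lu 3%N isT.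
pose q : {poly %/ w} := k%:A.
have qX (n : int) : q ^ n = (k ^ n)%:A.
  by rewrite /q -[_%:A]/(in_alg _ k) -rmorphXz // unitfE.
have qu : q \is a GRing.unit by rewrite /q scaler_unit ?unitr1 // unitfE.
(* As w divides the difference, the two products agree modulo w up to the factor k; the second one
   is the unit N. *)
have rel : l 0 ^ coef_a S * l 1 ^ coef_b S * l 2 ^ coef_c S * l 3 ^ coef_d S = q.
  pose N : {poly %/ w} := l 0 ^+ `|(Num.max 0 (- coef_a S))%R|%N
    * l 1 ^+ `|(Num.max 0 (- coef_b S))%R|%N * l 2 ^+ `|(Num.max 0 (- coef_c S))%R|%N
    * l 3 ^+ `|(Num.max 0 (- coef_d S))%R|%N.
  have Nu : N \is a GRing.unit by rewrite /N !unitrM !unitrX.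
  apply: (mulIr Nu).
  have : in_qpoly w (pos_part s - k *: neg_part s) = 0 by exact: in_qpoly_dvdp.
  rewrite rmorphB /= in_qpolyZ => /eqP; rewrite subr_eq0 => /eqP.
  rewrite /pos_part /neg_part !big_cons !big_nil /= !mulr1 !rmorphM /= !rmorphXn /=.
  rewrite -/(l 0) -/(l 1) -/(l 2) -/(l 3).
  rewrite -(exprz_parts (coef_a S) l0) -(exprz_parts (coef_b S) l1).
  rewrite -(exprz_parts (coef_c S) l2) -(exprz_parts (coef_d S) l3) => e.
  rewrite /q mulr_algl /N; move: e.
  move: (l 0 ^ _) (l 1 ^ _) (l 2 ^ _) (l 3 ^ _) (l 0 ^+ _) (l 1 ^+ _) (l 2 ^+ _) (l 3 ^+ _).
  by move=> x0 x1 x2 x3 y0 y1 y2 y3; rewrite -!(mulrA y0) -(mulrA y1) => <-; ring.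
have [k1 [k2 [k3 kE]]] := coef_bezout S.
pose W (n : int) x := q ^ (- n) * l x * (l 0)^-1.
have Wu n x : l x \is a GRing.unit -> W n x \is a GRing.unit.
  by move=> ux; rewrite /W !unitrM unitrV unitrXz // ux l0.
have Wrel : monom (W k1 1) (W k2 2) (W k3 3) (coef_b S, coef_c S, coef_d S) = 1.
  exact: monom_rescaled kE rel.
have [chi [chiu chib chic chid]] :=
  character_exists (Wu k1 1 l1) (Wu k2 2 l2) (Wu k3 3 l3) Wrel.
(* Up to a nonzero real factor, the step from a to x multiplies chi by (X - s_x) / X. *)
have chiE x : x \in pin S -> exists2 t : R, t != 0 & forall z,
    chi (z + (x - a)) = t *: (l (slope x) * (chi z * (l 0)^-1)).
  rewrite !inE => /or4P[] /eqP->.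
  - exists 1; rewrite ?oner_neq0 // => z; rewrite subrr addr0 sa scale1r.
    by rewrite mulrCA mulrV // mulr1.
  - exists (k ^ (- k1)); rewrite ?expfz_neq0 // => z; rewrite chib sb /W qX.
    by rewrite -scalerAl mul1r -!scalerAl -scalerAr; congr (_ *: _); ring.
  - exists (k ^ (- k2)); rewrite ?expfz_neq0 // => z; rewrite chic sc /W qX.
    by rewrite -scalerAl mul1r -!scalerAl -scalerAr; congr (_ *: _); ring.
  - exists (k ^ (- k3)); rewrite ?expfz_neq0 // => z; rewrite chid sd /W qX.
    by rewrite -scalerAl mul1r -!scalerAl -scalerAr; congr (_ *: _); ring.
have addaK z x : z + a + (x - a) = z + x by rewrite addrA (addrAC z) addrK.
exists (fun z => vec3 1 0 0 *m reg_mx (chi z)).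
apply: (@good_from_conic R S _ slope); first exact: slope_inj.
  move=> r; exists (reg_mx (chi (r + a) * (l 0)^-1)).
    by apply: reg_mx_unit => //; rewrite unitrM chiu unitrV.
  move=> x /chiE[t t0 tE]; exists t => //.
  by rewrite -addaK tE reg_mxZ reg_mxM // -scalemxAr mulmxA e0_linear.
(* Two such steps: r + x + y carries the class of a product of two linear polynomials, times a unit
   independent of x and y. *)
move=> r; exists (reg_mx (chi (r + a + a) * (l 0)^-1 * (l 0)^-1)).
  by apply: reg_mx_unit => //; rewrite !unitrM chiu !unitrV l0.
move=> x y /chiE[t t0 tE] /chiE[t' t'0 t'E]; exists (t * t'); first by rewrite mulf_neq0.
rewrite -(addaK (r + x) y) t'E (addrAC r x a) -(addaK (r + a) x) tE.
have -> : l (slope y) * (t *: (l (slope x) * (chi (r + a + a) * (l 0)^-1)) * (l 0)^-1)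
    = t *: ((l (slope x) * l (slope y)) * (chi (r + a + a) * (l 0)^-1 * (l 0)^-1)).
  by rewrite -!scalerAl -!scalerAr; congr (_ *: _); ring.
rewrite !reg_mxZ [reg_mx (_ * _ * _)]reg_mxM // -!scalemxAr !scalerA (mulrC t').
by rewrite mulmxA e0_quadratic.
Qed.
End Existence.

(** * The area of the convex hull of a Y-pin *)

Section Area.
Variable R : realType.
Local Notation mu := (@lebesgue_measure R).
Local Notation RM := (measurableTypeR R).
Local Notation mu2 := (@lebesgue_measure R \x @lebesgue_measure R)%E.
Local Open Scope classical_set_scope.

(** The image measure under the affine map, multiplied by |a|, gives every interval ]x, y] its
    length, so it is the Lebesgue measure. *)
Lemma lebesgue_affine (a b : R) (A : set RM) : a != 0 -> measurable A ->
  mu ((fun y => a * y + b) @^-1` A) = (`|a|^-1%:E * mu A)%E.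
Proof.
move=> a0 mA; pose f := (fun y : RM => a * y + b : RM).
have na0 : 0 < `|a| by rewrite normr_gt0.
have mf : measurable_fun setT f by apply: measurable_funD => //; exact: mulrl_measurable.
pose push : {measure set RM -> \bar R} :=
  measure_function_pushforward__canonical__measure_function_Measure mu mf.
have pushE B : mscale (NngNum (normr_ge0 a)) push B = (`|a|%:E * mu (f @^-1` B))%E.
  by [].
have key : mu A = mscale (NngNum (normr_ge0 a)) push A.
  apply: lebesgue_measure_unique => // _ [[x y]] _ <-.
  transitivity (`|a|%:E * mu (f @^-1` `]x, y]))%E; last by [].
  rewrite lebesgue_measure_itv /=.
  have [a_lt0|a_gt0|/eqP] := ltgtP a 0; last by rewrite (negPf a0).
  - have -> : f @^-1` `]x, y] = `[(y - b) / a, (x - b) / a[.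
      apply/seteqP; split=> z /=; rewrite !in_itv /= /f => /andP[h1 h2].
        by rewrite ler_ndivrMr // ltr_ndivlMr //; apply/andP; split; lra.
      by move: h1 h2; rewrite ler_ndivrMr // ltr_ndivlMr // => *; apply/andP; split; lra.
    rewrite lebesgue_measure_itv /= !lte_fin ltr_nM2r ?invr_lt0 // ltrD2r.
    case: ifP => _; rewrite ?mule0 // ltr0_norm // -!EFinB -EFinM; congr EFin; field.
    by rewrite a0.
  - have -> : f @^-1` `]x, y] = `](x - b) / a, (y - b) / a].
      apply/seteqP; split=> z /=; rewrite !in_itv /= /f => /andP[h1 h2].
        by rewrite ltr_pdivrMr // ler_pdivlMr //; apply/andP; split; lra.
      by move: h1 h2; rewrite ltr_pdivrMr // ler_pdivlMr // => *; apply/andP; split; lra.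
    rewrite lebesgue_measure_itv /= !lte_fin ltr_pM2r ?invr_gt0 // ltrD2r.
    case: ifP => _; rewrite ?mule0 // gtr0_norm // -!EFinB -EFinM; congr EFin; field.
    by rewrite a0.
by rewrite key pushE muleA -EFinM mulVf ?gt_eqF // mul1e.
Qed.

Lemma product_affine2 (a k t : R) (A : set (RM * RM)) : a != 0 -> measurable A ->
  mu2 ((fun z => (z.1, a * z.2 + k * z.1 + t)) @^-1` A) = (`|a|^-1%:E * mu2 A)%E.
Proof.
move=> a0 mA; rewrite /product_measure1 /=.
rewrite -ge0_integralZl //; last exact: measurable_fun_xsection.
apply: eq_integral => x _ /=.
rewrite -(lebesgue_affine (k * x + t) a0) //; last exact: measurable_xsection.
congr (mu _); apply/seteqP; split=> y /=; rewrite /xsection /= !inE /= addrA //.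
Qed.

(** The order of integration is exchanged, so that the one-dimensional formula applies to the
    sections in the first coordinate. *)
Lemma product_affine1 (a k t : R) (A : set (RM * RM)) : a != 0 -> measurable A ->
  measurable ((fun z => (a * z.1 + k * z.2 + t, z.2)) @^-1` A) ->
  mu2 ((fun z => (a * z.1 + k * z.2 + t, z.2)) @^-1` A) = (`|a|^-1%:E * mu2 A)%E.
Proof.
move=> a0 mA mA'.
have swap (B : set (RM * RM)) : measurable B -> mu2 B =
    (@lebesgue_measure R \x^ @lebesgue_measure R)%E B.
  by move=> mB; apply: product_measure_unique mB => C D mC mD; exact: product_measure2E.
rewrite !swap // /product_measure2 /=.
rewrite -ge0_integralZl //; last exact: measurable_fun_ysection.
apply: eq_integral => y _ /=.
rewrite -(lebesgue_affine (k * y + t) a0) //; last exact: measurable_ysection.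
congr (mu _); apply/seteqP; split=> x /=; rewrite /ysection /= !inE /= addrA //.
Qed.

Definition std_triangle : set (RM * RM) :=
  [set z | [/\ 0 <= z.1, 0 <= z.2 & z.1 + z.2 <= 1]].

Lemma measurable_halfplane (f : RM * RM -> RM) : measurable_fun setT f ->
  measurable [set z | 0 <= f z].
Proof.
move=> mf; have := mf measurableT `[0, +oo[ (measurable_itv _); rewrite setTI.
by congr (measurable _); apply/seteqP; split=> z /=; rewrite in_itv /= andbT.
Qed.

Lemma measurable_std_triangle : measurable std_triangle.
Proof.
have -> : std_triangle = [set z | 0 <= z.1] `&` [set z | 0 <= z.2]
    `&` [set z | 0 <= 1 - (z.1 + z.2)].
  apply/seteqP; split=> z /= [].
    by move=> *; do ?split => //; lra.
  by move=> [*]; split=> //; lra.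
apply: measurableI; first apply: measurableI; apply: measurable_halfplane.
- exact: measurable_fst.
- exact: measurable_snd.
- apply: measurable_funB => //; apply: measurable_funD.
    exact: measurable_fst.
  exact: measurable_snd.
Qed.

(* The exact value is 1/2; this bound by a staircase is good enough. *)
Lemma std_triangle_le : (mu2 std_triangle <= (2 / 3)%:E)%E.
Proof.
pose rect (x x' y : R) : set (RM * RM) := `[x, x'] `*` `[0, y].
have mrect x x' y : measurable (rect x x' y) by apply: measurableX; exact: measurable_itv.
have rectE x x' y : x < x' -> 0 < y -> mu2 (rect x x' y) = ((x' - x) * y)%:E.
  move=> xx' y0; rewrite /rect product_measure1E; try exact: measurable_itv.
  rewrite [LHS](_ : _ = (mu `[x, x'] * mu `[0%R, y])%E) //.
  by rewrite !lebesgue_measure_itv /= !lte_fin xx' y0 -!EFinB subr0.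
(* The rectangles have areas 1/3, 2/9 and 1/9. *)
have sub : std_triangle `<=` rect 0 (1/3) 1 `|` rect (1/3) (2/3) (2/3) `|` rect (2/3) 1 (1/3).
  move=> [x y] [/= x0 y0 xy]; rewrite /rect /= !in_itv /=.
  have [x1|x1] := lerP x (1/3).
    by left; left; split; apply/andP; split; lra.
  have [x2|x2] := lerP x (2/3).
    by left; right; split; apply/andP; split; lra.
  by right; split; apply/andP; split; lra.
set A1 := rect 0 _ _ in sub; set A2 := rect (1/3) _ _ in sub; set A3 := rect (2/3) _ _ in sub.
have [m1 m2 m3] : [/\ measurable A1, measurable A2 & measurable A3] by split; exact: mrect.
have m12 := measurableU _ _ m1 m2.
have m123 := measurableU _ _ m12 m3.
have h1 : (mu2 std_triangle <= mu2 (A1 `|` A2 `|` A3))%E.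
  by apply: le_measure; rewrite ?inE //; exact: measurable_std_triangle.
have h2 : (mu2 (A1 `|` A2 `|` A3) <= mu2 (A1 `|` A2) + mu2 A3)%E by exact: measureU2.
have h3 : (mu2 (A1 `|` A2) <= mu2 A1 + mu2 A2)%E by exact: measureU2.
apply: (le_trans h1); apply: (le_trans h2); apply: (le_trans (leeD2r _ h3)).
have -> : mu2 A1 = ((1 / 3 - 0) * 1)%:E by apply: rectE; lra.
have -> : mu2 A2 = ((2 / 3 - 1 / 3) * (2 / 3))%:E by apply: rectE; lra.
have -> : mu2 A3 = ((1 - 2 / 3) * (1 / 3))%:E by apply: rectE; lra.
by rewrite -!EFinD lee_fin; lra.
Qed.

Definition hull3 (p q s : R * R) : set (RM * RM) :=
  [set z | exists x y t : R, [/\ [/\ 0 <= x, 0 <= y & 0 <= t], x + y + t = 1,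
     z.1 = x * p.1 + y * q.1 + t * s.1 & z.2 = x * p.2 + y * q.2 + t * s.2]].

Definition tri_det (p q s : R * R) : R :=
  (q.1 - p.1) * (s.2 - p.2) - (q.2 - p.2) * (s.1 - p.1).

Lemma hull3_swap p q s : hull3 p q s = hull3 p s q.
Proof.
by apply/seteqP; split=> z [x [y [t [[x0 y0 t0] e e1 e2]]]];
  exists x, t, y; split; rewrite ?e1 ?e2 1?addrAC.
Qed.

(** The affine map onto the standard triangle is a composition of two maps changing one coordinate
    each, with factors e / dt and 1 / e. The pivot e is made nonzero by exchanging q and s if
    necessary. *)
Lemma hull3_measure p q s : tri_det p q s != 0 ->
  measurable (hull3 p q s) /\
  (mu2 (hull3 p q s) = `|tri_det p q s|%:E * mu2 std_triangle)%E.
Proof.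
wlog e10 : q s / q.1 - p.1 != 0 => [wl|].
  have [e0|] := eqVneq (q.1 - p.1) 0; last exact: wl.
  move=> D0; rewrite hull3_swap.
  have Dsw : tri_det p s q = - tri_det p q s by rewrite /tri_det; ring.
  have [||m e] := wl s q; rewrite ?Dsw ?oppr_eq0 //.
    by apply: contraNneq D0 => e0'; rewrite /tri_det e0 e0' mul0r mulr0 subrr.
  by rewrite Dsw normrN in e.
set e := q.1 - p.1 in e10 *; set dt := tri_det p q s => D0.
pose f1 := s.1 - p.1; pose e2 := q.2 - p.2; pose f2 := s.2 - p.2.
have dtE : dt = e * f2 - e2 * f1 by [].
(* The coordinates of [g1 (g2 z)] are the barycentric coordinates of z with respect to q and s. *)
pose g2 (z : RM * RM) : RM * RM :=
  (z.1, (e / dt) * z.2 + (- e2 / dt) * z.1 + (e2 * p.1 - e * p.2) / dt).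
pose g1 (z : RM * RM) : RM * RM := (e^-1 * z.1 + (- f1 / e) * z.2 + (- p.1 / e), z.2).
have mg1 (B : set (RM * RM)) : measurable B -> measurable (g1 @^-1` B).
  have mf : measurable_fun setT g1.
    apply/measurable_fun_pairP; split; rewrite /comp /=.
    - apply: measurable_funD => //; apply: measurable_funD;
        apply: measurable_funM => //; first [exact: measurable_fst|exact: measurable_snd].
    - exact: measurable_snd.
  by move=> mB; have := mf measurableT _ mB; rewrite setTI.
have mg2 (B : set (RM * RM)) : measurable B -> measurable (g2 @^-1` B).
  have mf : measurable_fun setT g2.
    apply/measurable_fun_pairP; split; rewrite /comp /=.
    - exact: measurable_fst.
    - apply: measurable_funD => //; apply: measurable_funD;
        apply: measurable_funM => //; first [exact: measurable_fst|exact: measurable_snd].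
  by move=> mB; have := mf measurableT _ mB; rewrite setTI.
have hE : hull3 p q s = g2 @^-1` (g1 @^-1` std_triangle).
  have g1E (z : RM * RM) : (g1 (g2 z)).1 = ((z.1 - p.1) * f2 - (z.2 - p.2) * f1) / dt.
    by rewrite /g1 /g2 /= dtE; field; rewrite -dtE D0 e10.
  have g2E (z : RM * RM) : (g1 (g2 z)).2 = (e * (z.2 - p.2) - e2 * (z.1 - p.1)) / dt.
    by rewrite /g1 /g2 /=; field.
  apply/seteqP; split=> [z [x [y [t [[x0 y0 t0] xyt z1 z2]]]]|z].
    have xE : x = 1 - y - t by lra.
    have zy : (g1 (g2 z)).1 = y.
      rewrite g1E z1 z2 xE; apply: (mulIf D0); rewrite divfK // dtE /e /f1 /e2 /f2; ring.
    have zt : (g1 (g2 z)).2 = t.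
      rewrite g2E z1 z2 xE; apply: (mulIf D0); rewrite divfK // dtE /e /f1 /e2 /f2; ring.
    by split; rewrite ?zy ?zt //; lra.
  move=> [h1 h2 h12]; exists (1 - (g1 (g2 z)).1 - (g1 (g2 z)).2), (g1 (g2 z)).1, (g1 (g2 z)).2.
  split; first by split=> //; lra.
  - by ring.
  - by rewrite g1E g2E dtE /e /f1 /e2 /f2; field; rewrite -/f1 -/f2 -/e -/e2 -dtE.
  - by rewrite g1E g2E dtE /e /f1 /e2 /f2; field; rewrite -/f1 -/f2 -/e -/e2 -dtE.
have mst := measurable_std_triangle.
split; first by rewrite hE; apply: mg2; exact: mg1.
rewrite hE product_affine2 ?mulf_neq0 ?invr_eq0 //; last exact: mg1.
rewrite product_affine1 ?invr_eq0 //; last exact: mg1.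
rewrite muleA -EFinM; congr (_%:E * _)%E.
by rewrite -!normfV -normrM; congr `|_|; field; rewrite e10 D0.
Qed.

(** Take for tau the smallest ratio w_i / al_i with al_i > 0; where al_j <= 0, subtracting tau al_j
    does not decrease w_j. *)
Lemma min_ratio (n : nat) (w al : 'I_n -> R) (i0 : 'I_n) :
    0 < al i0 -> (forall i, 0 <= w i) ->
  exists i tau, [/\ 0 < al i, w i = tau * al i & forall j, 0 <= w j - tau * al j].
Proof.
move=> al0 w0; pose ratio i := w i / al i.
case: (@arg_minP _ _ _ i0 (fun i => 0 < al i) ratio al0) => i ali imin.
exists i, (w i / al i); split=> // [|j]; first by rewrite divfK ?gt_eqF.
have tau0 : 0 <= w i / al i by rewrite divr_ge0 // ltW.
have [alj|alj] := ltP 0 (al j); first by rewrite subr_ge0 -ler_pdivlMr //; exact: imin.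
by rewrite subr_ge0 (le_trans _ (w0 j)) // mulr_ge0_le0.
Qed.

Definition part (al : R) (A : set (RM * RM)) : set (RM * RM) :=
  if 0 < al then A else set0.

(* Subtracting from the weights the largest admissible multiple of the affine
   relation cancels a weight whose coefficient is positive. *)
Lemma hull4_triangles (p q s t : R * R) (p0 q0 s0 t0 : R) :
    [|| 0 < p0, 0 < q0, 0 < s0 | 0 < t0] -> p0 + q0 + s0 + t0 = 0 ->
    p0 * p.1 + q0 * q.1 + s0 * s.1 + t0 * t.1 = 0 ->
    p0 * p.2 + q0 * q.2 + s0 * s.2 + t0 * t.2 = 0 ->
  hull4 p q s t = part p0 (hull3 q s t) `|` part q0 (hull3 p s t)
    `|` part s0 (hull3 p q t) `|` part t0 (hull3 p q s).
Proof.
move=> pos sum0 rel1 rel2; apply/seteqP; split=> z; last first.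
  rewrite /part; case=> [[[|]|]|].
  - case: ifP => // _ [x [y [u [[? ? ?] e e1 e2]]]].
    by exists 0, x, y, u; split; split=> //; rewrite ?mul0r !add0r.
  - case: ifP => // _ [x [y [u [[? ? ?] e e1 e2]]]].
    by exists x, 0, y, u; split; split=> //; rewrite ?mul0r addr0.
  - case: ifP => // _ [x [y [u [[? ? ?] e e1 e2]]]].
    by exists x, y, 0, u; split; split=> //; rewrite ?mul0r addr0.
  - case: ifP => // _ [x [y [u [[? ? ?] e e1 e2]]]].
    by exists x, y, u, 0; split; split=> //; rewrite ?mul0r addr0.
move=> [w1 [w2 [w3 [w4 [[w1_ge0 w2_ge0 w3_ge0 w4_ge0] [wE z1E z2E]]]]]].
pose w (i : 'I_4) := [:: w1; w2; w3; w4]`_i; pose al (i : 'I_4) := [:: p0; q0; s0; t0]`_i.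
have [i0 al0] : exists i0, 0 < al i0.
  by case/or4P: pos; [exists 0|exists 1|exists 2%:R|exists 3%:R].
have [|i [tau [ali wi wj]]] := min_ratio (w := w) al0.
  by case=> [[|[|[|[|]]]]].
have /= h0 := wj 0; have /= h1 := wj 1; have /= h2 := wj 2%:R; have /= h3 := wj 3%:R.
have e1 : z.1 = (w1 - tau * p0) * p.1 + (w2 - tau * q0) * q.1 + (w3 - tau * s0) * s.1
    + (w4 - tau * t0) * t.1.
  by rewrite z1E -[LHS]subr0 -(mulr0 tau) -rel1; ring.
have e2 : z.2 = (w1 - tau * p0) * p.2 + (w2 - tau * q0) * q.2 + (w3 - tau * s0) * s.2
    + (w4 - tau * t0) * t.2.
  by rewrite z2E -[LHS]subr0 -(mulr0 tau) -rel2; ring.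
have e0 : (w1 - tau * p0) + (w2 - tau * q0) + (w3 - tau * s0) + (w4 - tau * t0) = 1.
  by rewrite -wE -[RHS]subr0 -(mulr0 tau) -sum0; ring.
case: i ali wi => [[|[|[|[|//]]]] lt_i]; rewrite /al /w /= => ali wi.
- left; left; left; rewrite /part ali.
  exists (w2 - tau * q0), (w3 - tau * s0), (w4 - tau * t0); move: e0 e1 e2.
  by rewrite wi subrr !mul0r !add0r.
- left; left; right; rewrite /part ali.
  exists (w1 - tau * p0), (w3 - tau * s0), (w4 - tau * t0); move: e0 e1 e2.
  by rewrite wi subrr !mul0r !addr0.
- left; right; rewrite /part ali.
  exists (w1 - tau * p0), (w2 - tau * q0), (w4 - tau * t0); move: e0 e1 e2.
  by rewrite wi subrr !mul0r !addr0.
- right; rewrite /part ali.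
  exists (w1 - tau * p0), (w2 - tau * q0), (w3 - tau * s0); move: e0 e1 e2.
  by rewrite wi subrr !mul0r !addr0.
Qed.

Lemma part_measure (al : R) (p q s : R * R) : `|tri_det p q s| = `|al| ->
  measurable (part al (hull3 p q s)) /\
  (mu2 (part al (hull3 p q s)) <= (Num.max 0 al * (2 / 3))%:E)%E.
Proof.
rewrite /part => e; case: ltrP => al0; last by rewrite measure0 mul0r.
have [|m ->] := @hull3_measure p q s.
  by rewrite -normr_gt0 e normr_gt0 gt_eqF.
rewrite e gtr0_norm // EFinM; split=> //.
by apply: lee_wpmul2l std_triangle_le; rewrite lee_fin ltW.
Qed.

(** The triangles opposite to the points with positive coefficients cover the hull, and the
    determinant of each is that coefficient up to sign. *)
Lemma hull_area_le (S : Ypin) : (hull_area R S <= ((degree S)%:~R * (2 / 3))%:E)%E.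
Proof.
rewrite /hull_area.
set p := point_of_Z2 R (pa S); set q := point_of_Z2 R (pb S).
set s := point_of_Z2 R (pc S); set t := point_of_Z2 R (pd S).
have pos : [|| 0 < coef_a S, 0 < coef_b S, 0 < coef_c S | 0 < coef_d S].
  have [k1 [k2 [k3 k1E]]] := coef_bezout S.
  apply: contra_eqT k1E; rewrite !negb_or /coef_a -!leNgt => /and4P[ha hb hc hd].
  have [-> -> ->] : [/\ coef_b S = 0, coef_c S = 0 & coef_d S = 0] by split; lia.
  by rewrite !mulr0.
have relP : [/\ (coef_a S)%:~R + (coef_b S)%:~R + (coef_c S)%:~R + (coef_d S)%:~R = 0 :> R,
    (coef_a S)%:~R * p.1 + (coef_b S)%:~R * q.1 + (coef_c S)%:~R * s.1
      + (coef_d S)%:~R * t.1 = 0 &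
    (coef_a S)%:~R * p.2 + (coef_b S)%:~R * q.2 + (coef_c S)%:~R * s.2
      + (coef_d S)%:~R * t.2 = 0].
  rewrite /p /q /s /t /point_of_Z2 /coef_a /coef_b /coef_c /coef_d /det2 /=.
  by rewrite !(mulrNz, intrD, intrM); split; ring.
have [rel0 rel1 rel2] := relP.
have detP : [/\ `|tri_det q s t| = `|(coef_a S)%:~R|, `|tri_det p s t| = `|(coef_b S)%:~R|,
    `|tri_det p q t| = `|(coef_c S)%:~R| & `|tri_det p q s| = `|(coef_d S)%:~R|].
  rewrite /tri_det /p /q /s /t /point_of_Z2 /coef_a /coef_b /coef_c /coef_d /det2 /=.
  rewrite !(mulrNz, intrD, intrM).
  split; try (by congr `|_|; ring); rewrite -normrN; congr `|_|; ring.
have [da db dc dd] := detP; have [ma la] := part_measure da; have [mb lb] := part_measure db.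
have [mc lc] := part_measure dc; have [md ld] := part_measure dd.
rewrite (hull4_triangles _ rel0 rel1 rel2) ?ltr0z //.
have mab := measurableU _ _ ma mb; have mabc := measurableU _ _ mab mc.
apply: (le_trans (measureU2 _ mabc md)); apply: (le_trans (leeD2r _ (measureU2 _ mab mc))).
apply: (le_trans (leeD2r _ (leeD2r _ (measureU2 _ ma mb)))).
apply: (le_trans (leeD (leeD (leeD la lb) lc) ld)).
rewrite -!EFinD lee_fin -!mulrDl ler_wpM2r ?divr_ge0 //.
have maxE (n : int) : Num.max 0 n%:~R = (Num.max 0 n)%:~R :> R.
  by rewrite !maxEle ler0z; case: ifP.
by rewrite !maxE /degree !intrD.
Qed.

(** The area is at least 3/2, so the rough area bound gives a degree of at least 9/4, and the degree
    is an integer. *)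
Lemma degree_ge3 (S : Ypin) : (2%:E <= D R S)%E -> 3 <= degree S.
Proof.
have := hull_area_le S; rewrite /D; case: (hull_area R S) => [r| |] //.
  rewrite lee_fin -EFinM -EFinB lee_fin => h1 h2.
  have : (2%:~R : R) < (degree S)%:~R by move: h1 h2; lra.
  by rewrite ltr_int; lia.
by move=> _; rewrite gt0_muleNy // lte_fin.
Qed.
End Area.

(** * The value of m_2(S) *)

Theorem proposition6p4 (R : realType) (S : Ypin) (hD : (2%:E <= D R S)%E) :
  (m2 R S)%:Z = Num.max ((pc S).2 - (pa S).2) ((pd S).2 - (pb S).2).
Proof.
have good_ex := exists_good R (degree_ge3 hD).
have [? ? ? ?] := width_bounds S.
suff -> : m2 R S = width S by lia.
have min_width : reducible_to R S (width S) /\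
    forall k, reducible_to R S k -> (width S <= k)%N.
  by split=> [|k]; [exact: reducible_width|exact: lower_bound].
(* A least order exists, so the default value of [xget] does not arise, and least orders are
   unique. *)
rewrite /m2; case: xgetP => [n -> [red_n n_min]|none]; last by have := none _ min_width.
by apply/eqP; rewrite eqn_leq; apply/andP; split; [exact: n_min min_width.1|exact: min_width.2].
Qed.
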